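(* Let $D_+:\mathrm{Dom}(D_+)\to\mathcal H$ be a closed densely defined operator on a Hilbert space $\mathcal H$, let $D_-:=(D_+)^*$, and let $A\in\mathcal L(\mathcal H)$. Assume that (1) $D_+$ is normal; (2) $A$ and $A^*$ map $\mathrm{Dom}(D_+)$ into itself; (3) $[D_+,A^*]+[A,D_-]:\mathrm{Dom}(D_-)\to\mathcal H$ extends to a bounded operator on $\mathcal H$. Suppose that $A\in \mathrm{OP}^0$ (with respect to $\Delta=D_+D_-$) and that there exists $n_0\in\mathbb N$ such that $(1+\Delta)^{-i-1}F(1+\Delta)^{-n_0+i}$ is of trace class for all $i\in\{0,\ldots,n_0-1\}$. Then the homological index $\mathrm{H\text{-}Ind}_n(T_\lambda)$ exists for all $\lambda\in(0,\infty)$ and all $n\ge n_0$. Furthermore, for each $n\ge n_0$, the map $z\mapsto z^n\cdot\mathrm{Tr}\big((z+\Delta_2)^{-n}-(z+\Delta_1)^{-n}\big)$ provides a holomorphic extension of $\lambda\mapsto \mathrm{H\text{-}Ind}_n(T_\lambda)$ to the open set $\mathbb C\setminus(-\infty,0]$.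
   Context: $\mathcal L(\mathcal H)$ denotes the bounded operators and $\mathcal L^1(\mathcal H)$ the trace class operators on $\mathcal H$; $\mathbb N=\{1,2,\dots\}$. Normality means $D_+D_-=D_-D_+$, and then $\mathrm{Dom}(D_+)=\mathrm{Dom}(D_-)$. Put $\mathcal D_+:=D_++A$ and $\mathcal D_-:=(\mathcal D_+)^*=D_-+A^*$, $\Delta:=D_+D_-=D_-D_+$, $\Delta_1:=\mathcal D_+\mathcal D_-$, $\Delta_2:=\mathcal D_-\mathcal D_+$. Under (1)–(3) one has $\mathrm{Dom}(\Delta_1)=\mathrm{Dom}(\Delta_2)=\mathrm{Dom}(\Delta)$, and the commutator $\mathcal D_+\mathcal D_--\mathcal D_-\mathcal D_+:\mathrm{Dom}(\Delta)\to\mathcal H$ extends to a bounded operator, denoted $F\in\mathcal L(\mathcal H)$. $\mathrm{OP}^0\subset\mathcal L(\mathcal H)$ is the $*$-algebra of bounded operators $T$ such that for all $k\in\mathbb N$: $\mathrm{Dom}(\Delta^{k/2})$ is invariant under $T$, and the iterated commutator $\delta^k(T):\mathrm{Dom}(\Delta^{k/2})\to\mathcal H$, defined by $\delta(T)=[\Delta^{1/2},T]$, $\delta^k(T)=[\Delta^{1/2},\delta^{k-1}(T)]$, extends to a bounded operator on $\mathcal H$. For $\lambda>0$ let $T_\lambda:=\lambda^{-1/2}\mathcal D_+(1+\lambda^{-1}\mathcal D_-\mathcal D_+)^{-1/2}$. The homological index of a bounded operator $T$ in degree $n$ exists if $(1-T^*T)^n-(1-TT^* )^n$ is of trace class, and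 is then $\mathrm{H\text{-}Ind}_n(T):=\mathrm{Tr}\big((1-T^*T)^n-(1-TT^* )^n\big)$. One has $1-T_\lambda^*T_\lambda=\lambda(\lambda+\Delta_2)^{-1}$ and $1-T_\lambda T_\lambda^*=\lambda(\lambda+\Delta_1)^{-1}$. *)

(* Defs.v *)
From HB Require Import structures.
From mathcomp Require Import all_boot all_order all_algebra.
From mathcomp Require Import all_classical all_reals all_analysis summability.
From mathcomp Require Import complex.

Set Implicit Arguments.
Unset Strict Implicit.
Unset Printing Implicit Defensive.

Import Order.TTheory GRing.Theory Num.Theory.
Import numFieldNormedType.Exports.

Local Open Scope classical_set_scope.
Local Open Scope ring_scope.
Local Open Scope complex_scope.

(* An operator on H, bounded or not, is represented by its graph, a subset of
   H * H. Equality of operators is then equality of sets, so it includes the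
   equality of the domains, and sums and products carry their maximal natural
   domains. *)
Section OperatorCalculus.
Variables (C : numFieldType) (H : normedModType C).
Implicit Types (S T : set (H * H)) (c : C) (V : set H).

Definition dom T : set H := [set x | exists y, T (x, y)].

Definition app T (x : H) : H := xget 0 [set y | T (x, y)].

(* c%:Op is multiplication by c, with domain H. *)
Definition opcst c : set (H * H) := [set p | p.2 = c *: p.1].

Definition opadd S T : set (H * H) :=
  [set p | exists y z, [/\ S (p.1, y), T (p.1, z) & p.2 = y + z]].

Definition opscale c T : set (H * H) :=
  [set p | exists2 y, T (p.1, y) & p.2 = c *: y].

Definition opsub S T : set (H * H) := opadd S (opscale (-1) T).

(* opmul S T is "first T, then S". *)
Definition opmul S T : set (H * H) := (S \; T)%relation.

Definition oppow T (n : nat) : set (H * H) := iter n (opmul T) (opcst 1).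

Definition opinv T : set (H * H) := (T^-1)%relation.

Definition comm S T : set (H * H) := opsub (opmul S T) (opmul T S).

Definition is_operator T : Prop :=
  [/\ T (0, 0),
      forall c x y x' y', T (x, y) -> T (x', y') ->
        T (c *: x + x', c *: y + y')
    & forall x y y', T (x, y) -> T (x, y') -> y = y'].

Definition bounded_op T : Prop :=
  [/\ is_operator T, dom T = setT
    & exists M : C, forall x y, T (x, y) -> `|y| <= M * `|x|].

Definition extends_to_bounded T : Prop :=
  exists2 B, bounded_op B & T `<=` B.

(* The bounded extension; it is unique when T is densely defined. *)
Definition bounded_ext T : set (H * H) :=
  xget set0 [set B | bounded_op B /\ T `<=` B].

Definition maps_into_itself T V : Prop :=
  forall x y, V x -> T (x, y) -> V y.

(* delta^k(T) for delta(T) = [S, T]. If T leaves Dom(S^j) invariant for all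
   j <= k, the domain of this graph is exactly Dom(S^k). *)
Fixpoint iter_comm S (k : nat) T : set (H * H) :=
  if k is k'.+1 then comm S (iter_comm S k' T) else T.

End OperatorCalculus.

Declare Scope op_scope.
Delimit Scope op_scope with op.
Notation "c %:Op" := (@opcst _ _ c%R)
  (at level 2, format "c %:Op") : op_scope.
Notation "S + T" := (opadd S T) : op_scope.
Notation "S - T" := (opsub S T) : op_scope.
Notation "S * T" := (opmul S T) : op_scope.
Notation "c *: T" := (opscale c%R T) : op_scope.
Notation "T ^+ n" := (oppow T n) : op_scope.
Notation "T ^-1" := (opinv T) : op_scope.
Notation "T ^- n" := (oppow (opinv T) n) : op_scope.
Notation "[ 'comm' S , T ]" := (comm S T)
  (at level 0, format "[ 'comm'  S ,  T ]") : op_scope.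

Section HilbertSpace.
Variables (R : realType) (H : completeNormedModType R[i]).
(* The form ip is linear in its first and antilinear in its second argument. *)
Variable ip : {dot H for Num.conj}.
Implicit Types (S T G : set (H * H)) (E : set H).

(* The adjoint graph; it is single-valued iff T is densely defined. *)
Definition adj T : set (H * H) :=
  [set p | forall x y, T (x, y) -> ip y p.1 = ip x p.2].

Local Notation "T ^*" := (adj T) : op_scope.

Definition normal_op T : Prop := (T * T^* = T^* * T)%op.

Definition selfadjoint T : Prop :=
  [/\ is_operator T, dense (dom T) & adj T = T].

Definition nonneg_op T : Prop := forall x y, T (x, y) -> 0 <= ip y x.

(* G^{1/2}: the nonnegative selfadjoint operator with square G. *)
Definition opsqrt G : set (H * H) :=
  xget set0 [set S | [/\ selfadjoint S, nonneg_op S & (S * S)%op = G]].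

Definition OP0 (Delta T : set (H * H)) : Prop :=
  bounded_op T /\
  forall k : nat, (0 < k)%N ->
    maps_into_itself T (dom (opsqrt Delta ^+ k)%op) /\
    extends_to_bounded (iter_comm (opsqrt Delta) k T).

Definition orthonormal_basis E : Prop :=
  [/\ forall e, E e -> ip e e = 1,
      forall e f, E e -> E f -> e <> f -> ip e f = 0
    & forall x, (forall e, E e -> ip x e = 0) -> x = 0].

(* H need not be separable: bases are sets of vectors of any cardinality. *)
Definition trace_class T : Prop :=
  bounded_op T /\
  forall E, orthonormal_basis E ->
    (\esum_(e in E)
       (complex.Re (ip (app (opsqrt (T^* * T)%op) e) e))%:E < +oo)%E.

(* The trace is computed in one chosen orthonormal basis, as the limit of the
   net of finite partial sums. *)
Definition Tr T : R[i] :=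
  summability.sum (((fun e => ip (app T e) e)
    \_ (xget set0 [set E | orthonormal_basis E])) : H -> R[i]^o).

Definition hind_op (n : nat) T : set (H * H) :=
  ((1%:Op - T^* * T) ^+ n - (1%:Op - T * T^*) ^+ n)%op.

Definition HInd_exists (n : nat) T : Prop :=
  bounded_op T /\ trace_class (hind_op n T).

Definition HInd (n : nat) T : R[i] := Tr (hind_op n T).

(* X^{-1/2} is taken to be (X^{-1})^{1/2}. *)
Definition Tlam (D : set (H * H)) (lam : R) : set (H * H) :=
  ((Num.sqrt lam)^-1%:C *:
     (D * opsqrt ((1%:Op + lam^-1%:C *: (D^* * D))^-1)))%op.

End HilbertSpace.

Definition slit_plane (R : realType) : set R[i] :=
  ~` [set x%:C | x in [set x : R | x <= 0]].

Definition holomorphic_on (R : realType) (U : set R[i]) (f : R[i] -> R[i]) :=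
  forall z, U z -> derivable (f : R[i]^o -> R[i]^o) z 1.

(* Main.v *)
Require Import Defs.
From HB Require Import structures.
From mathcomp Require Import all_boot all_order all_algebra.
From mathcomp Require Import all_classical all_reals all_analysis.
From mathcomp Require Import complex ring lra zify finmap.

Set Implicit Arguments.
Unset Strict Implicit.
Unset Printing Implicit Defensive.

Import Order.TTheory GRing.Theory Num.Theory.
Import numFieldNormedType.Exports Normc.

Local Open Scope classical_set_scope.
Local Open Scope ring_scope.
Local Open Scope complex_scope.

(** The powers of the resolvents of the two Laplacians are compared by
    telescoping. With [R_j (z) = (z + Delta_j)^-1] and the second resolvent
    identity [R_2 - R_1 = R_2 F R_1],
<<
  R_2 (z)^n - R_1 (z)^n = sum_(i < n) R_2 (z)^(i+1) F R_1 (z)^(n-i).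
>>
    Put [U_j (z) = (1 + Delta_j) R_j (z)], a bounded operator which depends
    holomorphically on [z] in the slit plane. The [i]-th term is
    [U_2 (z)^(i+1) L_i U_1 (z)^(n-i)], where the operator
    [L_i = R_2 (1)^(i+1) F R_1 (1)^(n-i)] does not depend on [z]
    ([res_power_difference]). It therefore suffices that the [L_i] are of trace
    class for [n >= n0]: the trace of each term is then a holomorphic function
    ([quad_diff_Tr]), and [H-Ind_n] is the value of [z^n Tr (...)] at
    [z = lam] because [1 - T^* T = lam R_2 (lam)] and [1 - T T^* = lam R_1 (lam)]
    ([Tlam_bop]).

    The assumption concerns the unperturbed resolvent [r = (1 + Delta)^-1], so
    one needs [R_1 (1)^k = r^k B] with [B] bounded, and dually
    [R_2 (1)^k = B' r^k]. By the uniform boundedness principle such a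
    factorization follows from the inclusion of the ranges ([range_factor]), and
    the range of [r^k] is [Dom Delta^k]. The question is thus one of regularity:
    the range of [R_j (1)^k] has to be contained in [Dom Delta^k]. Let
    [S = Delta^(1/2)]. If [A] and [A^*] preserve all the domains [Dom S^m], a
    bootstrap argument shows that [Delta_j x] in [Dom S^m] implies [x] in
    [Dom S^(m+2)] ([perturb_scale]), and the inclusion follows by iteration
    ([perturb_res_range]). That [A] preserves the scale is part of the condition
    defining [OP^0]. For [A^*] one uses the commutators: [S] maps [A^* x] to
    [A^* S x - delta (A)^* x], and similarly for the adjoints of the
    [delta^k (A)], so that the degree of regularity grows by induction
    ([smooth_adj_scale]).

    Everything rests on a small amount of operator theory which is developed
    from the projection theorem: von Neumann's theorem on [T^* T]
    ([square_nonneg_sa]), resolvents on the slit plane, square roots of bounded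
    operators and, through [r^2 = (1 + G)^-1], of unbounded ones ([opsqrtP]).
    Functional calculus is avoided: the comparison of [D_+], [D_-] and [S], which
    have the same square, goes through the core [Dom Delta] ([form_domain]).
    Trace class operators are handled through a bound for the sums of
    [|<V f W e, e>|] which is uniform in the norms of [V] and [W] ([summing]). It
    is equivalent to the finiteness of the trace of [|f|] by Douglas' lemma, and
    it makes the ideal property and the continuity of the trace immediate. *)

(** * Hilbert spaces *)

Section RealNorm.
Variables (R : realType) (H : completeNormedModType R[i]).

(** The norm of [H] takes its values in [R[i]]; estimates are made with its real
    value [hN]. *)
Definition hN (x : H) : R := complex.Re `|x|.

Lemma normr_hN (x : H) : `|x| = (hN x)%:C.
Proof. by rewrite /hN RRe_real// normr_real. Qed.

Lemma hN_ge0 x : 0 <= hN x.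
Proof. by rewrite -ler0c -normr_hN. Qed.

Lemma hND x y : hN (x + y) <= hN x + hN y.
Proof. by rewrite -lecR rmorphD /= -!normr_hN ler_normD. Qed.

Lemma normC_normc (c : R[i]) : `|c| = (normc c)%:C.
Proof. by []. Qed.

Lemma hNZ c x : hN (c *: x) = normc c * hN x.
Proof. by apply: complexI; rewrite rmorphM/= -!normr_hN normrZ. Qed.

Lemma hNN x : hN (- x) = hN x.
Proof. by rewrite /hN normrN. Qed.

Lemma hN0 : hN 0 = 0.
Proof. by rewrite /hN normr0. Qed.

Lemma hN0_eq0 x : hN x = 0 -> x = 0.
Proof. by move=> h; apply/eqP; rewrite -normr_eq0 normr_hN h. Qed.

Lemma hNB x y : hN (x - y) = hN (y - x).
Proof. by rewrite -hNN opprB. Qed.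

Lemma hN_cauchy (u : nat -> H) :
  (forall e : R, 0 < e -> exists n0, forall m n, (n0 <= m)%N -> (n0 <= n)%N ->
     hN (u m - u n) <= e) ->
  exists l, forall e : R, 0 < e -> exists n0, forall n, (n0 <= n)%N ->
     hN (u n - l) <= e.
Proof.
move=> cu.
have : cvg (u @ \oo).
  apply: cauchy_cvg; apply: cauchy_exP => e e0.
  have re : 0 < complex.Re e by move: e0; rewrite ltcE => /andP[].
  have [n0 h] := cu (complex.Re e / 2) (divr_gt0 re (ltr0Sn _ 1)).
  exists (u n0); exists n0 => // n /= n0n.
  rewrite -ball_normE /= normr_hN.
  have -> : e = (complex.Re e)%:C by rewrite RRe_real// realE ltW.
  rewrite ltcR (le_lt_trans (h _ _ (leqnn _) n0n))//.
  by rewrite ltr_pdivrMr// ltr_pMr// ltr1n.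
move=> /cvg_ex[l /cvgrPdist_le ul]; exists l => e e0.
have eC : 0 < e%:C by rewrite ltcR.
have [n0 _ h] := ul _ eC; exists n0 => n /h /=.
by rewrite normr_hN hNB lecR.
Qed.

Lemma real_eps0 (a : R) : (forall e : R, 0 < e -> a <= e) -> a <= 0.
Proof.
move=> h; rewrite leNgt; apply/negP => a0.
have := h (a / 2) (divr_gt0 a0 (ltr0Sn _ 1)); lra.
Qed.

Lemma hN_eps0 x : (forall e : R, 0 < e -> hN x <= e) -> x = 0.
Proof.
move=> h; apply: hN0_eq0; apply/eqP; rewrite eq_le hN_ge0 andbT.
exact: real_eps0.
Qed.

End RealNorm.

Section NormC.
Variable R : realType.
Implicit Types a b c : R[i].

Lemma normcr (t : R) : normc t%:C = `|t|.
Proof. by rewrite /= expr0n addr0 sqrtr_sqr. Qed.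

Lemma normc_ge0 c : 0 <= normc c.
Proof. by rewrite -ler0c -normC_normc. Qed.

Lemma normc_conj c : normc (Num.conj c) = normc c.
Proof. by apply: complexI; rewrite -!normC_normc norm_conjC. Qed.

Lemma normc_sqr c : ((normc c) ^+ 2)%:C = c * Num.conj c.
Proof. by rewrite rmorphXn /= -normCK normC_normc. Qed.

Lemma Re_le_normc c : complex.Re c <= normc c.
Proof.
have := normc_ge_Re c; rewrite normC_normc lecR.
by apply: le_trans; exact: ler_norm.
Qed.

Lemma conjC_realC (t : R) : Num.conj (t%:C) = t%:C.
Proof. by rewrite conj_Creal// complex_real. Qed.

Lemma ReD a b : complex.Re (a + b) = complex.Re a + complex.Re b.
Proof. by case: a b => ? ? []. Qed.

Lemma ReN a : complex.Re (- a) = - complex.Re a.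
Proof. by case: a. Qed.

End NormC.

Section PsdForm.
Variables (R : realType) (V : lmodType R[i]) (B : V -> V -> R[i]).

(** The projection theorem is needed on [H] and, for graphs, on [H * H]; the
    abstract form serves both without a Hilbert space structure on the product. *)
Record psd_form : Prop := PsdForm {
  pfD : forall x y z, B (x + y) z = B x z + B y z;
  pfZ : forall c x z, B (c *: x) z = c * B x z;
  pfC : forall x y, B y x = Num.conj (B x y);
  pfpos : forall x, 0 <= B x x }.

Hypothesis psdB : psd_form.

Definition qf (x : V) : R := complex.Re (B x x).

Lemma qfE x : B x x = (qf x)%:C.
Proof. by rewrite RRe_real// realE (pfpos psdB). Qed.

Lemma qf_ge0 x : 0 <= qf x.
Proof. by rewrite -ler0c -qfE (pfpos psdB). Qed.

Lemma pfN x z : B (- x) z = - B x z.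
Proof. by rewrite -scaleN1r (pfZ psdB) mulN1r. Qed.

Lemma pfDr x y z : B x (y + z) = B x y + B x z.
Proof.
by rewrite (pfC psdB) (pfD psdB) rmorphD/= -!(pfC psdB).
Qed.

Lemma pfZr c x z : B x (c *: z) = Num.conj c * B x z.
Proof.
by rewrite (pfC psdB) (pfZ psdB) rmorphM/= -(pfC psdB).
Qed.

Lemma pfNr x z : B x (- z) = - B x z.
Proof. by rewrite (pfC psdB) pfN rmorphN/= -(pfC psdB). Qed.

Lemma qfN x : qf (- x) = qf x.
Proof. by rewrite /qf pfN pfNr opprK. Qed.

Lemma qf_line x y (t : R) :
  qf (x - (t%:C * B x y) *: y) =
  qf x - 2 * t * normc (B x y) ^+ 2 + t ^+ 2 * normc (B x y) ^+ 2 * qf y.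
Proof.
have := normc_sqr (B x y); move: (normc _ ^+ 2) => b bE.
apply: complexI; rewrite -qfE !rmorphD rmorphN !rmorphM/= -!qfE rmorph_nat bE.
rewrite (pfD psdB) pfN (pfZ psdB) !pfDr !pfNr !pfZr rmorphM/= conjC_realC.
by rewrite (pfC psdB x y); ring.
Qed.

Lemma cauchy_schwarz x y : normc (B x y) ^+ 2 <= qf x * qf y.
Proof.
set b := normc _ ^+ 2; have b0 : 0 <= b by exact: exprn_ge0 (normc_ge0 _).
have key t : 0 <= qf x - 2 * t * b + t ^+ 2 * b * qf y.
  by rewrite /b -qf_line qf_ge0.
have x0 := qf_ge0 x; have := qf_ge0 y; rewrite le_eqVlt => /predU1P[y0|y0].
  rewrite -y0 mulr0 leNgt; apply/negP => bp.
  have := key ((qf x + 1) / (2 * b)).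
  rewrite -y0 mulr0 addr0.
  have -> : 2 * ((qf x + 1) / (2 * b)) * b = qf x + 1 by field; rewrite gt_eqF.
  lra.
have := key (qf y)^-1.
have -> : qf x - 2 * (qf y)^-1 * b + (qf y)^-1 ^+ 2 * b * qf y = qf x - b / qf y.
  by field; rewrite gt_eqF.
by rewrite subr_ge0 ler_pdivrMr.
Qed.

Lemma parallelogram x y : qf (x + y) + qf (x - y) = 2 * qf x + 2 * qf y.
Proof.
apply: complexI; rewrite !rmorphD !rmorphM/= -!qfE !(pfD psdB, pfN, pfDr, pfNr).
ring.
Qed.

Lemma qfZ c x : qf (c *: x) = normc c ^+ 2 * qf x.
Proof.
apply: complexI; rewrite rmorphM/= normc_sqr -!qfE (pfZ psdB) pfZr; ring.
Qed.

Definition qf_complete := forall u : nat -> V,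
  (forall e : R, 0 < e -> exists n0, forall m n, (n0 <= m)%N -> (n0 <= n)%N ->
     qf (u m - u n) <= e) ->
  exists l, forall e : R, 0 < e -> exists n0, forall n, (n0 <= n)%N ->
     qf (u n - l) <= e.

Definition subspace (W : set V) :=
  W 0 /\ forall c x y, W x -> W y -> W (c *: x + y).

Lemma subspaceZ W c x : subspace W -> W x -> W (c *: x).
Proof. by move=> [W0 Wl] Wx; rewrite -[_ *: _]addr0; exact: Wl. Qed.

Lemma subspaceD W x y : subspace W -> W x -> W y -> W (x + y).
Proof. by move=> [W0 Wl] Wx Wy; rewrite -[x]scale1r; exact: Wl. Qed.

Lemma subspaceB W x y : subspace W -> W x -> W y -> W (x - y).
Proof.
by move=> sW Wx Wy; rewrite addrC -scaleN1r; apply: sW.2.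
Qed.

Lemma qf_archi (e : R) : 0 < e -> exists n0, forall n, (n0 <= n)%N ->
  n.+1%:R^-1 <= e.
Proof.
move=> e0; exists (Num.truncn e^-1) => n nn.
rewrite -[leRHS]invrK lef_pV2 ?posrE ?invr_gt0 ?ltr0n//.
by rewrite ltW// (lt_le_trans (truncnS_gt _))// ler_nat ltnS.
Qed.

(** A minimizing sequence of the distance from [h] to [W] is a Cauchy sequence by
    the parallelogram identity. Its limit [p] is only asked to be approximable
    from [W], since [W] need not be closed. *)
Lemma orthogonal_projection (W : set V) (h : V) :
  qf_complete -> subspace W ->
  exists p, (forall e : R, 0 < e -> exists2 w, W w & qf (p - w) <= e) /\
            (forall w, W w -> B w (h - p) = 0).
Proof.
move=> cV sW.
pose E := [set qf (h - w) | w in W].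
have infE : has_inf E.
  split; first by exists (qf (h - 0)); exists 0 => //; case: sW.
  by exists 0 => _ [w _ <-]; exact: qf_ge0.
have /choice[u uP] : forall n, exists v, W v /\ qf (h - v) <= inf E + n.+1%:R^-1.
  move=> n.
  have n0 : 0 < n.+1%:R^-1 :> R by rewrite invr_gt0 ltr0n.
  by have [_ [w Ww <-] wE] := inf_adherent n0 infE; exists w; split=> //; exact: ltW.
have ub w : W w -> inf E <= qf (h - w).
  by move=> Ww; apply: inf_lbound; [case: infE | exists w].
have cu m n : qf (u m - u n) <= 2 * m.+1%:R^-1 + 2 * n.+1%:R^-1.
  have [Wm qm] := uP m; have [Wn qn] := uP n.
  have := parallelogram (h - u n) (h - u m).
  have -> : h - u n - (h - u m) = u m - u n.
    by rewrite opprB [LHS]addrC subrKA.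
  have -> : h - u n + (h - u m) = 2%:C *: (h - 2^-1%:C *: (u n + u m)).
    rewrite scalerBr scalerA -rmorphM/= divff ?pnatr_eq0// scale1r.
    by rewrite rmorph_nat scaler_nat mulr2n addrACA opprD.
  rewrite qfZ normcr ger0_norm ?ler0n//.
  have := ub _ (subspaceZ 2^-1%:C sW (subspaceD sW Wn Wm)).
  move: qm qn; move: (m.+1%:R^-1) (n.+1%:R^-1) => a b; lra.
have [e e0|p up] := cV u.
  have [n0 h0] := qf_archi (divr_gt0 e0 (ltr0Sn _ 3)); exists n0 => m n mn nn.
  rewrite (le_trans (cu _ _))//; have := h0 _ mn; have := h0 _ nn.
  move: (m.+1%:R^-1) (n.+1%:R^-1) => a b; lra.
exists p; split=> [e e0|w Ww].
  have [n0 h0] := up _ e0; exists (u n0); first by have [] := uP n0.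
  by rewrite -qfN opprB h0.
have small (e : R) : 0 < e -> normc (B w (h - p)) <= e.
  move=> e0; set K := qf w + 1; have K0 : 0 < K.
    by rewrite /K; have := qf_ge0 w; lra.
  pose d := (e / 2) ^+ 2 / K.
  have d0 : 0 < d by rewrite divr_gt0// exprn_gt0// divr_gt0.
  have [n1 h1] := up _ d0; have [n2 h2] := qf_archi d0.
  pose n := maxn n1 n2.
  have {}h1 := h1 n (leq_maxl _ _); have {}h2 := h2 n (leq_maxr _ _).
  have [Wn qn] := uP n.
  have -> : h - p = (h - u n) + (u n - p) by rewrite addrA subrK.
  rewrite pfDr (le_trans (le_normcD _ _))// [e]splitr lerD//.
    rewrite -(@ler_pXn2r _ 2) ?nnegrE ?normc_ge0//; last by rewrite divr_ge0// ltW.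
    have -> : (e / 2) ^+ 2 = d * K by rewrite /d divfK// gt_eqF.
    rewrite -ler_pdivrMr//.
    set b : R := normc _ ^+ 2.
    have b0 : 0 <= b by exact: exprn_ge0 (normc_ge0 _).
    have bE : normc (B (h - u n) w) ^+ 2 = b by rewrite (pfC psdB) normc_conj.
    (* Moving [u n] along [w] by the step [K^-1] cannot bring it nearer to [h]
       than the infimum, which makes [B (h - u n) w] small. *)
    have Wl : W (u n + (K^-1%:C * B (h - u n) w) *: w).
      by rewrite addrC; apply: sW.2.
    have := ub _ Wl; rewrite opprD addrA qf_line bE => hb.
    have iK : K^-1 * K = 1 by rewrite mulVf// gt_eqF.
    have iK0 : 0 < K^-1 by rewrite invr_gt0.
    have qK : qf w = K - 1 by rewrite /K addrK.
    have E1 : K^-1 ^+ 2 * b * qf w = b * K^-1 - K^-1 ^+ 2 * b.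
      by rewrite qK; field; rewrite gt_eqF.
    have : 0 <= K^-1 ^+ 2 * b by rewrite mulr_ge0// exprn_ge0// ltW.
    have h3 : qf (h - u n) <= inf E + d by rewrite (le_trans qn)// lerD2l.
    move: hb h3; rewrite E1; move: (inf E) (qf (h - u n)) (K^-1) => t1 t2 t3; lra.
  rewrite -(@ler_pXn2r _ 2) ?nnegrE ?normc_ge0//; last by rewrite divr_ge0// ltW.
  rewrite (le_trans (cauchy_schwarz _ _))//.
  have -> : (e / 2) ^+ 2 = K * d by rewrite /d mulrCA mulfV ?gt_eqF// mulr1.
  by apply: ler_pM; rewrite ?qf_ge0// /K lerDl.
by apply: eq0_normc; apply/eqP; rewrite eq_le normc_ge0 andbT; exact: real_eps0.
Qed.

End PsdForm.

(** As a class, the compatibility of the norm with the form is passed on without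
    being mentioned in every step. *)
Class hilbert (R : realType) (H : completeNormedModType R[i])
  (ip : {dot H for Num.conj}) : Prop :=
  norm_ipE : forall x : H, `|x| ^+ 2 = ip x x.

Section Hilbert.
Variables (R : realType) (H : completeNormedModType R[i]).
Variable ip : {dot H for Num.conj}.
Context {ipH : hilbert ip}.
Implicit Types (x y z : H) (c : R[i]).

Lemma psd_ip : psd_form ip.
Proof.
split=> [x y z|c x z|x y|x]; last exact: dnorm_ge0.
- exact: linearDl.
- exact: linearZl_LR.
- by rewrite hermC mul1r.
Qed.

Lemma ipDl x y z : ip (x + y) z = ip x z + ip y z.
Proof. exact: (pfD psd_ip). Qed.
Lemma ipDr x y z : ip x (y + z) = ip x y + ip x z.
Proof. exact: (pfDr psd_ip). Qed.
Lemma ipZl c x z : ip (c *: x) z = c * ip x z.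
Proof. exact: (pfZ psd_ip). Qed.
Lemma ipZr c x z : ip x (c *: z) = Num.conj c * ip x z.
Proof. exact: (pfZr psd_ip). Qed.
Lemma ipNl x z : ip (- x) z = - ip x z.
Proof. exact: (pfN psd_ip). Qed.
Lemma ipNr x z : ip x (- z) = - ip x z.
Proof. exact: (pfNr psd_ip). Qed.
Lemma ipBl x y z : ip (x - y) z = ip x z - ip y z.
Proof. by rewrite ipDl ipNl. Qed.
Lemma ipBr x y z : ip x (y - z) = ip x y - ip x z.
Proof. by rewrite ipDr ipNr. Qed.
Lemma ip0l z : ip 0 z = 0.
Proof. by rewrite -(scale0r (0 : H)) ipZl mul0r. Qed.
Lemma ip0r z : ip z 0 = 0.
Proof. by rewrite -(scale0r (0 : H)) ipZr rmorph0 mul0r. Qed.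
Lemma ipC x y : ip y x = Num.conj (ip x y).
Proof. exact: (pfC psd_ip). Qed.

Definition ipE := (ipDl, ipDr, ipNl, ipNr, ipZl, ipZr, ip0l, ip0r).

Lemma ip_conj0 x y : ip x y = 0 -> ip y x = 0.
Proof. by move=> e; rewrite ipC e rmorph0. Qed.

Lemma ip_hN x : ip x x = (hN x ^+ 2)%:C.
Proof. by rewrite -norm_ipE normr_hN rmorphXn. Qed.

Lemma qf_ip x : qf ip x = hN x ^+ 2.
Proof. by rewrite /qf ip_hN. Qed.

Lemma ip_eq0 x : ip x x = 0 -> x = 0.
Proof. by move/eqP; rewrite dnorm_eq0 => /eqP. Qed.

Lemma ip_CS x y : normc (ip x y) <= hN x * hN y.
Proof.
rewrite -(@ler_pXn2r _ 2) ?nnegrE ?normc_ge0 ?mulr_ge0 ?hN_ge0//.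
by rewrite exprMn -!qf_ip; exact: cauchy_schwarz psd_ip _ _.
Qed.

Lemma ip_inj x y : (forall z, ip z x = ip z y) -> x = y.
Proof.
move=> h; apply/eqP; rewrite -subr_eq0; apply/eqP; apply: ip_eq0.
by rewrite ipBr h subrr.
Qed.

Lemma sq_le (a b : R) : 0 <= a -> 0 <= b -> (a ^+ 2 <= b ^+ 2) = (a <= b).
Proof. by move=> a0 b0; rewrite ler_pXn2r. Qed.

Lemma qf_complete_ip : qf_complete ip.
Proof.
move=> u cu; have [e e0|l ul] := @hN_cauchy _ _ u.
  have [n0 h] := cu _ (exprn_gt0 2 e0); exists n0 => m n mn nn.
  by rewrite -sq_le ?hN_ge0 ?(ltW e0)// -qf_ip; exact: h.
exists l => e e0; have [n0 h] := ul (Num.sqrt e) ltac:(by rewrite sqrtr_gt0).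
exists n0 => n /h {}h; rewrite qf_ip -[leRHS]sqr_sqrtr ?(ltW e0)//.
by rewrite sq_le ?hN_ge0 ?sqrtr_ge0.
Qed.

Definition ip2 (p q : H * H) := ip p.1 q.1 + ip p.2 q.2.

Lemma psd_ip2 : psd_form ip2.
Proof.
split=> [x y z|c x z|x y|x]; rewrite /ip2/=.
- by rewrite !ipDl addrACA.
- by rewrite !ipZl mulrDr.
- by rewrite rmorphD/= -!ipC.
- by rewrite addr_ge0.
Qed.

Lemma qf_ip2 p : qf ip2 p = hN p.1 ^+ 2 + hN p.2 ^+ 2.
Proof. by rewrite /qf /ip2 ReD -/(qf ip _) qf_ip -/(qf ip _) qf_ip. Qed.

Lemma qf_complete_ip2 : qf_complete ip2.
Proof.
move=> u cu.
have [e e0|l1 u1] := @hN_cauchy _ _ (fst \o u).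
  have [n0 h] := cu _ (exprn_gt0 2 e0); exists n0 => m n mn nn.
  rewrite -sq_le ?hN_ge0 ?(ltW e0)//; apply: le_trans (h m n mn nn).
  by rewrite qf_ip2 lerDl sqr_ge0.
have [e e0|l2 u2] := @hN_cauchy _ _ (snd \o u).
  have [n0 h] := cu _ (exprn_gt0 2 e0); exists n0 => m n mn nn.
  rewrite -sq_le ?hN_ge0 ?(ltW e0)//; apply: le_trans (h m n mn nn).
  by rewrite qf_ip2 lerDr sqr_ge0.
exists (l1, l2) => e e0.
have e2 : 0 < e / 2 by lra.
have [n1 h1] := u1 (Num.sqrt (e / 2)) ltac:(by rewrite sqrtr_gt0).
have [n2 h2] := u2 (Num.sqrt (e / 2)) ltac:(by rewrite sqrtr_gt0).
exists (maxn n1 n2) => n; rewrite geq_max => /andP[/h1 {}h1 /h2 {}h2].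
rewrite qf_ip2 [e]splitr -[e / 2]sqr_sqrtr ?(ltW e2)// lerD// sq_le ?sqrtr_ge0//.
- exact: hN_ge0.
- exact: hN_ge0.
Qed.

Definition adherent (W : set H) x :=
  forall e : R, 0 < e -> exists2 w, W w & hN (x - w) <= e.

(** For subspaces this is density, in the form in which orthogonality arguments
    prove and use it. *)
Definition total (W : set H) := forall h, (forall w, W w -> ip w h = 0) -> h = 0.

Lemma projection_exists (W : set H) h : subspace W ->
  exists2 p, adherent W p & forall w, W w -> ip w (h - p) = 0.
Proof.
move=> sW; have [p [pW po]] := orthogonal_projection psd_ip h qf_complete_ip sW.
exists p => // e e0; have [w Ww pw] := pW _ (exprn_gt0 2 e0); exists w => //.
by rewrite -sq_le ?hN_ge0 ?(ltW e0)// -qf_ip.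
Qed.

Lemma adherent_seq (W : set H) x : adherent W x -> exists u : nat -> H,
  (forall n, W (u n)) /\ forall n, hN (x - u n) <= n.+1%:R^-1.
Proof.
move=> a.
have /choice[u uP] : forall n, exists v, W v /\ hN (x - v) <= n.+1%:R^-1.
  move=> n; have n0 : 0 < n.+1%:R^-1 :> R by rewrite invr_gt0 ltr0n.
  by have [v Wv xv] := a _ n0; exists v.
by exists u; split=> n; have [] := uP n.
Qed.

Lemma total_adherent (W : set H) : subspace W -> total W -> forall x, adherent W x.
Proof.
move=> sW tW x; have [p pW po] := projection_exists x sW.
by have /eqP := tW _ po; rewrite subr_eq0 => /eqP ->.
Qed.

Lemma adherent_total (W : set H) : (forall x, adherent W x) -> total W.
Proof.
move=> aW h hW; apply: ip_eq0; apply: eq0_normc; apply/eqP.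
rewrite eq_le normc_ge0 andbT; apply: real_eps0 => e e0.
have k0 : 0 < hN h + 1 by rewrite ltr_wpDl// hN_ge0.
have [w Ww hw] := aW h _ (divr_gt0 e0 k0).
have -> : ip h h = ip (h - w) h by rewrite ipBl (hW _ Ww) subr0.
rewrite (le_trans (ip_CS _ _))// (le_trans (ler_wpM2r (hN_ge0 _) hw))//.
by rewrite mulrAC ler_pdivrMr// ler_wpM2l ?(ltW e0)// lerDl.
Qed.

Lemma hN_ball x y (e : R[i]) : ball x e y = (`|x - y| < e) :> Prop.
Proof. by rewrite -ball_normE. Qed.

Lemma dense_adherent (W : set H) : dense W <-> forall x, adherent W x.
Proof.
split=> [dW x e e0|aW U [x Ux] oU].
  have eC : 0 < e%:C :> R[i] by rewrite ltcR.
  have [oB Bx] := ball_open_nbhs x eC.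
  have [y [xy Wy]] := dW (ball x e%:C) (ex_intro _ x Bx) oB.
  by exists y => //; move: xy; rewrite hN_ball normr_hN ltcR => /ltW.
have /nbhs_ballP[e /= e0 eU] : nbhs x U by apply: open_nbhs_nbhs.
have eE : e = (complex.Re e)%:C by rewrite RRe_real// realE ltW.
have re : 0 < complex.Re e / 2 by move: e0; rewrite eE ltcR /=; lra.
have [w Ww xw] := aW x _ re; exists w; split=> //; apply: eU.
rewrite hN_ball normr_hN eE ltcR (le_lt_trans xw)//.
by move: re; move: (complex.Re e) => t; lra.
Qed.

End Hilbert.

(** * Bounded operators *)

Section BoundedOperators.
Variables (R : realType) (H : completeNormedModType R[i]).

(** Bundling makes the everywhere defined bounded operators a ring under
    composition, so that identities between resolvents become ring identities. *)
Record bop := Bop {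
  bfun :> H -> H;
  bop_lin : forall c x y, bfun (c *: x + y) = c *: bfun x + bfun y;
  bop_bnd : exists M : R, forall x, hN (bfun x) <= M * hN x }.

HB.instance Definition _ := gen_eqMixin bop.
HB.instance Definition _ := gen_choiceMixin bop.

Lemma bopP (f g : bop) : (forall x, f x = g x) -> f = g.
Proof.
case: f g => [f lf bf] [g lg bg] /= /funext fg; subst g.
by congr Bop; exact: Prop_irrelevance.
Qed.

Definition bnd (f : H -> H) (M : R) := forall x, hN (f x) <= M * hN x.

Lemma bop_bnd_gt0 (f : bop) : exists2 M : R, 0 < M & bnd f M.
Proof.
have [M h] := bop_bnd f; exists (`|M| + 1); first by rewrite ltr_wpDl.
move=> x; apply: le_trans (h x) _; rewrite ler_wpM2r ?hN_ge0//.
by rewrite (le_trans (ler_norm _))// lerDl.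
Qed.

Fact bop_add_lin (f g : bop) c x y :
  f (c *: x + y) + g (c *: x + y) = c *: (f x + g x) + (f y + g y).
Proof. by rewrite !bop_lin scalerDr addrACA. Qed.
Fact bnd_add (f g : H -> H) M N : bnd f M -> bnd g N ->
  bnd (fun x => f x + g x) (M + N).
Proof. by move=> hf hg x; rewrite (le_trans (hND _ _))// mulrDl lerD. Qed.
Fact bop_add_bnd (f g : bop) : exists M, bnd (fun x => f x + g x) M.
Proof.
have [M hM] := bop_bnd f; have [N hN] := bop_bnd g; exists (M + N).
exact: bnd_add.
Qed.
Definition bop_add f g := Bop (@bop_add_lin f g) (bop_add_bnd f g).

Fact bop_scale_lin (a : R[i]) (f : bop) c x y :
  a *: f (c *: x + y) = c *: (a *: f x) + a *: f y.
Proof. by rewrite bop_lin scalerDr !scalerA mulrC. Qed.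
Fact bnd_scale (a : R[i]) (f : H -> H) M : bnd f M ->
  bnd (fun x => a *: f x) (normc a * M).
Proof. by move=> hf x; rewrite hNZ -mulrA ler_wpM2l ?normc_ge0. Qed.
Fact bop_scale_bnd (a : R[i]) (f : bop) : exists M, bnd (fun x => a *: f x) M.
Proof. by have [M hM] := bop_bnd f; exists (normc a * M); exact: bnd_scale. Qed.
Definition bop_scale a f := Bop (@bop_scale_lin a f) (bop_scale_bnd a f).

Fact bop0_lin (c : R[i]) (x y : H) : (0 : H) = c *: (0 : H) + 0.
Proof. by rewrite scaler0 addr0. Qed.
Fact bop0_bnd : exists M, bnd (fun _ => 0) M.
Proof. by exists 0 => x; rewrite hN0 mul0r. Qed.
Definition bop0 := Bop bop0_lin bop0_bnd.

Fact bop1_bnd : exists M, bnd (fun x => x) M.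
Proof. by exists 1 => x; rewrite mul1r. Qed.
Definition bop1 := Bop (fun c x y => erefl (c *: x + y)) bop1_bnd.

Fact bop_mul_lin (f g : bop) c x y : f (g (c *: x + y)) = c *: f (g x) + f (g y).
Proof. by rewrite !bop_lin. Qed.
Fact bnd_mul (f g : H -> H) M N : 0 <= M -> bnd f M -> bnd g N ->
  bnd (fun x => f (g x)) (M * N).
Proof.
by move=> M0 hf hg x; rewrite (le_trans (hf _))// -mulrA ler_wpM2l.
Qed.
Fact bop_mul_bnd (f g : bop) : exists M, bnd (fun x => f (g x)) M.
Proof.
have [M M0 hM] := bop_bnd_gt0 f; have [N hN] := bop_bnd g.
by exists (M * N); apply: bnd_mul => //; exact: ltW.
Qed.
Definition bop_mul f g := Bop (@bop_mul_lin f g) (bop_mul_bnd f g).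

Fact bop_addA : associative bop_add.
Proof. by move=> f g h; apply: bopP => x /=; rewrite addrA. Qed.
Fact bop_addC : commutative bop_add.
Proof. by move=> f g; apply: bopP => x /=; rewrite addrC. Qed.
Fact bop_add0 : left_id bop0 bop_add.
Proof. by move=> f; apply: bopP => x /=; rewrite add0r. Qed.
Fact bop_addN : left_inverse bop0 (bop_scale (-1)) bop_add.
Proof. by move=> f; apply: bopP => x /=; rewrite scaleN1r addNr. Qed.
HB.instance Definition _ :=
  GRing.isZmodule.Build bop bop_addA bop_addC bop_add0 bop_addN.

Fact bop_mulA : associative bop_mul. Proof. by move=> f g h; exact: bopP. Qed.
Fact bop_mul1 : left_id bop1 bop_mul. Proof. by move=> f; exact: bopP. Qed.
Fact bop_mulr1 : right_id bop1 bop_mul. Proof. by move=> f; exact: bopP. Qed.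
Fact bop_mulDl : left_distributive bop_mul +%R.
Proof. by move=> f g h; exact: bopP. Qed.
Fact bop_mulDr : right_distributive bop_mul +%R.
Proof.
move=> f g h; apply: bopP => x /=.
by rewrite -[X in f (X + _)]scale1r bop_lin scale1r.
Qed.
HB.instance Definition _ := GRing.Zmodule_isPzRing.Build bop
  bop_mulA bop_mul1 bop_mulr1 bop_mulDl bop_mulDr.

Fact bop_scaleA a b f : bop_scale a (bop_scale b f) = bop_scale (a * b) f.
Proof. by apply: bopP => x /=; rewrite scalerA. Qed.
Fact bop_scale1 : left_id 1 bop_scale.
Proof. by move=> f; apply: bopP => x /=; rewrite scale1r. Qed.
Fact bop_scaleDr : right_distributive bop_scale +%R.
Proof. by move=> a f g; apply: bopP => x /=; rewrite scalerDr. Qed.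
Fact bop_scaleDl f : {morph bop_scale^~ f : a b / a + b}.
Proof. by move=> a b; apply: bopP => x /=; rewrite scalerDl. Qed.
HB.instance Definition _ := GRing.Zmodule_isLmodule.Build R[i] bop
  bop_scaleA bop_scale1 bop_scaleDr bop_scaleDl.

Implicit Types f g : bop.

Lemma bopDE f g x : (f + g) x = f x + g x. Proof. by []. Qed.
Lemma bopNE f x : (- f) x = - f x. Proof. exact: scaleN1r. Qed.
Lemma bopBE f g x : (f - g) x = f x - g x.
Proof. by rewrite bopDE bopNE. Qed.
Lemma bopZE a f x : (a *: f) x = a *: f x. Proof. by []. Qed.
Lemma bopME f g x : (f * g) x = f (g x). Proof. by []. Qed.
Lemma bop1E x : (1 : bop) x = x. Proof. by []. Qed.
Lemma bop0E x : (0 : bop) x = 0. Proof. by []. Qed.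
Lemma bopXS f n x : (f ^+ n.+1) x = f ((f ^+ n) x).
Proof. by rewrite exprS. Qed.
Lemma bopXSr f n x : (f ^+ n.+1) x = (f ^+ n) (f x).
Proof. by rewrite exprSr. Qed.
Lemma bopX0 f x : (f ^+ 0) x = x. Proof. by []. Qed.
Definition bE := (bopDE, bopNE, bopZE, bopME, bop1E, bop0E).

Lemma bopD f x y : f (x + y) = f x + f y.
Proof. by rewrite -[x]scale1r bop_lin !scale1r. Qed.
Lemma bop0r f : f 0 = 0.
Proof. by apply: (addrI (f 0)); rewrite -bopD !addr0. Qed.
Lemma bopZ f c x : f (c *: x) = c *: f x.
Proof. by rewrite -[c *: x]addr0 bop_lin bop0r addr0. Qed.
Lemma bopN f x : f (- x) = - f x.
Proof. by rewrite -scaleN1r bopZ scaleN1r. Qed.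
Lemma bopB f x y : f (x - y) = f x - f y.
Proof. by rewrite bopD bopN. Qed.

Lemma bop_scaleAl c f g : c *: (f * g) = (c *: f) * g.
Proof. exact: bopP. Qed.
Lemma bop_scaleAr c f g : c *: (f * g) = f * (c *: g).
Proof. by apply: bopP => x; rewrite !bE bopZ. Qed.

Lemma bop_commE f g x : GRing.comm f g -> f (g x) = g (f x).
Proof. by move=> fg; rewrite -!bopME fg. Qed.

Lemma bop_exprZ c f n : (c *: f) ^+ n = c ^+ n *: f ^+ n.
Proof.
elim: n => [|n IH]; first by rewrite !expr0 scale1r.
by rewrite !exprS IH -bop_scaleAl -bop_scaleAr scalerA.
Qed.

(** The sum telescopes in this order of the factors although [f] and [g] need
    not commute. *)
Lemma bop_subrXX f g n :
  f ^+ n - g ^+ n = \sum_(i < n) f ^+ i * (f - g) * g ^+ (n.-1 - i).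
Proof.
elim: n => [|n IH]; first by rewrite big_ord0 subrr.
rewrite big_ord_recr /= subnn expr0 mulr1 -[LHS](subrKA (f ^+ n * g)).
rewrite exprSr [in LHS]exprSr -mulrBr -mulrBl addrC; congr (_ + _).
rewrite IH mulr_suml; apply: eq_bigr => -[i /= ilt] _.
rewrite -[LHS]mulrA -exprSr; congr (_ * _ ^+ _).
by case: n ilt {IH} => //= n ilt; rewrite subSn.
Qed.

Lemma bnd_adherent f (W : set H) x : adherent W x -> (forall w, W w -> f w = 0) -> f x = 0.
Proof.
move=> ax fW; have [M M0 fM] := bop_bnd_gt0 f; apply: hN_eps0 => e e0.
have [w Ww xw] := ax _ (divr_gt0 e0 M0).
have -> : f x = f (x - w) by rewrite bopB (fW _ Ww) subr0.
by rewrite (le_trans (fM _))// -ler_pdivlMl// mulrC.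
Qed.

End BoundedOperators.
Arguments bnd_add {R H f g M N}.
Arguments bnd_mul {R H f g M N}.
Arguments ip_inj {R H} ip {x y}.

Section Adjoint.
Variables (R : realType) (H : completeNormedModType R[i]).
Variable ip : {dot H for Num.conj}.
Context {ipH : hilbert ip}.
Local Notation bop := (bop H).
Implicit Types (x y z : H) (c : R[i]) (f g : bop).

(** The vector is found in the orthogonal complement of the kernel of [phi]. *)
Lemma riesz (phi : H -> R[i]) (M : R) :
  (forall c x y, phi (c *: x + y) = c * phi x + phi y) ->
  (forall x, normc (phi x) <= M * hN x) ->
  exists g : H, forall x, phi x = ip x g.
Proof.
move=> lin bd.
have phi0 : phi 0 = 0.
  by apply: (addrI (phi 0)); rewrite -{1}[phi 0]mul1r -lin scale1r !addr0.
have phiD x y : phi (x + y) = phi x + phi y.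
  by rewrite -[x]scale1r lin mul1r scale1r.
have phiZ c x : phi (c *: x) = c * phi x by rewrite -[c *: x]addr0 lin phi0 addr0.
have phiN x : phi (- x) = - phi x by rewrite -scaleN1r phiZ mulN1r.
have [/(_ _)|/existsNP[x0 x00]] := pselect (forall x, phi x = 0).
  by move=> h; exists 0 => x; rewrite h ip0r.
pose W : set H := [set x | phi x = 0].
have sW : subspace W.
  by split=> //= c x y Wx Wy; rewrite /W/= lin Wx Wy mulr0 addr0.
have [p pW po] := projection_exists x0 sW.
have phip : phi p = 0.
  apply: eq0_normc; apply/eqP; rewrite eq_le normc_ge0 andbT.
  apply: real_eps0 => e e0.
  have M0 : 0 < `|M| + 1 by rewrite ltr_wpDl.
  have [w Ww pw] := pW _ (divr_gt0 e0 M0).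
  have -> : phi p = phi (p - w) by rewrite phiD phiN Ww subr0.
  rewrite (le_trans (bd _))// (@le_trans _ _ ((`|M| + 1) * hN (p - w)))//.
    by rewrite ler_wpM2r ?hN_ge0// (le_trans (ler_norm _))// lerDl.
  by rewrite -ler_pdivlMl// mulrC.
pose g0 := x0 - p.
have phig0 : phi g0 != 0 by rewrite phiD phiN phip subr0; exact/eqP.
have gg : ip g0 g0 != 0.
  apply/eqP => /ip_eq0 g00; move: phig0; rewrite g00 phi0 eqxx//.
exists (Num.conj (phi g0 / ip g0 g0) *: g0) => x.
have /po : W (x - (phi x / phi g0) *: g0).
  by rewrite /W/= phiD phiN phiZ divfK// subrr.
rewrite -/g0 ipBl ipZl => /eqP; rewrite subr_eq0 => /eqP xg.
rewrite ipZr conjCK xg; move: gg phig0.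
by move: (ip g0 g0) (phi g0) (phi x) => a b c a0 b0; field; rewrite a0 b0.
Qed.

Lemma badj_exists f : exists g : bop, forall x y, ip (f x) y = ip x (g y).
Proof.
have [M M0 fM] := bop_bnd_gt0 f.
have /choice[g gP] : forall y, exists z, forall x, ip (f x) y = ip x z.
  move=> y; apply: (@riesz _ (M * hN y)) => [c x z|x].
    by rewrite bop_lin ipDl ipZl.
  rewrite (le_trans (ip_CS _ _))// mulrAC ler_wpM2r ?hN_ge0//.
have glin c x y : g (c *: x + y) = c *: g x + g y.
  by apply: (ip_inj ip) => z; rewrite -gP !ipE !gP.
have gbd : exists M, bnd g M.
  exists M => y; have [->|gy] := eqVneq (hN (g y)) 0.
    by rewrite mulr_ge0 ?hN_ge0// ltW.
  have gy0 : 0 < hN (g y) by rewrite lt_def gy hN_ge0.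
  rewrite -(ler_pM2l gy0) -expr2 -lecR -ip_hN -gP.
  apply: (@le_trans _ _ (normc (ip (f (g y)) y))%:C).
    have -> : ip (f (g y)) y = (hN (g y) ^+ 2)%:C by rewrite gP ip_hN.
    by rewrite normcr lecR ler_norm.
  rewrite lecR (le_trans (ip_CS _ _))//.
  by rewrite mulrA (mulrC _ M) ler_wpM2r ?hN_ge0.
by exists (Bop glin gbd) => x y; rewrite gP.
Qed.

Definition badj f : bop := xget 0 [set g : bop | forall x y, ip (f x) y = ip x (g y)].

Lemma badjP f x y : ip (f x) y = ip x (badj f y).
Proof. exact: (xgetPex 0 (badj_exists f)). Qed.

Lemma badjPr f x y : ip (badj f x) y = ip x (f y).
Proof. by rewrite ipC -badjP -ipC. Qed.

Lemma badj_uniq f g : (forall x y, ip (f x) y = ip x (g y)) -> badj f = g.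
Proof. by move=> h; apply: bopP => y; apply: (ip_inj ip) => x; rewrite -badjP h. Qed.

Lemma badjK f : badj (badj f) = f.
Proof. by apply: badj_uniq => x y; rewrite badjPr. Qed.

Lemma badjM f g : badj (f * g) = badj g * badj f.
Proof. by apply: badj_uniq => x y; rewrite !bE !badjP. Qed.

Lemma badj1 : badj 1 = 1.
Proof. exact: badj_uniq. Qed.

Lemma badjX f n : badj (f ^+ n) = badj f ^+ n.
Proof.
by elim: n => [|n IH]; [exact: badj1 | rewrite exprS badjM IH exprSr].
Qed.

Lemma badjD f g : badj (f + g) = badj f + badj g.
Proof. by apply: badj_uniq => x y; rewrite !bE !ipE !badjP. Qed.

Lemma badjN f : badj (- f) = - badj f.
Proof. by apply: badj_uniq => x y; rewrite !bE !ipE !badjP. Qed.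

Lemma badj_bnd f M : 0 <= M -> bnd f M -> bnd (badj f) M.
Proof.
move=> M0 fM y; have [->|gy] := eqVneq (hN (badj f y)) 0.
  by rewrite mulr_ge0 ?hN_ge0.
have gy0 : 0 < hN (badj f y) by rewrite lt_def gy hN_ge0.
rewrite -(ler_pM2l gy0) -expr2 -lecR -ip_hN -badjP.
apply: (@le_trans _ _ (normc (ip (f (badj f y)) y))%:C).
  by rewrite badjP ip_hN normcr lecR ler_norm.
rewrite lecR (le_trans (ip_CS _ _))//.
by rewrite mulrA (mulrC _ M) ler_wpM2r ?hN_ge0.
Qed.

Lemma sa_inj_total f : badj f = f -> injective f -> total ip (range f).
Proof.
move=> fs fi h hf; apply: fi; rewrite bop0r; apply: (ip_inj ip) => x.
by rewrite ip0r -{1}fs -badjP hf//; exists x.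
Qed.

Lemma range_subspace f : subspace (range f).
Proof.
split; first by exists 0 => //; exact: bop0r.
by move=> c _ _ [x _ <-] [y _ <-]; exists (c *: x + y) => //; rewrite bop_lin.
Qed.

End Adjoint.
Arguments badj {R H} ip f.

Section OperatorNormLimits.
Variables (R : realType) (H : completeNormedModType R[i]).
Local Notation bop := (bop H).
Implicit Types (f g : bop) (M N e : R).

Lemma bbndD f g M N : bnd f M -> bnd g N -> bnd (f + g) (M + N).
Proof. exact: bnd_add. Qed.
Lemma bbndM f g M N : 0 <= M -> bnd f M -> bnd g N -> bnd (f * g) (M * N).
Proof. exact: bnd_mul. Qed.
Lemma bbndN f M : bnd f M -> bnd (- f) M.
Proof. by move=> h x; rewrite bopNE hNN. Qed.
Lemma bbndB f g M N : bnd f M -> bnd g N -> bnd (f - g) (M + N).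
Proof. by move=> hf hg; apply: bbndD hf (bbndN hg). Qed.
Lemma bbndZ (a : R[i]) f M : bnd f M -> bnd (a *: f) (normc a * M).
Proof. exact: bnd_scale. Qed.
Lemma bbnd1 : bnd (1 : bop) 1.
Proof. by move=> x; rewrite mul1r. Qed.
Lemma bbnd0 : bnd (0 : bop) 0.
Proof. by move=> x; rewrite hN0 mul0r. Qed.
Lemma bnd_le f M N : M <= N -> bnd f M -> bnd f N.
Proof. by move=> MN h x; rewrite (le_trans (h x))// ler_wpM2r ?hN_ge0. Qed.
Lemma bnd_eps0 f K : (forall e, 0 < e -> bnd f (K * e)) -> f = 0.
Proof.
move=> h; apply: bopP => x; apply: hN_eps0 => e e0.
pose k := (`|K| + 1) * (hN x + 1).
have k0 : 0 < k by rewrite mulr_gt0// ltr_wpDl// hN_ge0.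
have ek : 0 < e / k by rewrite divr_gt0.
rewrite (le_trans (h _ ek x))//.
apply: (@le_trans _ _ ((`|K| + 1) * (e / k) * (hN x + 1))).
  apply: (@le_trans _ _ ((`|K| + 1) * (e / k) * hN x)).
    rewrite ler_wpM2r ?hN_ge0// ler_wpM2r ?(ltW ek)//.
    by rewrite (le_trans (ler_norm _))// lerDl.
  by rewrite ler_wpM2l ?lerDl// mulr_ge0 ?(ltW ek)// addr_ge0.
by rewrite mulrAC -/k mulrC divfK// gt_eqF.
Qed.

Lemma bop_complete (u : nat -> bop) :
  (forall e, 0 < e -> exists n0, forall m n, (n0 <= m)%N -> (n0 <= n)%N ->
     bnd (u m - u n) e) ->
  exists f, forall e, 0 < e -> exists n0, forall n, (n0 <= n)%N ->
     bnd (f - u n) e.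
Proof.
move=> cu.
have /choice[f fP] : forall x, exists l, forall e, 0 < e ->
    exists n0, forall n, (n0 <= n)%N -> hN (u n x - l) <= e.
  move=> x; apply: hN_cauchy => e e0.
  have k0 : 0 < hN x + 1 by rewrite ltr_wpDl// hN_ge0.
  have [n0 h] := cu _ (divr_gt0 e0 k0); exists n0 => m n mn nn.
  rewrite -bopBE (le_trans (h m n mn nn x))// mulrAC ler_pdivrMr//.
  by rewrite ler_wpM2l ?(ltW e0)// lerDl.
have near e : 0 < e -> exists n0, forall n, (n0 <= n)%N ->
    forall x, hN (f x - u n x) <= e * hN x.
  move=> e0; have [n0 h] := cu _ e0; exists n0 => n nn x.
  rewrite -subr_le0; apply: real_eps0 => d d0; rewrite lerBlDr.
  have [n1 h1] := fP x _ d0; pose m := maxn n0 n1.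
  have -> : f x - u n x = (f x - u m x) + (u m x - u n x) by rewrite subrKA.
  rewrite (le_trans (hND _ _))// lerD//; first by rewrite hNB h1// leq_maxr.
  by rewrite -bopBE; apply: h nn _; rewrite leq_maxl.
have flin c x y : f (c *: x + y) = c *: f x + f y.
  apply/eqP; rewrite -subr_eq0; apply/eqP; apply: hN_eps0 => e e0.
  pose k := hN (c *: x + y) + (normc c * hN x + hN y) + 1.
  have k0 : 0 < k.
    by rewrite ltr_wpDl// !addr_ge0 ?mulr_ge0 ?hN_ge0 ?normc_ge0.
  have [n0 h] := near _ (divr_gt0 e0 k0).
  have {}h := h n0 (leqnn _).
  have -> : f (c *: x + y) - (c *: f x + f y) =
      (f (c *: x + y) - u n0 (c *: x + y)) -
      (c *: (f x - u n0 x) + (f y - u n0 y)).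
    rewrite bop_lin scalerBr -addrA; congr (_ + _).
    by rewrite (addrACA (c *: f x)) -(opprD (c *: u n0 x)) opprB addKr.
  rewrite (le_trans (hND _ _))// hNN.
  rewrite (@le_trans _ _ (e / k * hN (c *: x + y) +
     (normc c * (e / k * hN x) + e / k * hN y)))//.
    rewrite lerD// (le_trans (hND _ _))// lerD// hNZ.
    by rewrite ler_wpM2l ?normc_ge0.
  rewrite mulrCA -!mulrDr mulrAC ler_pdivrMr// ler_wpM2l ?(ltW e0)//.
  by rewrite lerDl.
have fbd : exists M, bnd f M.
  have [n0 h] := near _ ltr01; have [M M0 uM] := bop_bnd_gt0 (u n0).
  exists (1 + M) => x; rewrite -[f x](subrK (u n0 x)) mulrDl.
  by rewrite (le_trans (hND _ _))// lerD// h.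
exists (Bop flin fbd) => e e0; have [n0 h] := near _ e0; exists n0 => n nn x.
by rewrite bopBE; exact: h.
Qed.

End OperatorNormLimits.

Section SquareRoot.
Variables (R : realType) (H : completeNormedModType R[i]).
Variable ip : {dot H for Num.conj}.
Context {ipH : hilbert ip}.
Local Notation bop := (bop H).

Lemma badjZ c (f : bop) : badj ip (c *: f) = Num.conj c *: badj ip f.
Proof. by apply: badj_uniq => x y; rewrite !bE !ipE conjCK badjP. Qed.

(** The scalar majorant of the iteration for the square root. *)
Fixpoint tseq (n : nat) : R := if n is m.+1 then (1 + tseq m ^+ 2) / 2 else 0.

Fixpoint yseq (a : bop) (n : nat) : bop :=
  if n is m.+1 then (2^-1)%:C *: (a + yseq a m * yseq a m) else 0.

Lemma tseq_ge0 n : 0 <= tseq n.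
Proof. by case: n => //= n; rewrite divr_ge0// addr_ge0// sqr_ge0. Qed.

Lemma tseq_le1 n : tseq n <= 1.
Proof.
elim: n => //= n IH; have := tseq_ge0 n.
by move: (tseq n) IH => t t1 t0; nra.
Qed.

Lemma tseq_mono n : tseq n <= tseq n.+1.
Proof. by rewrite /=; have := sqr_ge0 (tseq n - 1); nra. Qed.

Lemma tseq_cauchy (e : R) : 0 < e -> exists n0, forall n m, (n0 <= n)%N ->
  (n <= m)%N -> tseq m - tseq n <= e.
Proof.
move=> e0; pose E := range tseq.
have sE : has_sup E.
  split; first by exists (tseq 0); exists 0%N.
  by exists 1 => _ [n _ <-]; exact: tseq_le1.
have mono : {homo tseq : n m / (n <= m)%N >-> n <= m}.
  by apply: homo_leq => //; [exact: le_trans | exact: tseq_mono].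
have [_ [n0 _ <-] h] := sup_adherent e0 sE; exists n0 => n m nn nm.
have : tseq m <= sup E by apply: sup_upper_bound => //; exists m.
by have := mono _ _ nn; lra.
Qed.

Lemma yseq_bnd (a : bop) n : bnd a 1 -> bnd (yseq a n) (tseq n).
Proof.
move=> a1; elim: n => [|n IH] /=; first exact: bbnd0.
apply: bnd_le (bbndZ (2^-1)%:C (bbndD a1 (bbndM (tseq_ge0 n) IH IH))).
by rewrite normcr ger0_norm ?invr_ge0// mulrC expr2.
Qed.

Lemma yseq_step (a : bop) n : bnd a 1 ->
  bnd (yseq a n.+1 - yseq a n) (tseq n.+1 - tseq n).
Proof.
move=> a1; elim: n => [|n IH].
  by rewrite [yseq a 0]/= [tseq 0]/= !subr0; exact: yseq_bnd.
have yn := yseq_bnd n a1; have yn1 := yseq_bnd n.+1 a1.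
set y1 := yseq a n.+1 in IH yn1 *; set y0 := yseq a n in IH yn *.
have -> : yseq a n.+2 - y1 =
    (2^-1)%:C *: (y1 * (y1 - y0) + (y1 - y0) * y0).
  rewrite /= -/y1 {2}/y1 /= -/y0 -scalerBr; congr (_ *: _).
  rewrite mulrBr mulrBl subrKA opprD addrACA subrr add0r.
  by [].
have d0 : 0 <= tseq n.+1 - tseq n by rewrite subr_ge0 tseq_mono.
apply: bnd_le (bbndZ _ (bbndD (bbndM (tseq_ge0 _) yn1 IH) (bbndM d0 IH yn))).
rewrite normcr ger0_norm ?invr_ge0//.
rewrite -[tseq n.+2]/((1 + tseq n.+1 ^+ 2) / 2).
set s := tseq n.+1; have -> : s = (1 + tseq n ^+ 2) / 2 by [].
by move: (tseq n) => t; nra.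
Qed.

Lemma yseq_cauchy (a : bop) : bnd a 1 ->
  forall e : R, 0 < e -> exists n0, forall m n, (n0 <= m)%N -> (n0 <= n)%N ->
     bnd (yseq a m - yseq a n) e.
Proof.
move=> a1.
have step n k : bnd (yseq a (k + n)%N - yseq a n) (tseq (k + n)%N - tseq n).
  elim: k => [|k IH]; first by rewrite add0n !subrr; exact: bbnd0.
  rewrite addSn -(subrKA (yseq a (k + n))) -[tseq _.+1 - _](subrKA (tseq (k + n))).
  by apply: bbndD => //; exact: yseq_step.
move=> e /tseq_cauchy[n0 h]; exists n0.
have key m n : (n0 <= n)%N -> (n <= m)%N -> bnd (yseq a m - yseq a n) e.
  move=> nn nm; apply: bnd_le (h n m nn nm) _.
  by rewrite -(subnK nm); exact: step.
move=> m n mn nn; have [nm|/ltnW nm] := leqP n m; first exact: key.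
by rewrite -opprB; apply: bbndN; exact: key.
Qed.

(** The square root of a selfadjoint [b] with [|1 - b| <= 1] is [1 - y], where
    [y] is the limit of the iteration [y |-> (1 - b + y^2) / 2] started at [0]:
    the norms of its increments are dominated by those of the scalar iteration
    for [b = 0]. *)
Lemma square_root (b : bop) : badj ip b = b -> bnd (1 - b) 1 ->
  exists r : bop, [/\ r * r = b, badj ip r = r, bnd (1 - r) 1 &
    forall c, GRing.comm c b -> GRing.comm c r].
Proof.
move=> bs b1; set a := 1 - b.
have [y yP] := bop_complete (yseq_cauchy b1).
have y1 : bnd y 1.
  move=> x; rewrite -subr_le0; apply: real_eps0 => e e0.
  have k0 : 0 < hN x + 1 by rewrite ltr_wpDl// hN_ge0.
  have [n h] := yP _ (divr_gt0 e0 k0); have {}h := h n (leqnn _) x.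
  rewrite lerBlDr -[y x](subrK (yseq a n x)) (le_trans (hND _ _))// lerD//.
    rewrite -bopBE (le_trans h)// mulrAC ler_pdivrMr// ler_wpM2l ?(ltW e0)//.
    by rewrite lerDl.
  exact: bnd_le (tseq_le1 n) (yseq_bnd n b1) x.
have yE : y = (2^-1)%:C *: (a + y * y).
  apply/eqP; rewrite -subr_eq0; apply/eqP; apply: (@bnd_eps0 _ _ _ 2) => e e0.
  have [n h] := yP _ e0.
  have hn := h n (leqnn _); have hn1 := h n.+1 (leqnSn _).
  have -> : y - (2^-1)%:C *: (a + y * y) = (y - yseq a n.+1) +
      (2^-1)%:C *: (- (yseq a n * (y - yseq a n)) - (y - yseq a n) * y).
    rewrite /= -[LHS](subrKA ((2^-1)%:C *: (a + yseq a n * yseq a n))).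
    congr (_ + _); rewrite -scalerBr; congr (_ *: _).
    rewrite mulrBr mulrBl opprB opprB subrKA.
    by rewrite opprD addrACA subrr add0r.
  apply: bnd_le (bbndD hn1 (bbndZ _ (bbndB (bbndN (bbndM (tseq_ge0 _)
     (yseq_bnd n b1) hn)) (bbndM (ltW e0) hn y1)))).
  rewrite normcr ger0_norm ?invr_ge0//.
  by have := tseq_le1 n; move: (tseq n) => t t1; nra.
exists (1 - y); split.
- have yy : y * y = y + y - a.
    have : 2%:C *: y = a + y * y.
      by rewrite {1}yE scalerA -rmorphM/= divff ?scale1r// pnatr_eq0.
    by rewrite rmorph_nat scaler_nat mulr2n => ->; rewrite addrAC subrr add0r.
  rewrite mulrBl mul1r mulrBr mulr1 yy /a.
  by apply: bopP => x; apply: (ip_inj ip) => z; rewrite !bE !ipE; ring.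
- apply/eqP; rewrite badjD badjN badj1 -subr_eq0 opprD opprK addrACA subrr add0r.
  apply/eqP; apply: (@bnd_eps0 _ _ _ 2) => e e0.
  have [n h] := yP _ e0; have {}h := h n (leqnn _).
  have ys m : badj ip (yseq a m) = yseq a m.
    elim: m => [|m IH]; first by apply: badj_uniq => u v; rewrite ip0l ip0r.
    rewrite [yseq a m.+1]/= badjZ badjD badjM IH conjC_realC.
    by rewrite /a badjD badjN badj1 bs.
  have -> : - badj ip y + y = (y - yseq a n) - badj ip (y - yseq a n).
    by rewrite badjD badjN ys opprB subrKA addrC.
  have -> : 2 * e = e + e by ring.
  by apply: bbndB => //; apply: badj_bnd => //; exact: ltW.
- by rewrite opprB addrC subrK.
- move=> c cb.
  have ca : GRing.comm c a by apply: commrB => //; exact: commr1.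
  have cy m : GRing.comm c (yseq a m).
    elim: m => [|m IH]; first exact: commr0.
    rewrite /= /GRing.comm -bop_scaleAr -bop_scaleAl; congr (_ *: _).
    by apply: commrD => //; exact: commrM.
  apply: commrB; first exact: commr1.
  have [M M0 cM] := bop_bnd_gt0 c.
  apply/eqP; rewrite -subr_eq0; apply/eqP; apply: (@bnd_eps0 _ _ _ (2 * M)) => e e0.
  have [n h] := yP _ e0; have {}h := h n (leqnn _).
  have -> : c * y - y * c = c * (y - yseq a n) - (y - yseq a n) * c.
    by rewrite mulrBr mulrBl (cy n) opprB addrA subrK.
  have -> : 2 * M * e = M * e + e * M by ring.
  by apply: bbndB; apply: bbndM => //; exact: ltW.
Qed.

(** A selfadjoint operator within distance [1] of the identity is nonnegative:
    [<r x, x> = |x|^2 - <(1 - r) x, x>]. *)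
Lemma sa_near1_ge0 (r : bop) x : badj ip r = r -> bnd (1 - r) 1 ->
  0 <= ip (r x) x.
Proof.
move=> rs r1.
have rr : ip (r x) x \is Num.real.
  by apply/CrealP; rewrite -ipC -badjPr rs.
rewrite -(RRe_real rr) ler0c.
have : ip (r x) x = ip x x - ip ((1 - r) x) x.
  by rewrite bopBE ipBl opprB addrC subrK.
move=> ->; rewrite ReD ReN ip_hN /= subr_ge0.
rewrite (le_trans (Re_le_normc _))// (le_trans (ip_CS _ _))// expr2.
by apply: ler_wpM2r; rewrite ?hN_ge0//; have := r1 x; rewrite mul1r.
Qed.

End SquareRoot.

(** * Closed operators and their adjoints *)

Section ClosedOperators.
Variables (R : realType) (H : completeNormedModType R[i]).
Variable ip : {dot H for Num.conj}.
Context {ipH : hilbert ip}.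
Local Notation bop := (bop H).
Local Notation adj := (adj ip).
Implicit Types (x y z u v : H) (c : R[i]) (S T G : set (H * H)).

Definition gr (f : bop) : set (H * H) := [set p | p.2 = f p.1].

(** Closedness of the graph, stated with real tolerances. *)
Definition closedg T := forall x y,
  (forall e : R, 0 < e -> exists a b, [/\ T (a, b), hN (x - a) <= e & hN (y - b) <= e]) ->
  T (x, y).

Lemma closed_closedg T : closed T -> closedg T.
Proof.
move=> cT x y h; apply: cT => B /nbhs_ballP[e /= e0 eB].
have eE : e = (complex.Re e)%:C by rewrite RRe_real// realE ltW.
have re : 0 < complex.Re e / 2 by move: e0; rewrite eE ltcR /=; lra.
have re2 : complex.Re e / 2 < complex.Re e by move: re; lra.
have [a [b [Tab xa yb]]] := h _ re; exists (a, b); split=> //; apply: eB.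
by split; rewrite hN_ball normr_hN eE ltcR/=;
  [apply: le_lt_trans xa _ | apply: le_lt_trans yb _].
Qed.

Lemma op_subspace T : is_operator T -> subspace T.
Proof.
by move=> [T0 Tl _]; split=> // c [x y] [x' y']; exact: Tl.
Qed.

Lemma op_fun T x y y' : is_operator T -> T (x, y) -> T (x, y') -> y = y'.
Proof. by move=> [_ _ h]; exact: h. Qed.

Lemma op_lin T c x y x' y' : is_operator T -> T (x, y) -> T (x', y') ->
  T (c *: x + x', c *: y + y').
Proof. by move=> [_ h _]; exact: h. Qed.

Lemma op_add T x y x' y' : is_operator T -> T (x, y) -> T (x', y') ->
  T (x + x', y + y').
Proof. by move=> oT h h'; have := op_lin 1 oT h h'; rewrite !scale1r. Qed.

Lemma op_scale T c x y : is_operator T -> T (x, y) -> T (c *: x, c *: y).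
Proof.
by move=> oT h; have [T0 _ _] := oT; have := op_lin c oT h T0; rewrite !addr0.
Qed.

Lemma op_sub T x y x' y' : is_operator T -> T (x, y) -> T (x', y') ->
  T (x - x', y - y').
Proof.
move=> oT h h'; rewrite -[- x']scaleN1r -[- y']scaleN1r.
exact: op_add oT h (op_scale _ oT h').
Qed.

Lemma dom_subspace T : is_operator T -> subspace (dom T).
Proof.
move=> oT; split; first by exists 0; case: oT.
by move=> c x x' [y h] [y' h']; exists (c *: y + y'); exact: op_lin.
Qed.

Lemma adjE T x y u v : adj T (u, v) -> T (x, y) -> ip y u = ip x v.
Proof. by move=> h; exact: h. Qed.

Lemma adj_subspace T : subspace (adj T).
Proof.
split=> [x y _|c [u v] [u' v'] h h' x y Txy]; rewrite /= ?ip0r//.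
by rewrite !ipE (h _ _ Txy) (h' _ _ Txy).
Qed.

Lemma adj_closed T : closedg (adj T).
Proof.
move=> u v h x y Txy /=; apply/eqP; rewrite -subr_eq0; apply/eqP.
apply: eq0_normc; apply/eqP; rewrite eq_le normc_ge0 andbT.
apply: real_eps0 => e e0; pose k := hN y + hN x + 1.
have k0 : 0 < k by rewrite ltr_wpDl// addr_ge0 ?hN_ge0.
have [a [b [Tab ua vb]]] := h _ (divr_gt0 e0 k0).
have -> : ip y u - ip x v = ip y (u - a) - ip x (v - b).
  by rewrite !ipBr (adjE Tab Txy); ring.
rewrite (le_trans (le_normcD _ _))// normcN.
apply: (@le_trans _ _ (hN y * (e / k) + hN x * (e / k))).
  rewrite lerD// (le_trans (ip_CS _ _))// ler_wpM2l ?hN_ge0//.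
rewrite -mulrDl mulrCA ler_piMr ?(ltW e0)// ler_pdivrMr// mul1r.
by rewrite /k lerDl.
Qed.

Lemma adj_op T : total ip (dom T) -> is_operator (adj T).
Proof.
move=> tT; have sT := adj_subspace T; split.
- exact: sT.1.
- by move=> c x y x' y' h h'; exact: (sT.2 c _ _ h h').
- move=> u v v' h h'; apply/eqP; rewrite -subr_eq0; apply/eqP.
  apply: tT => x [y Txy].
  by rewrite ipBr -(adjE h Txy) -(adjE h' Txy) subrr.
Qed.

Definition closed_dense T := [/\ is_operator T, closedg T & total ip (dom T)].

(** Projecting [(h, k)] onto the closed graph of [T] leaves a remainder in the
    orthogonal complement of the graph, which is the rotated graph of the
    adjoint. *)
Lemma graph_decomposition T h k : is_operator T -> closedg T ->
  exists u v, T (u, v) /\ adj T (k - v, u - h).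
Proof.
move=> oT cT.
have [[p q] [pT po]] :=
  orthogonal_projection (psd_ip2 ip) (h, k) (@qf_complete_ip2 _ _ ip ipH) (op_subspace oT).
exists p, q; split.
  apply: cT => e e0; have [[a b] Tab] := pT _ (exprn_gt0 2 e0).
  rewrite qf_ip2 /= => le2; exists a, b; split=> //.
    rewrite -sq_le ?hN_ge0 ?(ltW e0)//; apply: le_trans le2.
    by rewrite lerDl sqr_ge0.
  rewrite -sq_le ?hN_ge0 ?(ltW e0)//; apply: le_trans le2.
  by rewrite lerDr sqr_ge0.
move=> a b Tab /=; have := po _ Tab; rewrite /ip2/= => /eqP.
by rewrite addrC addr_eq0 => /eqP ->; rewrite !ipBr opprB.
Qed.

(** For [(h, k)] in the graph of [T^**], the decomposition leaves a remainder
    that is orthogonal to itself. *)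
Lemma adjK T : is_operator T -> closedg T -> adj (adj T) = T.
Proof.
move=> oT cT; apply/seteqP; split=> [[h k] hk|[x y] Txy u v Tuv /=]; last first.
  by rewrite ipC -(adjE Tuv Txy) -ipC.
have [u [v [Tuv ad]]] := graph_decomposition h k oT cT.
have := hk _ _ ad; rewrite /=.
have := adjE ad Tuv.
move=> e1 e2.
have e3 : ip (u - h) u = ip (k - v) v by rewrite ipC -e1 -ipC.
have : ip (u - h) (u - h) + ip (k - v) (k - v) = 0.
  by rewrite [ip _ (u - h)]ipBr [ip _ (k - v)]ipBr e2 e3; ring.
move/eqP; rewrite paddr_eq0 ?dnorm_ge0// !dnorm_eq0 !subr_eq0.
by move=> /andP[/eqP <- /eqP ->].
Qed.

Lemma adj_total T : is_operator T -> closedg T -> total ip (dom (adj T)).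
Proof.
move=> oT cT h hd.
have : adj (adj T) (0, h).
  by move=> u v Tuv /=; rewrite ip0r hd//; exists v.
by rewrite adjK// => /(op_fun oT); apply; case: oT.
Qed.

Lemma closed_dense_adj T : closed_dense T -> closed_dense (adj T).
Proof.
by move=> [oT cT tT]; split; [exact: adj_op|exact: adj_closed|exact: adj_total].
Qed.

Lemma closed_dense_adjK T : closed_dense T -> adj (adj T) = T.
Proof. by move=> [? ? _]; exact: adjK. Qed.

Definition nonneg_sa G :=
  [/\ is_operator G, nonneg_op ip G, adj G = G & total ip (dom G)].

Lemma nonneg_sa_closed G : nonneg_sa G -> closedg G.
Proof. by move=> [_ _ <- _]; exact: adj_closed. Qed.

Lemma nonneg_sa_sym G x y x' y' : nonneg_sa G -> G (x, y) -> G (x', y') ->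
  ip y x' = ip x y'.
Proof. by move=> [_ _ aG _] h; rewrite -{1}aG => h'; exact: (adjE h' h). Qed.

Lemma ge0_real_Re (a : R[i]) : 0 <= a -> a = (complex.Re a)%:C /\ 0 <= complex.Re a.
Proof.
by move=> a0; rewrite RRe_real ?realE ?a0//; split=> //; move: a0; rewrite lecE => /andP[].
Qed.

Section VonNeumann.
Variable T : set (H * H).
Hypothesis cT : closed_dense T.
Let G := opmul (adj T) T.

Lemma square_onto h : exists x y, G (x, y) /\ h = x + y.
Proof.
have [oT clT tT] := cT.
have [u [v [Tuv]]] := graph_decomposition h 0 oT clT.
rewrite sub0r => /(op_scale (-1) (adj_op tT)); rewrite !scaleN1r opprK opprB.
by move=> ad; exists u, (h - u); rewrite subrKC; split=> //; exists v.
Qed.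

Lemma square_form x y x' y' : G (x, y) -> T (x', y') ->
  exists2 w, T (x, w) & ip y x' = ip w y'.
Proof.
move=> [w Txw /= Tw] Txy'; exists w => //.
by rewrite ipC -(adjE Tw Txy') -ipC.
Qed.

(** von Neumann's theorem: by the graph decomposition [1 + T^* T] is onto, and a
    symmetric nonnegative operator with this property is selfadjoint. *)
Lemma square_nonneg_sa : nonneg_sa G.
Proof.
have [oT clT tT] := cT.
have oA := adj_op tT.
have oG : is_operator G.
  split.
  - by exists 0; [case: oT | case: oA].
  - move=> c x y x' y' [w h1 h2] [w' h1' h2']; exists (c *: w + w') => /=.
      exact: (op_lin c oT h1 h1').
    exact: (op_lin c oA h2 h2').
  - move=> x y y' [w h1 h2] [w' h1' h2'].
    have /= ww := op_fun oT h1 h1'; rewrite /= in h2 h2'.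
    by rewrite -ww in h2'; exact: op_fun oA h2 h2'.
have nG : nonneg_op ip G.
  move=> x y Gxy; have [w Txw _] := Gxy.
  have [w' Tw' ->] := square_form Gxy Txw.
  by rewrite /= in Tw' *; rewrite (op_fun oT Tw' Txw) dnorm_ge0.
have symG x y x' y' : G (x, y) -> G (x', y') -> ip y x' = ip x y'.
  move=> Gxy [w' h1' h2'].
  have [w Txw ->] := square_form Gxy h1'.
  by rewrite /=; exact: (adjE h2' Txw).
split=> //.
- apply/seteqP; split=> [[u v] uv|[x y] Gxy x' y' Gxy' /=]; last first.
    exact: symG Gxy' Gxy.
  have [x [y [Gxy uvE]]] := square_onto (u + v).
  suff ux : u = x by move: uvE; rewrite ux => /addrI ->; rewrite ?ux.
  apply: (ip_inj ip) => h; have [a [b [Gab ->]]] := square_onto h.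
  have e1 := adjE uv Gab; rewrite /= in e1.
  have e2 := symG _ _ _ _ Gab Gxy.
  rewrite !ipDl e1 e2 -!ipDr uvE.
  by [].
- move=> h hd; have [x [y [Gxy hE]]] := square_onto h.
  have x0 : x = 0.
    apply: (@ip_eq0 _ _ ip).
    have := hd x (ex_intro _ y Gxy); rewrite hE ipDr => /eqP.
    have yx : 0 <= ip x y by rewrite -(symG _ _ _ _ Gxy Gxy); exact: nG.
    by rewrite paddr_eq0 ?dnorm_ge0// => /andP[/eqP].
  by rewrite hE x0 add0r; apply: (op_fun oG Gxy); rewrite x0; case: (oG).
Qed.

End VonNeumann.

End ClosedOperators.

Section Resolvents.
Variables (R : realType) (H : completeNormedModType R[i]).
Variable ip : {dot H for Num.conj}.
Context {ipH : hilbert ip}.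
Local Notation bop := (bop H).
Local Notation adj := (adj ip).
Local Notation slit := (@slit_plane R).
Implicit Types (x y u v : H) (z c : R[i]) (G : set (H * H)).

(** A crude lower bound for the distance of [z] to the nonpositive reals; it is
    all that a resolvent estimate for a nonnegative operator needs. *)
Definition slit_gap z : R :=
  if 0 < complex.Re z then complex.Re z else `|complex.Im z|.

Lemma slit_gap_gt0 z : slit z -> 0 < slit_gap z.
Proof.
rewrite /slit_gap; case: ifPn => // rz sz; rewrite normr_gt0.
apply/eqP => iz; apply: sz; exists (complex.Re z).
  by rewrite /= leNgt.
by case: z iz {rz} => a b /= ->.
Qed.

Lemma slit_real (t : R) : 0 < t -> slit t%:C.
Proof. by move=> t0 [s /= s0 [st]]; move: s0; rewrite st leNgt t0. Qed.

Lemma slit_open z : slit z -> exists2 d : R, 0 < d & forall h, normc h < d -> slit (z + h).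
Proof.
move=> sz; have g0 := slit_gap_gt0 sz; exists (slit_gap z) => // h hd [s /= s0 E].
have hE : h = s%:C - z by rewrite E addrC addKr.
have iz : complex.Im z = - complex.Im h by rewrite hE; case: (z) => a b /=; rewrite add0r opprK.
have rz : complex.Re z = s - complex.Re h by rewrite hE; case: (z) => a b /=; rewrite opprD opprK addrA subrr add0r.
have ri : `|complex.Im h| <= normc h.
  by case: (h) => a b /=; rewrite -sqrtr_sqr ler_wsqrtr// lerDr sqr_ge0.
have rr : `|complex.Re h| <= normc h.
  by case: (h) => a b /=; rewrite -sqrtr_sqr ler_wsqrtr// lerDl sqr_ge0.
move: hd; rewrite /slit_gap; case: ifPn => [_|_].
  rewrite rz; have := ler_norm (- complex.Re h); rewrite normrN; lra.
by rewrite iz normrN; lra.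
Qed.

Lemma slit_gap_bound z (a t : R) : 0 <= a -> 0 <= t ->
  slit_gap z * a <= normc (z * a%:C + t%:C).
Proof.
case: z => p q a0 t0; rewrite /slit_gap /=; case: ifPn => p0.
  rewrite -[leLHS]ger0_norm ?mulr_ge0 ?(ltW p0)// -sqrtr_sqr ler_wsqrtr//.
  rewrite !mulr0 subr0 addr0 add0r.
  have : 0 <= p * a by rewrite mulr_ge0 ?(ltW p0).
  by have := sqr_ge0 (q * a); move: (p * a) (q * a) => u v; nra.
rewrite -{1}(ger0_norm a0) -normrM -sqrtr_sqr ler_wsqrtr//.
by rewrite !mulr0 !addr0 add0r lerDr sqr_ge0.
Qed.

(** For [z] in the slit plane [is_res G z r] determines [r = (z + G)^-1]. *)
Definition is_res G z (r : bop) :=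
  (forall y, G (r y, y - z *: r y)) /\
  (forall x v, G (x, v) -> r (z *: x + v) = x).

Definition res G z : bop := xget 0 [set r | is_res G z r].

Section Possa.
Variable G : set (H * H).
Hypothesis pG : nonneg_sa ip G.

(** Taking the inner product of [z x + G x] with [x] gives [z |x|^2 + <G x, x>],
    and adding a nonnegative number to [z |x|^2] keeps it away from [0]. *)
Lemma res_lower z x v : G (x, v) -> slit_gap z * hN x <= hN (z *: x + v).
Proof.
move=> Gxv; have [->|x0] := eqVneq (hN x) 0; first by rewrite mulr0 hN_ge0.
have {}x0 : 0 < hN x by rewrite lt_def x0 hN_ge0.
rewrite -(ler_pM2r x0) -mulrA; apply: le_trans (ip_CS (ip := ip) _ _).
have [_ nG _ _] := pG; have [vE v0] := ge0_real_Re (nG _ _ Gxv).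
by rewrite ipDl ipZl ip_hN vE slit_gap_bound// -expr2 sqr_ge0.
Qed.

(** The range of [z + G] is dense, because a vector orthogonal to it lies in the
    kernel of the adjoint [z^* + G]; it is closed by the lower bound. *)
Lemma res_onto z h : slit z -> exists x v, G (x, v) /\ h = z *: x + v.
Proof.
move=> sz; have g0 := slit_gap_gt0 sz; have [oG nG aG tG] := pG.
pose W := [set z *: p.1 + p.2 | p in G].
have sW : subspace W.
  split; first by exists (0, 0); [case: oG | rewrite /= scaler0 addr0].
  move=> c _ _ [[x v] h1 <-] [[x' v'] h2 <-] /=.
  exists (c *: x + x', c *: v + v'); first exact: op_lin oG h1 h2.
  by rewrite /= !scalerDr !scalerA (mulrC z) addrACA.
have tW : total ip W.
  move=> g gW.
  have Gg : G (g, - (Num.conj z *: g)).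
    rewrite -aG => x v Gxv /=; have := gW _ (ex_intro2 _ _ (x, v) Gxv erefl).
    by rewrite /= !ipE conjCK addrC => /eqP; rewrite addr_eq0 => /eqP.
  apply: (@ip_eq0 _ _ ip); have := gW _ (ex_intro2 _ _ _ Gg erefl).
  have [vE v0] := ge0_real_Re (nG _ _ Gg).
  rewrite /= ipDl ipZl ip_hN vE => E.
  have := slit_gap_bound z (sqr_ge0 (hN g)) v0; rewrite E normc0 pmulr_rle0//.
  move=> h1; congr (_%:C); apply/eqP; rewrite eq_le h1; exact: sqr_ge0.
have [u [uW uh]] := adherent_seq (total_adherent sW tW h).
have /choice[p pP] : forall n, exists p : H * H, G p /\ z *: p.1 + p.2 = u n.
  by move=> n; have [q Gq qE] := uW n; exists q.
have hu (e : R) : 0 < e -> exists n0, forall n, (n0 <= n)%N -> hN (h - u n) <= e.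
  move=> e0; have [n0 h0] := qf_archi e0; exists n0 => n /h0; exact: le_trans (uh n).
have [|x xP] := @hN_cauchy _ _ (fun n => (p n).1).
  move=> e e0; have [|n0 h0] := hu (slit_gap z * e / 2).
    by rewrite divr_gt0// mulr_gt0.
  exists n0 => m n mn nn; rewrite -(ler_pM2l g0).
  have [Gm Em] := pP m; have [Gn En] := pP n.
  move: Gm Gn Em En; case: (p m) (p n) => [a b] [a' b'] /= Gm Gn Em En.
  apply: le_trans (res_lower z (op_sub oG Gm Gn)) _.
  have -> : z *: (a - a') + (b - b') = (h - u n) - (h - u m).
    by rewrite opprB [RHS]addrC subrKA -Em -En scalerBr addrACA opprD.
  rewrite (le_trans (hND _ _))// hNN.
  by have := h0 _ mn; have := h0 _ nn; lra.
exists x, (h - z *: x); split; last by rewrite subrKC.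
apply: (nonneg_sa_closed pG) => e e0.
pose k := normc z + 1; have k0 : 0 < k by rewrite ltr_wpDl// normc_ge0.
have ek : 0 < e / 2 / k by rewrite !divr_gt0.
have [n1 h1] := xP _ ek; have [n2 h2] := hu (e / 2) ltac:(by rewrite divr_gt0).
pose n := maxn n1 n2; have {}h1 := h1 n (leq_maxl _ _); have {}h2 := h2 n (leq_maxr _ _).
have [Gn En] := pP n; move: Gn En h1; case: (p n) => a b /= Gn En h1.
have ke : e / 2 / k <= e / 2 by rewrite ler_pdivrMr// ler_peMr ?divr_ge0 ?(ltW e0)// lerDr normc_ge0.
have e2 : e / 2 <= e by lra.
exists a, b; split=> //; first by rewrite hNB (le_trans h1)// (le_trans ke).
have -> : h - z *: x - b = (h - u n) + z *: (a - x).
  by rewrite -En; apply: (ip_inj ip) => w; rewrite !ipE; ring.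
rewrite [e]splitr (le_trans (hND _ _))// lerD// hNZ.
apply: le_trans (ler_wpM2l (normc_ge0 _) h1) _.
rewrite mulrCA ler_piMr ?divr_ge0 ?(ltW e0)// ler_pdivrMr// mul1r.
by rewrite lerDl.
Qed.

Lemma res_exists z : slit z -> exists r, is_res G z r.
Proof.
move=> sz; have [oG nG aG tG] := pG; have g0 := slit_gap_gt0 sz.
have /choice[r rP] : forall h, exists x, G (x, h - z *: x).
  move=> h; have [x [v [Gxv ->]]] := res_onto h sz; exists x.
  by rewrite addrC addKr.
have inj x v : G (x, v) -> r (z *: x + v) = x.
  move=> Gxv; have := res_lower z (op_sub oG (rP (z *: x + v)) Gxv).
  rewrite scalerBr addrA.
  have -> : z *: r (z *: x + v) - z *: x + (z *: x + v - z *: r (z *: x + v)) - v = 0.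
    by apply: (ip_inj ip) => w; rewrite !ipE; ring.
  rewrite hN0 pmulr_rle0// => h; apply/eqP; rewrite -subr_eq0; apply/eqP.
  by apply: hN0_eq0; apply/eqP; rewrite eq_le h hN_ge0.
have rlin c x y : r (c *: x + y) = c *: r x + r y.
  have := inj _ _ (op_lin c oG (rP x) (rP y)).
  rewrite !scalerDr !scalerN !scalerA (mulrC z) addrACA subrKC subrKC.
  by [].
have rbd : exists M, bnd r M.
  exists (slit_gap z)^-1 => y; rewrite ler_pdivlMl//.
  by apply: le_trans (res_lower z (rP y)) _; rewrite subrKC.
by exists (Bop rlin rbd).
Qed.

Lemma resP z : slit z -> is_res G z (res G z).
Proof. by move=> sz; exact: (xgetPex 0 (res_exists sz)). Qed.

Lemma res_in z y : slit z -> G (res G z y, y - z *: res G z y).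
Proof. by move=> /resP[]. Qed.

Lemma resK z x v : slit z -> G (x, v) -> res G z (z *: x + v) = x.
Proof. by move=> /resP[_]; exact. Qed.

Lemma opinv_res z : slit z -> opinv (opadd (opcst z) G) = gr (res G z).
Proof.
move=> sz; apply/seteqP; split=> [[y x]|[y x]].
  by move=> [a [b []]]; rewrite /opcst /gr/= => -> Gxb ->; rewrite resK.
rewrite /gr/= => ->; exists (z *: res G z y), (y - z *: res G z y) => /=.
by split=> //; [exact: res_in | rewrite subrKC].
Qed.

Lemma res_inj z : slit z -> injective (res G z).
Proof.
move=> sz x y; have [oG _ _ _] := pG.
have /= hx := res_in x sz; have /= hy := res_in y sz.
move=> E; move: hx; rewrite E => hx.
by have := op_fun oG hx hy => /addIr.
Qed.

Lemma res_identity z z' : slit z -> slit z' ->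
  res G z - res G z' = (z' - z) *: (res G z * res G z').
Proof.
move=> sz sz'; apply: bopP => y; rewrite bopBE bopZE bopME.
have := resK sz (res_in y sz'); rewrite bopD bopB !bopZ => E.
by apply: (ip_inj ip) => w; rewrite -[in LHS]E !ipE; ring.
Qed.

Lemma res_comm z z' : slit z -> slit z' -> GRing.comm (res G z) (res G z').
Proof.
move=> sz sz'; have [->|zz] := eqVneq z z'; first exact: commr_refl.
have h1 := res_identity sz sz'; have h2 := res_identity sz' sz.
have zz0 : z' - z != 0 by rewrite subr_eq0 eq_sym.
rewrite /GRing.comm; apply: (scalerI zz0); rewrite -h1 -[z' - z]opprB scaleNr -h2.
by rewrite opprB.
Qed.

Lemma res_adj (t : R) : 0 < t -> badj ip (res G t%:C) = res G t%:C.
Proof.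
move=> t0; have sz := slit_real t0; apply: badj_uniq => x y.
have := nonneg_sa_sym pG (res_in x sz) (res_in y sz).
rewrite !ipBl !ipBr !ipZl !ipZr conjC_realC.
by move/addIr.
Qed.

(** The two summands of [y = t x + G x], where [x = (t + G)^-1 y], have a
    nonnegative inner product because [G] is nonnegative. *)
Lemma res_sum_sqr (t : R) y : 0 < t ->
  hN (t%:C *: res G t%:C y) ^+ 2 + hN (y - t%:C *: res G t%:C y) ^+ 2 <= hN y ^+ 2.
Proof.
move=> t0; have sz := slit_real t0; have [_ nG _ _] := pG.
have Gy := res_in y sz; set x := res G _ y in Gy *; set v := y - _ in Gy *.
have yE : y = t%:C *: x + v by rewrite subrKC.
clearbody v; clearbody x.
have [vE v0] := ge0_real_Re (nG _ _ Gy).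
have xv : ip x v = ip v x by rewrite ipC vE conjC_realC -vE.
have : (hN y ^+ 2)%:C = (hN (t%:C *: x) ^+ 2 + hN v ^+ 2 + 2 * t * complex.Re (ip v x))%:C.
  rewrite 2!rmorphD/= -!ip_hN !rmorphM/= -vE rmorph_nat [in LHS]yE.
  by rewrite !ipE conjC_realC xv; ring.
move=> /complexI ->; rewrite lerDl mulr_ge0// mulr_ge0// ltW//.
Qed.

Lemma res_contr (t : R) : 0 < t -> bnd (t%:C *: res G t%:C) 1.
Proof.
move=> t0 y; rewrite mul1r -sq_le ?hN_ge0//; apply: le_trans (res_sum_sqr y t0).
by rewrite lerDl sqr_ge0.
Qed.

Lemma res_contrC (t : R) : 0 < t -> bnd (1 - t%:C *: res G t%:C) 1.
Proof.
move=> t0 y; rewrite mul1r -sq_le ?hN_ge0//; apply: le_trans (res_sum_sqr y t0).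
by rewrite bopBE bopZE bop1E lerDr sqr_ge0.
Qed.

Lemma res_pos (t : R) y : 0 < t -> 0 <= ip (res G t%:C y) y.
Proof.
move=> t0; have sz := slit_real t0; have [_ nG _ _] := pG.
have Gy := res_in y sz; have p := nG _ _ Gy.
have [E v0] := ge0_real_Re p.
have : ip (res G t%:C y) y = ip (res G t%:C y) (y - t%:C *: res G t%:C y)
    + t%:C * ip (res G t%:C y) (res G t%:C y).
  by rewrite ipBr ipZr conjC_realC subrK.
move=> ->; rewrite addr_ge0 ?mulr_ge0 ?dnorm_ge0 ?ler0c ?(ltW t0)//.
by rewrite ipC E conjC_realC ler0c.
Qed.

End Possa.
End Resolvents.

Section ResolventAtOne.
Variables (R : realType) (H : completeNormedModType R[i]).
Variable ip : {dot H for Num.conj}.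
Context {ipH : hilbert ip}.
Variable G : set (H * H).
Hypothesis pG : nonneg_sa ip G.

Local Notation r1 := (res G 1).

Lemma slit1 : @slit_plane R 1.
Proof. exact: (@slit_real R 1 ltr01). Qed.

Lemma res1_adj : badj ip r1 = r1.
Proof. exact: (res_adj pG ltr01). Qed.

Lemma res1_contr : bnd r1 1.
Proof.
by have /(_ ipH) := res_contr pG ltr01; rewrite -[1%:C]/(1 : R[i]) scale1r.
Qed.

Lemma res1_contrC : bnd (1 - r1) 1.
Proof.
by have /(_ ipH) := res_contrC pG ltr01; rewrite -[1%:C]/(1 : R[i]) scale1r.
Qed.

Lemma res1_in y : G (r1 y, y - r1 y).
Proof. by have /(_ ipH) := res_in pG y slit1; rewrite scale1r. Qed.

Lemma res1K x v : G (x, v) -> r1 (x + v) = x.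
Proof. by move=> /(resK pG slit1); rewrite scale1r. Qed.

Lemma res1_inj : injective r1.
Proof. exact: res_inj pG _ slit1. Qed.

End ResolventAtOne.

(** * Form domains and square roots of unbounded operators *)

Section FormDomain.
Variables (R : realType) (H : completeNormedModType R[i]).
Variable ip : {dot H for Num.conj}.
Context {ipH : hilbert ip}.
Local Notation bop := (bop H).
Local Notation adj := (adj ip).
Implicit Types (x y u v : H) (S T G : set (H * H)).

(** An element of the graph of [T] which is orthogonal to the graph over
    [Dom (T^* T)] has its first component orthogonal to the range of
    [1 + T^* T], which is everything; hence [Dom (T^* T)] is a core of [T]. *)
Lemma square_core T u v : closed_dense ip T -> T (u, v) -> forall e : R, 0 < e ->
  exists a b, [/\ dom (opmul (adj T) T) a, T (a, b), hN (u - a) <= e & hN (v - b) <= e].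
Proof.
move=> cT Tuv; have [oT clT tT] := cT; have oA := adj_op tT.
pose G := opmul (adj T) T; have pG : nonneg_sa ip G := square_nonneg_sa cT.
have [oG _ _ _] := pG.
pose W := [set p : H * H | T p /\ dom G p.1].
have sW : subspace W.
  split; first by split; [case: oT | exact: (dom_subspace oG).1].
  move=> c [a b] [a' b'] [h d] [h' d']; split; first exact: op_lin oT h h'.
  exact: (dom_subspace oG).2.
have [[p q] [pW po]] :=
  orthogonal_projection (psd_ip2 ip) (u, v) (@qf_complete_ip2 _ _ ip ipH) sW.
have pq (e : R) : 0 < e -> exists a b, [/\ W (a, b), hN (p - a) <= e & hN (q - b) <= e].
  move=> e0; have [[a b] Wab] := pW _ (exprn_gt0 2 e0).
  rewrite qf_ip2 /= => le2; exists a, b; split=> //.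
    rewrite -sq_le ?hN_ge0 ?(ltW e0)//; apply: le_trans le2.
    by rewrite lerDl sqr_ge0.
  rewrite -sq_le ?hN_ge0 ?(ltW e0)//; apply: le_trans le2.
  by rewrite lerDr sqr_ge0.
have Tpq : T (p, q).
  by apply: clT => e /pq[a [b [[Tab _] pa qb]]]; exists a, b.
have d := op_sub oT Tuv Tpq.
have up : u = p.
  apply: (ip_inj ip) => h; have [x [y [Gxy ->]]] := square_onto cT h.
  have [w Txw Aw] := Gxy; rewrite /= in Txw Aw.
  have := po _ (conj Txw (ex_intro _ y Gxy)); rewrite /ip2/=.
  have -> : ip w (v - q) = ip y (u - p) by rewrite ipC (adjE Aw d) -ipC.
  by rewrite -ipDl ipBr => /eqP; rewrite subr_eq0 => /eqP.
have vq : v = q by rewrite up in Tuv; exact: op_fun oT Tuv Tpq.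
move=> e /pq[a [b [[Tab Da] pa qb]]]; exists a, b.
by rewrite up vq; split.
Qed.

Lemma square_norm T x y w : closed_dense ip T -> opmul (adj T) T (x, y) -> T (x, w) ->
  (hN w ^+ 2)%:C = ip y x.
Proof.
move=> [oT _ _] Gxy Txw; have [w' Tw' ->] := square_form Gxy Txw.
by rewrite (op_fun oT Tw' Txw) ip_hN.
Qed.

(** On the common core [Dom (T^* T)] the graph norms agree, as
    [|T x|^2 = <T^* T x, x>]. Hence the domains of their closures agree: this is
    what relates [D_+], [D_-] and [Delta^(1/2)] with no spectral theorem. *)
Lemma form_domain T T' : closed_dense ip T -> closed_dense ip T' ->
  opmul (adj T) T = opmul (adj T') T' -> dom T `<=` dom T'.
Proof.
move=> cT cT' E u [v Tuv].
have [oT _ _] := cT; have [oT' clT' _] := cT'.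
have core n : exists p : H * H * H, [/\ opmul (adj T) T (p.1.1, p.2), T p.1,
    hN (u - p.1.1) <= n.+1%:R^-1 & hN (v - p.1.2) <= n.+1%:R^-1].
  have n0 : 0 < n.+1%:R^-1 :> R by rewrite invr_gt0 ltr0n.
  have [a [b [[y Ga] Tab ua vb]]] := square_core cT Tuv n0.
  by exists ((a, b), y).
have /choice[p pP] := core.
have /choice[b' b'P] : forall n, exists w, T' ((p n).1.1, w).
  move=> n; have [Gn _ _ _] := pP n; rewrite E in Gn.
  by have [w Tw _] := Gn; exists w.
have dist m n : hN (b' m - b' n) = hN ((p m).1.2 - (p n).1.2).
  have [Gm Tm _ _] := pP m; have [Gn Tn _ _] := pP n.
  have b'm := b'P m; have b'n := b'P n.
  move: Gm Tm Gn Tn b'm b'n; case: (p m) => [[am bm] ym]; case: (p n) => [[an bn] yn] /=.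
  move=> Gm Tm Gn Tn b'm b'n.
  have [oG _ _ _] := square_nonneg_sa cT.
  have Gs := op_sub oG Gm Gn.
  have e1 := square_norm cT Gs (op_sub oT Tm Tn).
  rewrite E in Gs.
  have e2 := square_norm cT' Gs (op_sub oT' b'm b'n).
  have /complexI /eqP := etrans e2 (esym e1).
  by rewrite eqrXn2 ?hN_ge0// => /eqP.
have archi := @qf_archi R.
have [|v' v'P] := @hN_cauchy _ _ b'.
  move=> e e0; have [n0 h0] := archi _ (divr_gt0 e0 (ltr0Sn _ 1)).
  exists n0 => m n /h0 mn /h0 nn; rewrite dist.
  have [_ _ _ vm] := pP m; have [_ _ _ vn] := pP n.
  have -> : (p m).1.2 - (p n).1.2 = (v - (p n).1.2) - (v - (p m).1.2).
    by rewrite opprB [RHS]addrC subrKA.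
  by rewrite (le_trans (hND _ _))// hNN [e]splitr lerD// ?(le_trans vn)// (le_trans vm).
exists v'; apply: clT' => e e0.
have [n0 h0] := archi _ e0; have [n1 h1] := v'P _ e0; pose n := maxn n0 n1.
exists (p n).1.1, (b' n); split; first exact: b'P.
  by have [_ _ un _] := pP n; rewrite (le_trans un)// h0// leq_maxl.
by rewrite hNB h1// leq_maxr.
Qed.

Lemma selfadjoint_closed_dense S : selfadjoint ip S -> closed_dense ip S.
Proof.
move=> [oS dS aS]; split=> //; first by rewrite -aS; exact: adj_closed.
by apply: adherent_total; apply/dense_adherent.
Qed.

(** The graph of [s r^-1], parametrized so that no inverse is needed. For
    [r^2 = (1 + G)^-1] and [s^2 = 1 - r^2] it is the square root of [G]. *)
Section Quotient.
Variables r s : bop.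
Hypotheses (rs : badj ip r = r) (ss : badj ip s = s) (rsC : GRing.comm r s).
Hypotheses (rs1 : r * r + s * s = 1) (ri : injective r).

Let S : set (H * H) := [set (r x, s x) | x in [set: H]].

Let rsE x : r (s x) = s (r x). Proof. exact: bop_commE. Qed.
Let rrss x : r (r x) + s (s x) = x.
Proof. by rewrite -[RHS](bop1E x) -rs1. Qed.

Lemma quotientP u v : s u = r v -> S (u, v).
Proof.
move=> suv; exists (r u + s v) => //; rewrite !bopD -{1}rsE rsE; congr (_, _).
  by rewrite -suv rrss.
by rewrite suv rrss.
Qed.

Lemma quotient_selfadjoint : selfadjoint ip S.
Proof.
have oS : is_operator S.
  split; first by exists 0 => //; rewrite !bop0r.
    move=> c _ _ _ _ [x _ [<- <-]] [y _ [<- <-]].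
    by exists (c *: x + y) => //; rewrite !bop_lin.
  by move=> _ _ y' [x _ [<- <-]] [x' _ [/ri -> <-]].
split=> //.
  apply/dense_adherent => x.
  have : adherent (range r) x.
    apply: (total_adherent (ip := ip)); first exact: range_subspace.
    exact: sa_inj_total.
  move=> h e /h[_ [y _ <-] le]; exists (r y) => //.
  by exists (s y), y.
apply/seteqP; split=> [[u v] uv|_ [x _ <-] _ _ [y _ [<- <-]]] /=; last first.
  by rewrite badjP ss badjP rs rsE.
apply: quotientP; apply: (ip_inj ip) => x.
have := uv _ _ (ex_intro2 _ _ x I erefl); rewrite /=.
by rewrite badjP ss badjP rs.
Qed.

Lemma quotient_sqr : opmul S S = [set ((r * r) x, (s * s) x) | x in [set: H]].
Proof.
apply/seteqP; split=> [[u v] [w [a _ [<- <-]] [b _ [E <-]]]|_ [x _ <-]] /=.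
  have ra : r (r a + s b) = a by rewrite bopD rsE E rrss.
  have sb : s (r a + s b) = b by rewrite bopD -rsE -E rrss.
  by exists (r a + s b) => //=; rewrite ra sb.
by exists (r (s x)); [exists (r x) | exists (s x)]; rewrite ?rsE.
Qed.

Lemma quotient_nonneg : (forall x, 0 <= ip (r (s x)) x) -> nonneg_op ip S.
Proof. by move=> h _ _ [x _ [<- <-]]; have := h x; rewrite badjP rs. Qed.

End Quotient.

(** With [r^2 = (1 + G)^-1] and [s^2 = 1 - r^2] the quotient [s r^-1] is the
    square root. It is nonnegative since [r s] is the product of [r] with the
    square of [s^(1/2)], which commutes with [r]. *)
Lemma opsqrtP G : nonneg_sa ip G ->
  let S := opsqrt ip G in [/\ selfadjoint ip S, nonneg_op ip S & opmul S S = G].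
Proof.
move=> pG S.
suff ex : exists S, [set S | [/\ selfadjoint ip S, nonneg_op ip S & opmul S S = G]] S.
  exact: (xgetPex set0 ex).
pose b := res G 1.
have bs : badj ip b = b  by exact: res1_adj.
have b1 : bnd b 1  by exact: res1_contr.
have b1' : bnd (1 - b) 1  by exact: res1_contrC.
have [r [rr rs r1 rC]] := square_root bs b1'.
have [||s [ss sa s1' sC]] := @square_root _ _ ip ipH (1 - b).
- by rewrite badjD badjN badj1 bs.
- by rewrite opprB addrC subrK.
have bi : injective b by exact: res1_inj pG.
have ri : injective r by move=> x y E; apply: bi; rewrite -rr !bE E.
have rsC : GRing.comm r s.
  apply: sC; apply: commrB; first exact: commr1.
  by rewrite -rr; apply: commrM; exact: commr_refl.
have rs1 : r * r + s * s = 1 by rewrite rr ss subrKC.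
have [q [qq qs q1 qC]] := square_root sa s1'.
exists [set (r x, s x) | x in [set: H]]; split.
- exact: quotient_selfadjoint.
- apply: quotient_nonneg => // x.
  have rq : GRing.comm r q by exact: qC.
  rewrite -qq bopME -bopME rq bopME badjP qs.
  exact: sa_near1_ge0.
rewrite quotient_sqr// rr ss; apply/seteqP; split=> [_ [x _ <-]|[u v] Guv].
  by rewrite bopBE bop1E; exact: res1_in.
exists (u + v) => //; rewrite bopBE bop1E /b (res1K pG Guv).
by rewrite addrC addKr.
Qed.

End FormDomain.

(** * The scale of domains of a normal operator *)

Section GraphCalculus.
Variables (R : realType) (H : completeNormedModType R[i]).
Variable ip : {dot H for Num.conj}.
Context {ipH : hilbert ip}.
Local Notation bop := (bop H).
Implicit Types (f g : bop) (S T : set (H * H)) (c : R[i]).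

Lemma gr_inj f g : gr f = gr g -> f = g.
Proof.
move=> E; apply: bopP => x.
have : gr f (x, f x) by [].
by rewrite E.
Qed.

Lemma gr_op f : is_operator (gr f).
Proof.
split=> [|c x y x' y'|x y y']; rewrite /gr/= ?bop0r//.
  by move=> -> ->; rewrite bop_lin.
by move=> -> ->.
Qed.

Lemma gr_bounded f : bounded_op (gr f).
Proof.
split; first exact: gr_op.
  by apply/seteqP; split=> // x _; exists (f x).
have [M hM] := bop_bnd f; exists M%:C => x y; rewrite /gr/= => ->.
by rewrite !normr_hN -rmorphM lecR.
Qed.

Lemma bounded_opP T : bounded_op T -> exists f : bop, T = gr f.
Proof.
move=> [oT dT [M hM]].
have /choice[f fP] : forall x, exists y, T (x, y).
  by move=> x; have : dom T x by rewrite dT.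
have flin c x y : f (c *: x + y) = c *: f x + f y.
  exact: (op_fun oT (fP _) (op_lin c oT (fP x) (fP y))).
have fbd : exists M : R, bnd f M.
  exists (complex.Re M) => x; have := hM _ _ (fP x).
  rewrite !normr_hN => h; have := h; rewrite lecE => /andP[_ /=].
  by case: (M) => a b /=; rewrite mulr0 subr0.
exists (Bop flin fbd); apply/seteqP; split=> [[x y] Txy|[x y]]; rewrite /gr/=.
  exact: op_fun oT Txy (fP x).
by move=> ->.
Qed.

Lemma opadd_grP T f x y : opadd T (gr f) (x, y) <-> exists2 v, T (x, v) & y = v + f x.
Proof.
split=> [[v [w [/= Txv]]]|[v Txv ->]]; last by exists v, (f x).
by rewrite /gr/= => -> ->; exists v.
Qed.

Lemma opcst_gr c : opcst c = gr (c *: (1 : bop)).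
Proof. by []. Qed.

Lemma opadd_gr f g : opadd (gr f) (gr g) = gr (f + g).
Proof.
apply/seteqP; split=> [[x y] [a [b []]]|[x y]]; rewrite /gr/=.
  by move=> -> -> ->.
by move=> ->; exists (f x), (g x).
Qed.

Lemma opscale_gr c f : opscale c (gr f) = gr (c *: f).
Proof.
apply/seteqP; split=> [[x y] [a]|[x y]]; rewrite /gr/=.
  by move=> -> ->.
by move=> ->; exists (f x).
Qed.

Lemma opsub_gr f g : opsub (gr f) (gr g) = gr (f - g).
Proof. by rewrite /opsub opscale_gr opadd_gr scaleN1r. Qed.

Lemma opmul_gr f g : opmul (gr f) (gr g) = gr (f * g).
Proof.
apply/seteqP; split=> [[x y] [a]|[x y]]; rewrite /gr/=.
  by move=> -> ->.
by move=> ->; exists (g x).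
Qed.

Lemma oppow_gr f n : oppow (gr f) n = gr (f ^+ n).
Proof.
elim: n => [|n IH]; first by rewrite /oppow /= opcst_gr scale1r.
by rewrite /oppow iterS -/(oppow _ n) IH opmul_gr exprS.
Qed.

Lemma adj_gr f : adj ip (gr f) = gr (badj ip f).
Proof.
apply/seteqP; split=> [[u v] uv|[u v]]; rewrite /gr/=.
  by apply: (ip_inj ip) => x; rewrite -badjP -(adjE uv (erefl (f x) : gr f (x, f x))).
by move=> -> x y /= ->; rewrite badjP.
Qed.

Lemma opmulA S T (U : set (H * H)) : opmul S (opmul T U) = opmul (opmul S T) U.
Proof.
apply/seteqP; split=> [[x y] [b [a Uxa Tab] Sby]|[x y] [a Uxa [b Tab Sby]]].
  by exists a => //; exists b.
by exists b => //; exists a.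
Qed.

Lemma opmul1 T : opmul T (opcst 1) = T.
Proof.
apply/seteqP; split=> [[x y] [a]|[x y]]; rewrite /opcst/=.
  by move=> ->; rewrite scale1r.
by exists x => //=; rewrite scale1r.
Qed.

Lemma op1mul T : opmul (opcst 1) T = T.
Proof.
apply/seteqP; split=> [[x y] [a h]|[x y]]; rewrite /opcst/=.
  by move=> ->; rewrite scale1r.
by exists y => //=; rewrite scale1r.
Qed.

Lemma oppowSr T n : oppow T n.+1 = opmul (oppow T n) T.
Proof.
elim: n => [|n IH]; first by rewrite /oppow /= opmul1 op1mul.
by rewrite -[LHS]/(opmul T (oppow T n.+1)) [in LHS]IH; exact: opmulA.
Qed.

End GraphCalculus.

Section Scale.
Variables (R : realType) (H : completeNormedModType R[i]).
Variable ip : {dot H for Num.conj}.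
Context {ipH : hilbert ip}.
Local Notation bop := (bop H).
Local Notation adj := (adj ip).
Implicit Types (x y u v : H) (N T : set (H * H)).

(** This is normality together with [N^* N = G]. The instances are [D_+], [D_-]
    and [G^(1/2)]; all of them have the same domain. *)
Definition normal_root N G := [/\ closed_dense ip N, opmul (adj N) N = G & opmul N (adj N) = G].

Variables G S : set (H * H).
Hypotheses (pG : nonneg_sa ip G) (nS : normal_root S G) (saS : adj S = S).

Local Notation r := (res G 1).

Lemma normal_root_adj N : normal_root N G -> normal_root (adj N) G.
Proof.
move=> [cN e1 e2]; split; first exact: closed_dense_adj.
  by rewrite (closed_dense_adjK cN).
by rewrite (closed_dense_adjK cN).
Qed.

(** A normal root commutes with the resolvent of [G], because
    [(1 + N N^* ) N = N (1 + N^* N)]. *)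
Lemma root_res N u v : normal_root N G -> N (u, v) -> N (r u, r v).
Proof.
move=> [[oN _ _] e1 e2] Nuv.
have := res1_in pG u; rewrite -{1}e1 => -[w Nw Aw]; rewrite /= in Nw Aw.
have : G (w, v - w) by rewrite -e2; exists (u - r u) => //=; exact: op_sub.
by move=> /(res1K pG); rewrite subrKC => ->.
Qed.

(** The converse inclusion: powers of the resolvent regularize, and the relation
    between the regularized vectors can be undone. *)
Lemma root_resV N u v : normal_root N G -> N (r u, r v) -> N (u, v).
Proof.
move=> [cN e1 e2] Nr; have [oN _ tN] := cN; have oA := adj_op tN.
have := res1_in pG u; rewrite -{1}e1 => -[w Nw Aw]; rewrite /= in Nw Aw.
have wv := op_fun oN Nw Nr; subst w.
have := res1_in pG v; rewrite -{1}e2 => -[t At Nt]; rewrite /= in At Nt.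
rewrite (op_fun oA At Aw) in Nt.
by have := op_add oN Nr Nt; rewrite !subrKC.
Qed.

Lemma root_resX N u v k : normal_root N G -> N (u, v) -> N ((r ^+ k) u, (r ^+ k) v).
Proof.
by move=> nN Nuv; elim: k => [//|k IH]; rewrite !bopXS; exact: root_res.
Qed.

Lemma root_resXV N u v k : normal_root N G -> N ((r ^+ k) u, (r ^+ k) v) -> N (u, v).
Proof.
move=> nN; elim: k => [//|k IH]; rewrite !bopXS => h.
by apply: IH; exact: root_resV.
Qed.

Lemma root_dom N : normal_root N G -> dom N = dom S.
Proof.
move=> [cN e1 _]; have [cS e2 _] := nS.
by apply/seteqP; split; apply: form_domain => //; rewrite e1 e2.
Qed.

Let oS : is_operator S. Proof. by have [[]] := nS. Qed.

Definition scale m := dom (oppow S m).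

Lemma scale0 x : scale 0 x.
Proof. by exists (1 *: x). Qed.

Lemma scaleS m x : scale m.+1 x <-> exists2 w, S (x, w) & scale m w.
Proof.
rewrite /scale oppowSr; split=> [[y [w Sxw Swy]]|[w Sxw [y Swy]]].
  by exists w => //; exists y.
by exists y, w.
Qed.

Lemma scale1 x : scale 1 x <-> dom S x.
Proof.
rewrite scaleS; split=> [[w Sw _]|[w Sw]]; first by exists w.
by exists w => //; exact: scale0.
Qed.

Lemma scaleSS m x : scale m.+2 x <-> exists2 w, G (x, w) & scale m w.
Proof.
have [_ e1 _] := nS; rewrite -e1 saS scaleS; split.
  by move=> [w Sxw /scaleS[y Swy my]]; exists y => //; exists w.
by move=> [y [w Sxw Swy] my]; exists w => //; apply/scaleS; exists y.
Qed.

Lemma scale_le m n x : (m <= n)%N -> scale n x -> scale m x.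
Proof.
elim: n m x => [|n IH] [|m] x //; try by move=> _ _; exact: scale0.
by move=> mn /scaleS[w Sxw nw]; apply/scaleS; exists w => //; exact: IH nw.
Qed.

Lemma scale_subspace m : subspace (scale m).
Proof.
elim: m => [|m [IH0 IH]]; first by split=> *; exact: scale0.
split; first by apply/scaleS; exists 0 => //; case: oS.
move=> c x y /scaleS[w h1 h2] /scaleS[w' h1' h2']; apply/scaleS.
by exists (c *: w + w'); [exact: op_lin | exact: IH].
Qed.

Lemma scale_res m x : scale m x -> scale m (r x).
Proof.
elim: m x => [|m IH] x; first by move=> _; exact: scale0.
by move=> /scaleS[w Sxw mw]; apply/scaleS; exists (r w);
  [exact: root_res | exact: IH].
Qed.

(** [Dom S^(m+2)] is the image of [Dom S^m] under the resolvent. This turns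
    membership in the scale into a statement on ranges of bounded operators. *)
Lemma scale_range m x : scale m.+2 x <-> exists2 v, scale m v & x = r v.
Proof.
split=> [mx|[v mv ->]].
  have mx' : scale m x by apply: scale_le mx; rewrite ltnW.
  move/scaleSS: mx => [w Gxw mw]; exists (x + w); last by rewrite res1K.
  exact: subspaceD (scale_subspace m) mx' mw.
apply/scaleSS; exists (v - r v); first exact: res1_in.
exact: subspaceB (scale_subspace m) mv (scale_res mv).
Qed.

Lemma scale_resX m k x : scale m x -> scale (k.*2 + m)%N ((r ^+ k) x).
Proof.
move=> mx; elim: k => [//|k IH]; rewrite doubleS !addSn bopXS.
by apply/scale_range; exists ((r ^+ k) x).
Qed.

Lemma scale_double k x : scale k.*2 x -> exists v, x = (r ^+ k) v.
Proof.
elim: k x => [|k IH] x; first by exists x.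
rewrite doubleS => /scale_range[v /IH[w ->] ->]; exists w.
by rewrite bopXS.
Qed.

(** Every normal root lowers the scale by one. The step is by two, since only
    the square of the root is related to [S] directly, so two consecutive levels
    are carried through the induction. *)
Lemma root_scale N m x y : normal_root N G -> N (x, y) -> scale m.+1 x -> scale m y.
Proof.
move=> nN; have [[oN _ _] e1 _] := nN.
pose P m := forall x y, N (x, y) -> scale m.+1 x -> scale m y.
suff : P m /\ P m.+1 by case=> h _; exact: h.
elim: m => [|m [IH0 IH1]]; split=> //.
- by move=> *; exact: scale0.
- move=> a b Nab /scaleSS[w]; rewrite -e1 => -[b' Nab' Aw] _; apply/scale1.
  rewrite (op_fun oN Nab Nab') -(root_dom (normal_root_adj nN)).
  by exists w.
- move=> a b Nab /scale_range[v mv E].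
  have : dom N v by rewrite (root_dom nN); apply/scale1; exact: scale_le mv.
  move=> [w Nvw]; apply/scale_range; exists w; first exact: IH0 Nvw mv.
  by rewrite E in Nab; exact: op_fun oN Nab (root_res nN Nvw).
Qed.

(** ** Smooth operators *)

(** The bounded operator [B k] extends the [k]-fold commutator of [S] with [B 0].
    The aim is that the adjoint of [B 0] preserves the scale as well, although
    the commutators are only known on [Dom S^k]. *)
Section Smooth.
Variables (B : nat -> bop).
Hypothesis B0 : forall m x, scale m x -> scale m (B 0%N x).
Hypothesis BC : forall k, iter_comm S k (gr (B 0%N)) `<=` gr (B k).

Lemma iter_comm_scale k j x : scale (k + j)%N x ->
  iter_comm S k (gr (B 0%N)) (x, B k x) /\ scale j (B k x).
Proof.
suff h : scale (k + j)%N x -> exists2 y, iter_comm S k (gr (B 0%N)) (x, y) & scale j y.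
  by move=> /h[y Cxy jy]; have := BC Cxy; rewrite /gr/= => <-.
elim: k j x => [|k IH] j x; first by move=> jx; exists (B 0%N x) => //; exact: B0.
move=> kx; have kx' : scale (k + j.+1)%N x by rewrite addnS.
have [y1 C1 /scaleS[s1 Sy s1j]] := IH _ _ kx'.
move: kx; rewrite addSn => /scaleS[w Sxw /IH[y2 C2 y2j]].
exists (s1 + (-1) *: y2).
  exists s1, ((-1) *: y2); split=> //=; first by exists y1.
  by exists y2 => //; exists w.
by rewrite scaleN1r; exact: subspaceB (scale_subspace j) s1j y2j.
Qed.

Lemma smooth_comm k x w : scale k.+1 x -> S (x, w) -> S (B k x, B k.+1 x + B k w).
Proof.
move=> kx Sxw.
have [C1 s1] : iter_comm S k (gr (B 0%N)) (x, B k x) /\ scale 1 (B k x).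
  by apply: iter_comm_scale; rewrite addn1.
have [C2 _] : iter_comm S k.+1 (gr (B 0%N)) (x, B k.+1 x) /\ scale 0 (B k.+1 x).
  by apply: iter_comm_scale; rewrite addn0.
move: C2 => /= [a [b [[c C1' Sca] [d [e Se Ced] bE] E]]]; rewrite /= in C1' Sca Se Ced bE E.
have cE : c = B k x by have := BC C1'; rewrite /gr.
have eE : e = w by exact: op_fun oS Se Sxw.
have dE : d = B k w by have := BC Ced; rewrite /gr/= eE.
rewrite E bE scaleN1r dE subrK -cE.
exact: Sca.
Qed.

(** Formally [S (B k)^* = (B k)^* S - (B (k+1))^*], the adjoint of the commutator
    relation. That relation is available on [Dom S^(k+1)] only, so it is tested
    on vectors [(1 + G)^-k x]; the power of the resolvent is then cancelled. *)
Lemma smooth_adj k y y' : S (y, y') ->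
  S (badj ip (B k) y, badj ip (B k) y' - badj ip (B k.+1) y).
Proof.
move=> Syy; apply: (@root_resXV S _ _ k) => //; rewrite -saS => x x' Sxx /=.
have rk : badj ip (r ^+ k) = r ^+ k by rewrite badjX (res1_adj pG).
have rE u v : ip u ((r ^+ k) v) = ip ((r ^+ k) u) v by rewrite badjP rk.
rewrite !rE.
have Srk := root_resX k nS Sxx.
have sk : scale k.+1 ((r ^+ k) x).
  apply: (@scale_le _ (k.*2 + 1)%N); first by rewrite addn1 ltnS -addnn leq_addr.
  by apply: scale_resX; apply/scale1; exists x'.
have Sb := smooth_comm sk Srk.
have : adj S (y, y') by rewrite saS.
move=> /(_ _ _ Sb) /=; rewrite ipDl !badjP => E.
by rewrite bopB ipBr -E addrC addrA addNr add0r.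
Qed.

Lemma smooth_adj_scale k m x : scale m x -> scale m (badj ip (B k) x).
Proof.
elim: m k x => [|m IH] k x mx; first exact: scale0.
have mx' : scale m x by exact: scale_le mx.
move/scaleS: mx => [w Sxw mw]; apply/scaleS.
exists (badj ip (B k) w - badj ip (B k.+1) x); first exact: smooth_adj.
by apply: subspaceB (scale_subspace m) _ _; exact: IH.
Qed.

End Smooth.

(** ** Bounded perturbations of a normal operator *)

Section Perturbation.
Variables (N : set (H * H)) (a : bop).
Hypothesis nN : normal_root N G.
Hypothesis aS : forall m x, scale m x -> scale m (a x).
Hypothesis aS' : forall m x, scale m x -> scale m (badj ip a x).

Local Notation T := (opadd N (gr a)).

Lemma adj_perturb : adj T = opadd (adj N) (gr (badj ip a)).
Proof.
apply/seteqP; split=> [[u v] uv|[u v] /opadd_grP[w Nuw ->]].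
  apply/opadd_grP; exists (v - badj ip a u); last by rewrite subrK.
  move=> x y Nxy /=; have : T (x, y + a x) by apply/opadd_grP; exists y.
  by move=> /(adjE uv); rewrite ipDl ipBr badjP => E; rewrite -E addrK.
move=> x _ /opadd_grP[y Nxy ->] /=.
by rewrite ipDl ipDr (adjE Nuw Nxy) badjP.
Qed.

Lemma closed_dense_perturb : closed_dense ip T.
Proof.
have [[oN cN tN] _ _] := nN; split.
- split.
  + by apply/opadd_grP; exists 0; [case: oN | rewrite bop0r addr0].
  + move=> c x y x' y' /opadd_grP[w h1 ->] /opadd_grP[w' h1' ->].
    apply/opadd_grP; exists (c *: w + w'); first exact: op_lin.
    by rewrite bop_lin scalerDr addrACA.
  + move=> x y y' /opadd_grP[w h1 ->] /opadd_grP[w' h1' ->].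
    by rewrite (op_fun oN h1 h1').
- move=> x y h; apply/opadd_grP; exists (y - a x); last by rewrite subrK.
  apply: cN => e e0; have [M M0 aM] := bop_bnd_gt0 a.
  have d0 : 0 < e / (1 + M) by rewrite divr_gt0// addr_gt0.
  have [b [c [/opadd_grP[w Nbw ->] xb yc]]] := h _ d0.
  have de : e / (1 + M) <= e.
    by rewrite ler_pdivrMr ?addr_gt0// ler_peMr ?(ltW e0)// lerDl ltW.
  exists b, w; split=> //; first exact: le_trans de.
  have -> : y - a x - w = (y - (w + a b)) - a (x - b).
    by rewrite bopB; apply: (ip_inj ip) => z; rewrite !ipE; ring.
  rewrite (le_trans (hND _ _))// hNN.
  apply: (@le_trans _ _ (e / (1 + M) + M * (e / (1 + M)))).
    by rewrite lerD// (le_trans (aM _))// ler_wpM2l// ltW.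
  by rewrite -[X in X + _]mul1r -mulrDl mulrC divfK// gt_eqF// addr_gt0.
- suff <- : dom N = dom T by [].
  apply/seteqP; split=> [x [y Nxy]|x [_ /opadd_grP[y Nxy _]]]; last by exists y.
  by exists (y + a x); apply/opadd_grP; exists y.
Qed.

(** Elliptic regularity for [T = N + a]. With [T x = N x + a x] the equation
    [T^* T x = y] reads [G x = y - a^* (T x) - N^* (a x)], and if [x] is in level
    [m + 2] of the scale, the last two terms are in level [m + 1]. Each level of
    regularity of [y] thus gives one more of [x]. *)
Lemma perturb_scale m x y : opmul (adj T) T (x, y) -> scale m y -> scale m.+2 x.
Proof.
have [[oN cN tN] e1 _] := nN.
have nA := normal_root_adj nN; have oA := adj_op tN.
rewrite adj_perturb => -[t /opadd_grP[v Nxv /= ->] /opadd_grP[w Aw ->]].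
elim: m => [_|m IH my].
  have x1 : scale 1 x by apply/scale1; rewrite -(root_dom nN); exists v.
  have t1 : scale 1 (v + a x) by apply/scale1; rewrite -(root_dom nA); exists w.
  have : scale 1 v.
    have := subspaceB (scale_subspace 1) t1 (aS x1).
    by rewrite addrK.
  move/scale1; rewrite -(root_dom nA) => -[u Au]; apply/scaleSS.
  by exists u; [rewrite -e1; exists v | exact: scale0].
have xm := IH (scale_le (leqnSn m) my).
have v1 : scale m.+1 v by exact: root_scale nN Nxv xm.
have ax : scale m.+2 (a x) by exact: aS.
have sm := scale_subspace m.+1.
have : scale 1 (a x) by apply: scale_le ax.
move/scale1; rewrite -(root_dom nA) => -[u Au].
have u1 : scale m.+1 u by exact: root_scale nA Au ax.
have Av := op_sub oA Aw Au; rewrite addrK in Av.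
apply/scaleSS; exists (w - u); first by rewrite -e1; exists v.
apply: (subspaceB sm _ u1).
have : scale m.+1 (badj ip a (v + a x)).
  by apply: aS'; apply: (subspaceD sm v1 _); exact: scale_le ax.
by move=> h; have := subspaceB sm my h; rewrite addrK.
Qed.

(** The case [m = 0] of regularity gives one inclusion; for the other one, [a]
    maps [Dom G] into [Dom N^*]. *)
Lemma perturb_dom : dom (opmul (adj T) T) = dom G.
Proof.
have [[oN cN tN] e1 _] := nN.
have nA := normal_root_adj nN; have oA := adj_op tN.
apply/seteqP; split=> [x [y Txy]|x [y Gxy]].
  by have /scaleSS[w Gxw _] := perturb_scale Txy (scale0 y); exists w.
have x2 : scale 2 x by apply/scaleSS; exists y => //; exact: scale0.
move: Gxy; rewrite -e1 => -[v Nxv Avy]; rewrite /= in Nxv Avy.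
have v1 : scale 1 v by exact: root_scale nN Nxv x2.
have ax1 : scale 1 (a x) by apply: scale_le (aS x2).
have /scale1 := subspaceD (scale_subspace 1) v1 ax1.
rewrite -(root_dom nA) => -[w Aw].
exists (w + badj ip a (v + a x)), (v + a x) => /=.
  by apply/opadd_grP; exists v.
by rewrite adj_perturb; apply/opadd_grP; exists w.
Qed.

(** Each application of the perturbed resolvent raises the level by two, so its
    [k]-th power maps into [Dom G^k], the range of [(1 + G)^-k]. *)
Lemma perturb_res_range k x :
  exists v, (res (opmul (adj T) T) 1 ^+ k) x = (r ^+ k) v.
Proof.
have /(_ ipH) pT := square_nonneg_sa closed_dense_perturb.
apply: scale_double; elim: k x => [|k IH] x; first exact: scale0.
rewrite doubleS bopXS.
apply: (perturb_scale (res1_in pT ((res (opmul (adj T) T) 1 ^+ k) x))).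
apply: subspaceB (scale_subspace _) (IH _) _.
by rewrite -bopXS bopXSr; exact: IH.
Qed.

End Perturbation.

End Scale.

(** * Uniform boundedness and factorization *)

Section UniformBoundedness.
Variables (R : realType) (H : completeNormedModType R[i]).
Implicit Types (x y : H) (p : H -> R).

Definition bounded_seminorm p :=
  [/\ forall x y, p (x + y) <= p x + p y,
      forall (c : R[i]) x, p (c *: x) = normc c * p x
    & exists M : R, forall x, p x <= M * hN x].

Lemma seminormN p x : bounded_seminorm p -> p (- x) = p x.
Proof. by move=> [_ pZ _]; rewrite -scaleN1r pZ normcN normc1 mul1r. Qed.

(** One step of the gliding hump: move the point [x] by at most [d] so that some
    member of the family exceeds [n] there, and keep it so nearby. *)
Lemma hump (F : set (H -> R)) (n : nat) x (d : R) :
  (forall p, F p -> bounded_seminorm p) ->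
  (forall M : R, exists2 p, F p & exists v, M * hN v < p v) -> 0 < d ->
  exists p x' d', [/\ F p, hN (x' - x) <= d, n.+1%:R <= p x', 0 < d' /\ d' <= d / 2
    & forall y, hN y <= 2 * d' -> p y <= 1].
Proof.
move=> Fs Fu d0; have [p Fp [v pv]] := Fu (n.+1%:R / d).
have [pD pZ [M pM]] := Fs p Fp.
have hv : 0 < hN v.
  rewrite lt_def hN_ge0 andbT; apply/eqP => v0; move: pv.
  by rewrite (hN0_eq0 v0) -(scale0r (0 : H)) pZ normc0 mul0r scale0r hN0 mulr0 ltxx.
pose xi := (d / hN v)%:C *: v.
have dv : 0 <= d / hN v by rewrite divr_ge0 ?hN_ge0 ?ltW.
have hxi : hN xi = d by rewrite hNZ normcr ger0_norm// divfK// gt_eqF.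
have pxi : n.+1%:R <= p xi.
  rewrite pZ normcr ger0_norm// mulrAC ler_pdivlMr// -ler_pdivrMl//.
  by rewrite mulrA [_ * n.+1%:R]mulrC ltW.
have [x' xx' px'] : exists2 x', hN (x' - x) <= d & n.+1%:R <= p x'.
  have [h|h] := leP n.+1%:R (p (x + xi)).
    by exists (x + xi) => //; rewrite addrC addKr hxi.
  exists (x - xi); first by rewrite addrC addKr hNN hxi.
  have := pD (x + xi) (- (x - xi)).
  rewrite seminormN; last exact: Fs.
  have -> : x + xi - (x - xi) = 2%:C *: xi.
    by rewrite opprB addrC subrKA rmorph_nat scaler_nat mulr2n.
  rewrite pZ normcr ger0_norm//.
  by move: pxi h; move: (p xi) (p (x + xi)) (p (x - xi)) => a b c; lra.
have K0 : 0 < `|M| + 1 by rewrite ltr_wpDl.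
exists p, x', (Num.min (d / 2) (2 * (`|M| + 1))^-1); split=> //.
  rewrite ge_min lexx; split=> //.
  by rewrite lt_min; apply/andP; split; rewrite ?divr_gt0// invr_gt0 mulr_gt0.
move=> y; set d' := Num.min _ _ => yd.
have d'le : d' <= (2 * (`|M| + 1))^-1 by rewrite ge_min lexx orbT.
rewrite (le_trans (pM y))//; apply: (@le_trans _ _ ((`|M| + 1) * hN y)).
  by rewrite ler_wpM2r ?hN_ge0// (le_trans (ler_norm _))// lerDl.
rewrite mulrC -ler_pdivlMr// mul1r (le_trans yd)//.
by move: d'le; rewrite invfM -ler_pdivlMl ?invr_gt0// invrK.
Qed.

(** If the family were unbounded, the gliding hump steps would converge to a
    point at which it is unbounded. *)
Lemma uniform_boundedness (F : set (H -> R)) :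
  (forall p, F p -> bounded_seminorm p) ->
  (forall x, exists M : R, forall p, F p -> p x <= M) ->
  exists M : R, forall p, F p -> forall x, p x <= M * hN x.
Proof.
move=> Fs Fpt; apply: contrapT => nb.
have Fu (M : R) : exists2 p, F p & exists v, M * hN v < p v.
  apply: contrapT => h; apply: nb; exists M => p Fp v.
  by rewrite leNgt; apply/negP => pv; apply: h; exists p => //; exists v.
pose st := (H * {posnum R})%type.
have step (ns : nat * st) : exists s' : st, exists p, [/\ F p,
    hN (s'.1 - ns.2.1) <= ns.2.2%:num, ns.1.+1%:R <= p s'.1,
    s'.2%:num <= ns.2.2%:num / 2 & forall y, hN y <= 2 * s'.2%:num -> p y <= 1].
  case: ns => n [x d].
  have [p [x' [d' [Fp xx px [d0 dd] py]]]] := hump n x Fs Fu [gt0 of d%:num].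
  by exists (x', PosNum d0), p.
have /choice[f fP] := step.
pose s := fix s n : st := if n is m.+1 then f (m, s m) else (0, PosNum ltr01).
pose x n := (s n).1; pose d n : R := (s n).2%:num.
have d0 n : 0 < d n by rewrite /d; exact: gt0.
have sP n : exists p, [/\ F p, hN (x n.+1 - x n) <= d n, n.+1%:R <= p (x n.+1),
    d n.+1 <= d n / 2 & forall y, hN y <= 2 * d n.+1 -> p y <= 1].
  exact: (fP (n, s n)).
have dist n k : hN (x (k + n)%N - x n) <= 2 * d n - 2 * d (k + n)%N.
  elim: k => [|k IH]; first by rewrite add0n !subrr hN0.
  have [p [_ h _ dd _]] := sP (k + n)%N.
  rewrite addSn -(subrKA (x (k + n)%N)) (le_trans (hND _ _))//.
  by move: IH h dd; rewrite -/(addn _ _); lra.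
have dn n : d n * n.+1%:R <= 1.
  elim: n => [|n IH]; first by rewrite mulr1.
  have [p [_ _ _ dd _]] := sP n.
  apply: le_trans IH; apply: (@le_trans _ _ (d n / 2 * n.+2%:R)).
    by rewrite ler_wpM2r.
  rewrite -mulrA ler_wpM2l ?(ltW (d0 n))//.
  rewrite -[n.+2%:R]natr1 -[n.+1%:R]natr1; have := ler0n R n; lra.
have dist2 n m : (n <= m)%N -> hN (x m - x n) <= 2 * d n.
  move=> nm; have := dist n (m - n)%N; rewrite subnK// => /le_trans; apply.
  by have := d0 m; lra.
have [|l lP] := @hN_cauchy _ _ x.
  move=> e e0; have [n0 h0] := qf_archi (divr_gt0 e0 (ltr0Sn _ 3)).
  exists n0 => m n mn nn.
  have dn0 : d n0 <= e / 4.
    apply: le_trans (h0 n0 (leqnn _)).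
    by rewrite -[leRHS]mul1r ler_pdivlMr.
  have -> : x m - x n = (x m - x n0) - (x n - x n0) by rewrite opprB subrKA.
  rewrite (le_trans (hND _ _))// hNN.
  by have := dist2 _ _ mn; have := dist2 _ _ nn; lra.
have [M hM] := Fpt l.
pose n := (Num.truncn `|M|).+1.
have [p [Fp _ px _ py]] := sP n.
have [pD pZ _] := Fs p Fp.
have lx : hN (x n.+1 - l) <= 2 * d n.+1.
  rewrite -subr_le0; apply: real_eps0 => e e0; rewrite lerBlDr.
  have [n1 h1] := lP _ e0; pose m := maxn n1 n.+1.
  have -> : x n.+1 - l = (x m - l) - (x m - x n.+1) by rewrite opprB [RHS]addrC subrKA.
  rewrite (le_trans (hND _ _))// hNN lerD ?h1 ?leq_maxl// dist2// leq_maxr//.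
have := pD (x n.+1 - l) l; rewrite subrK; have := py _ lx; have := hM p Fp.
have : M < n%:R by rewrite (le_lt_trans (ler_norm _))// truncnS_gt.
move: px; rewrite -natr1; move: n%:R (p l) (p (x n.+1)) (p (x n.+1 - l)).
by move=> t a b c; lra.
Qed.

End UniformBoundedness.

Section RangeFactor.
Variables (R : realType) (H : completeNormedModType R[i]).
Variable ip : {dot H for Num.conj}.
Context {ipH : hilbert ip}.
Local Notation bop := (bop H).

(** The operator [T = X^-1 Y] is everywhere defined, and it is bounded by the
    uniform boundedness principle for the functionals [x |-> <x, Y^* y>] with
    [|X y| <= 1]: at [x] they equal [<T x, X y>] and are at most [|T x|]. *)
Lemma range_factor (X Y : bop) : badj ip X = X -> injective X ->
  (forall x, exists v, Y x = X v) -> exists T : bop, Y = X * T.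
Proof.
move=> Xs Xi /choice[t tP].
have swap x y : ip x (badj ip Y y) = ip (t x) (X y).
  by rewrite -badjP tP badjP Xs.
pose F := [set p : H -> R | exists2 y, hN (X y) <= 1 &
  p = fun x => normc (ip x (badj ip Y y))].
have [_ [y _ ->]|x|M hM] := @uniform_boundedness _ _ F.
- split=> [u v|c u|].
  + by rewrite ipDl le_normcD.
  + by rewrite ipZl normcM.
  + exists (hN (badj ip Y y)) => u; rewrite mulrC; exact: ip_CS.
- exists (hN (t x)) => _ [y y1 ->]; rewrite swap.
  by rewrite (le_trans (ip_CS _ _))// ler_piMr ?hN_ge0.
have key x y : normc (ip (t x) (X y)) <= `|M| * hN x * hN (X y).
  have [y0|y0] := eqVneq (hN (X y)) 0.
    by rewrite (hN0_eq0 y0) ip0r normc0 hN0 mulr0.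
  have yp : 0 < hN (X y) by rewrite lt_def y0 hN_ge0.
  pose y1 := (hN (X y))^-1%:C *: y.
  have Fy : hN (X y1) <= 1.
    by rewrite /y1 bopZ hNZ normcr ger0_norm ?invr_ge0 ?hN_ge0// mulVf.
  have : normc (ip x (badj ip Y y1)) <= M * hN x.
    by apply: (hM (fun x => normc (ip x (badj ip Y y1)))); exists y1.
  rewrite swap bopZ ipZr conjC_realC normcM normcr ger0_norm ?invr_ge0 ?hN_ge0//.
  rewrite ler_pdivrMl// mulrC => /le_trans; apply.
  by rewrite ler_wpM2r ?hN_ge0// ler_wpM2r ?hN_ge0// ler_norm.
have tlin c x y : t (c *: x + y) = c *: t x + t y.
  by apply: Xi; rewrite bop_lin -!tP bop_lin.
have tbd : exists K, bnd t K.
  exists `|M| => x; set a := `|M| * hN x.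
  have a0 : 0 <= a by rewrite mulr_ge0 ?hN_ge0.
  have b0 := hN_ge0 (t x).
  suff : hN (t x) ^+ 2 - a * hN (t x) <= 0 by move: (hN _) b0 => b; nra.
  have k0 : 0 < hN (t x) + a + 1 by lra.
  apply: real_eps0 => e e0.
  have tX : adherent (range X) (t x).
    by apply: (total_adherent (range_subspace X)); exact: (@sa_inj_total _ _ ip).
  have [_ [y _ <-] le] := tX _ (divr_gt0 e0 k0); set d := e / _ in le.
  have d0 : 0 < d by rewrite divr_gt0.
  have h1 : normc (ip (t x) (t x - X y)) <= hN (t x) * d.
    by rewrite (le_trans (ip_CS _ _))// ler_wpM2l.
  have h2 : normc (ip (t x) (X y)) <= a * (hN (t x) + d).
    rewrite (le_trans (key _ _))// ler_wpM2l//.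
    rewrite -[X y](subrK (t x)) addrC (le_trans (hND _ _))// lerD2l.
    by rewrite hNB.
  have h3 : hN (t x) ^+ 2 <= normc (ip (t x) (t x - X y)) + normc (ip (t x) (X y)).
    apply: le_trans (le_normcD _ _); rewrite -ipDr subrK ip_hN normcr.
    exact: ler_norm.
  have h4 : d * (hN (t x) + a + 1) = e by rewrite divfK// gt_eqF.
  by move: h1 h2 h3 h4 d0; move: (hN (t x)) (normc _) (normc _) => ? ? ?; nra.
exists (Bop tlin tbd); apply: bopP => x; exact: tP.
Qed.

End RangeFactor.

(** * Trace class operators *)

Section Douglas.
Variables (R : realType) (H : completeNormedModType R[i]).
Variable ip : {dot H for Num.conj}.
Context {ipH : hilbert ip}.
Local Notation bop := (bop H).

(** The map [X x |-> Y x] is a well defined contraction on the range of [X]. It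
    extends to the closure of this range, and by [0] to the orthogonal
    complement. In the graph of the extension, [p] is the projection of [h] onto
    that closure and [k] is the limit of [Y x] as [X x] tends to [p]. *)
Lemma douglas (X Y : bop) : (forall x, hN (Y x) <= hN (X x)) ->
  exists2 Z : bop, Y = Z * X & bnd Z 1.
Proof.
move=> YX.
pose P h p := adherent (range X) p /\ forall x, ip (X x) (h - p) = 0.
pose Q p k := forall e : R, 0 < e -> exists x, hN (p - X x) <= e /\ hN (k - Y x) <= e.
pose Z := [set hk : H * H | exists2 p, P hk.1 p & Q p hk.2].
have Qbd p k : Q p k -> hN k <= hN p.
  move=> h; rewrite -subr_le0; apply: real_eps0 => e e0.
  have [x [h1 h2]] := h _ (divr_gt0 e0 (ltr0Sn _ 1)).
  have h3 := hND (k - Y x) (Y x); rewrite subrK in h3.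
  have h4 := hND (X x - p) p; rewrite subrK hNB in h4.
  by have := YX x; lra.
have Qlin c p k p' k' : Q p k -> Q p' k' -> Q (c *: p + p') (c *: k + k').
  move=> h h' e e0; pose K := normc c + 1.
  have K0 : 0 < K by rewrite ltr_wpDl// normc_ge0.
  have [x [x1 x2]] := h _ (divr_gt0 e0 K0).
  have e2 : 0 < e / K by rewrite divr_gt0.
  have [x' [x1' x2']] := h' _ e2.
  have est (a b a' b' : H) : hN (a - b) <= e / K -> hN (a' - b') <= e / K ->
      hN (c *: a + a' - (c *: b + b')) <= e.
    move=> ab ab'; have -> : c *: a + a' - (c *: b + b') = c *: (a - b) + (a' - b').
      by rewrite scalerBr opprD addrACA.
    rewrite (le_trans (hND _ _))// hNZ.
    apply: (@le_trans _ _ (normc c * (e / K) + e / K)).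
      by rewrite lerD// ler_wpM2l ?normc_ge0.
    by rewrite -[X in _ + X]mul1r -mulrDl -/K mulrC divfK// gt_eqF.
  by exists (c *: x + x'); rewrite !bop_lin; split; exact: est.
have Plin c h p h' p' : P h p -> P h' p' -> P (c *: h + h') (c *: p + p').
  move=> [a o] [a' o']; split; last first.
    move=> x; have -> : c *: h + h' - (c *: p + p') = c *: (h - p) + (h' - p').
      by rewrite scalerBr opprD addrACA.
    by rewrite ipDr ipZr o o' mulr0 addr0.
  move=> e e0; pose K := normc c + 1.
  have K0 : 0 < K by rewrite ltr_wpDl// normc_ge0.
  have [_ [x _ <-] hx] := a _ (divr_gt0 e0 K0).
  have [_ [x' _ <-] hx'] := a' _ (divr_gt0 e0 K0).
  exists (X (c *: x + x')); first by exists (c *: x + x').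
  have -> : c *: p + p' - X (c *: x + x') = c *: (p - X x) + (p' - X x').
    by rewrite bop_lin scalerBr opprD addrACA.
  rewrite (le_trans (hND _ _))// hNZ.
  apply: (@le_trans _ _ (normc c * (e / K) + e / K)).
    by rewrite lerD// ler_wpM2l ?normc_ge0.
  by rewrite -[X in _ + X]mul1r -mulrDl -/K mulrC divfK// gt_eqF.
have Pbd h p : P h p -> hN p <= hN h.
  move=> [a o]; have ph : ip p (h - p) = 0.
    apply: eq0_normc; apply/eqP; rewrite eq_le normc_ge0 andbT.
    apply: real_eps0 => e e0; pose K := hN (h - p) + 1.
    have K0 : 0 < K by rewrite ltr_wpDl// hN_ge0.
    have [_ [x _ <-] hx] := a _ (divr_gt0 e0 K0).
    have -> : ip p (h - p) = ip (p - X x) (h - p) by rewrite [RHS]ipBl o subr0.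
    rewrite (le_trans (ip_CS _ _))// (@le_trans _ _ (e / K * K))//.
      by rewrite ler_pM ?hN_ge0// lerDl.
    by rewrite divfK// gt_eqF.
  have [->|p0] := eqVneq (hN p) 0; first exact: hN_ge0.
  have pp : 0 < hN p by rewrite lt_def p0 hN_ge0.
  rewrite -(ler_pM2l pp) -expr2; apply: le_trans (ip_CS p h).
  have -> : ip p h = (hN p ^+ 2)%:C.
    by rewrite -[h](subrK p) ipDr ph add0r ip_hN.
  by rewrite normcr ler_norm.
have oZ : is_operator Z.
  split.
  - exists 0.
      split=> [e e0|x]; last by rewrite subrr ip0r.
      by exists 0; [exists 0 => //; exact: bop0r | rewrite subrr hN0 ltW].
    by move=> e e0; exists 0; rewrite !bop0r subrr hN0; split; exact: ltW.
  - move=> c h k h' k' [p P1 Q1] [p' P2 Q2]; exists (c *: p + p').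
      exact: Plin.
    exact: Qlin.
  - move=> h k k' [p P1 Q1] [p' P2 Q2]; rewrite /= in P1 Q1 P2 Q2.
    have PP := Plin (-1) _ _ _ _ P1 P2; have QQ := Qlin (-1) _ _ _ _ Q1 Q2.
    move: PP QQ; rewrite !scaleN1r addNr => /Pbd; rewrite hN0 => p0 /Qbd k0.
    apply/eqP; rewrite eq_sym -subr_eq0 addrC; apply/eqP; apply: hN0_eq0.
    by apply/eqP; rewrite eq_le hN_ge0 andbT (le_trans k0).
have ZX x : Z (X x, Y x).
  exists (X x); first split=> [e e0|z]; rewrite /= ?subrr ?ip0r//.
    by exists (X x); [exists x | rewrite subrr hN0 ltW].
  by move=> e e0; exists x; rewrite !subrr hN0; split; exact: ltW.
have dZ : dom Z = setT.
  apply/seteqP; split=> // h _.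
  have [p pa po] := projection_exists h (range_subspace X).
  have Ph : P h p by split=> // x; apply: po; exists x.
  have [u [uX up]] := adherent_seq pa.
  have /choice[v vP] : forall n, exists x, X x = u n.
    by move=> n; have [x _ xE] := uX n; exists x.
  have [|k kP] := @hN_cauchy _ _ (fun n => Y (v n)).
    move=> e e0; have [n0 h0] := qf_archi (divr_gt0 e0 (ltr0Sn _ 1)).
    exists n0 => m n /h0 mn /h0 nn; rewrite -bopB (le_trans (YX _))// bopB !vP.
    have -> : u m - u n = (p - u n) - (p - u m) by rewrite opprB [RHS]addrC subrKA.
    rewrite (le_trans (hND _ _))// hNN [e]splitr lerD//.
      exact: le_trans (up _) nn.
    exact: le_trans (up _) mn.
  exists k, p => //= e e0.
  have [n0 h0] := qf_archi e0; have [n1 h1] := kP _ e0; pose n := maxn n0 n1.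
  exists (v n); rewrite vP; split.
    by rewrite (le_trans (up _))// h0// leq_maxl.
  by rewrite hNB h1// leq_maxr.
have Zbd h k : Z (h, k) -> hN k <= hN h.
  by move=> [p /Pbd ph /Qbd kp]; exact: le_trans ph.
have [|f fZ] := @bounded_opP _ _ Z.
  by split=> //; exists 1 => h k /Zbd; rewrite mul1r !normr_hN lecR.
exists f.
  by apply: bopP => x; have := ZX x; rewrite fZ /gr/=.
by move=> x; rewrite mul1r; apply: Zbd; rewrite fZ.
Qed.

End Douglas.

Section BoundedSquareRoot.
Variables (R : realType) (H : completeNormedModType R[i]).
Variable ip : {dot H for Num.conj}.
Context {ipH : hilbert ip}.
Local Notation bop := (bop H).
Implicit Types (f b s : bop).

Lemma gr_nonneg_sa b : badj ip b = b -> (forall x, 0 <= ip (b x) x) -> nonneg_sa ip (gr b).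
Proof.
move=> bs b0; split; first exact: gr_op.
- by move=> x y; rewrite /gr/= => ->.
- by rewrite adj_gr bs.
- by move=> h hd; apply: (@ip_eq0 _ _ ip); apply: hd; exists (b h).
Qed.

(** The square root of a bounded operator is bounded, as
    [|S x|^2 = <b x, x>]. *)
Lemma bounded_opsqrt b : badj ip b = b -> (forall x, 0 <= ip (b x) x) ->
  exists s, [/\ opsqrt ip (gr b) = gr s, s * s = b, badj ip s = s &
    forall x, 0 <= ip (s x) x].
Proof.
move=> bs b0; have [[oS _ aS] nS SS] := opsqrtP (gr_nonneg_sa bs b0).
set S := opsqrt _ _ in oS aS nS SS *.
have bb x : exists2 y, S (x, y) & S (y, b x).
  by have : gr b (x, b x) by []; rewrite -SS => -[y]; exists y.
have bS : bounded_op S.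
  split=> //; first by apply/seteqP; split=> // x _; have [y] := bb x; exists y.
  have [M M0 bM] := bop_bnd_gt0 b; exists (M + 1)%:C => x y Sxy.
  have [y' Sxy' Syb] := bb x; have yE := op_fun oS Sxy' Sxy; subst y'.
  have : adj ip S (x, y) by rewrite aS.
  move=> /(adjE (x := y) (y := b x)) /(_ Syb) E.
  rewrite !normr_hN -rmorphM lecR -sq_le ?hN_ge0//; last first.
    by rewrite mulr_ge0 ?hN_ge0// addr_ge0// ltW.
  have h : hN y ^+ 2 <= M * hN x ^+ 2.
    have : normc (ip (b x) x) <= hN (b x) * hN x by exact: ip_CS.
    rewrite E ip_hN normcr ger0_norm ?sqr_ge0// => /le_trans; apply.
    by rewrite expr2 mulrA ler_wpM2r ?hN_ge0.
  rewrite (le_trans h)// exprMn ler_wpM2r ?sqr_ge0//.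
  by move: M0 {bM h}; move: (M) => m; nra.
have [s sS] := bounded_opP bS.
exists s; split=> //.
- by apply: gr_inj; rewrite -opmul_gr -sS SS.
- by apply: gr_inj; rewrite -adj_gr -sS aS.
- by move=> x; apply: nS; rewrite sS.
Qed.

Lemma absolute_value f : exists s, [/\ opsqrt ip (opmul (adj ip (gr f)) (gr f)) = gr s,
  s * s = badj ip f * f, badj ip s = s & forall x, 0 <= ip (s x) x].
Proof.
rewrite adj_gr opmul_gr; apply: bounded_opsqrt; first by rewrite badjM badjK.
by move=> x; rewrite bopME badjPr dnorm_ge0.
Qed.

Lemma hN_sqrt s f x : s * s = badj ip f * f -> badj ip s = s -> hN (s x) = hN (f x).
Proof.
move=> sf ss; have : ip (s x) (s x) = ip (f x) (f x).
  by rewrite -{2}ss -badjP -bopME sf bopME badjPr.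
rewrite !ip_hN => /complexI /eqP.
by rewrite eqrXn2 ?hN_ge0// => /eqP.
Qed.

Lemma app_gr f x : app (gr f) x = f x.
Proof.
have : [set y | gr f (x, y)] (app (gr f) x).
  by apply: (@xgetPex _ 0 [set y | gr f (x, y)]); exists (f x).
by [].
Qed.

End BoundedSquareRoot.

Section FiniteSums.
Variables (R : realType) (I : choiceType).
Implicit Types (E : set I) (u v : I -> R) (K : R).

(** All finite partial sums of [u] over [E] are at most [K]. *)
Definition sums_le E u K := forall s : seq I, uniq s -> (forall x, x \in s -> E x) ->
  \sum_(x <- s) u x <= K.

Lemma esum_sums_le E u K :
  ((\esum_(x in E) (u x)%:E <= K%:E)%E <-> sums_le E u K).
Proof.
split=> [h s us sE|h].
  rewrite -lee_fin; apply: le_trans h; apply: esum_ge.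
  exists [set` s]; first by split=> //; exact: finite_seq.
  by rewrite -fsbig_seq// sumEFin.
apply: ge_ereal_sup => _ [X [finX XE] <-].
rewrite fsbig_finite//= sumEFin lee_fin; apply: h; first exact: finmap.fset_uniq.
by move=> x; rewrite in_fset_set// => /set_mem/XE.
Qed.

Lemma esum_lty_sums_le E u : (forall x, E x -> 0 <= u x) ->
  ((\esum_(x in E) (u x)%:E < +oo)%E <-> exists K, sums_le E u K).
Proof.
move=> u0; split=> [h|[K h]]; last first.
  by apply: (le_lt_trans (_ : _ <= K%:E)%E); [apply/esum_sums_le | rewrite ltry].
have f : (\esum_(x in E) (u x)%:E)%E \is a fin_num.
  by rewrite ge0_fin_numE//; apply: esum_ge0 => x /u0; rewrite lee_fin.
by exists (fine (\esum_(x in E) (u x)%:E)%E); apply/esum_sums_le; rewrite fineK.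
Qed.

Lemma sums_le_mono E u v K : (forall x, E x -> u x <= v x) ->
  sums_le E v K -> sums_le E u K.
Proof.
move=> uv h s us sE; apply: le_trans (h s us sE).
by rewrite !big_seq; apply: ler_sum => x /sE /uv.
Qed.

End FiniteSums.

Section Orthonormal.
Variables (R : realType) (H : completeNormedModType R[i]).
Variable ip : {dot H for Num.conj}.
Context {ipH : hilbert ip}.
Local Notation bop := (bop H).
Implicit Types (x y : H) (s t : seq H).

Lemma ip_suml (J : Type) (r : seq J) (F : J -> H) y :
  ip (\sum_(j <- r) F j) y = \sum_(j <- r) ip (F j) y.
Proof.
by elim: r => [|j r IH]; rewrite ?big_nil ?ip0l// !big_cons ipDl IH.
Qed.

Variable E : set H.
Hypothesis bE : orthonormal_basis ip E.

Definition in_basis s := uniq s /\ forall x, x \in s -> E x.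

Definition fourier_sum s x := \sum_(f <- s) ip x f *: f.

Lemma fourier_ortho s x f : in_basis s -> f \in s -> ip (x - fourier_sum s x) f = 0.
Proof.
move=> [us sE] fs; have [b1 b0 _] := bE.
rewrite ipBl ip_suml (bigD1_seq f)//= ipZl b1 ?mulr1; last exact: sE.
rewrite big_seq_cond big1 ?addr0 ?subrr// => g /andP[gs gf].
by rewrite ipZl (b0 _ _ (sE _ gs) (sE _ fs) (elimN eqP gf)) mulr0.
Qed.

Lemma fourier_norm s x : in_basis s ->
  hN (x - fourier_sum s x) ^+ 2 = hN x ^+ 2 - \sum_(f <- s) normc (ip x f) ^+ 2.
Proof.
move=> bs; apply: complexI; rewrite -ip_hN rmorphB/= rmorph_sum/= -ip_hN.
rewrite [LHS]ipBr.
have -> : ip (x - fourier_sum s x) (fourier_sum s x) = 0.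
  apply: ip_conj0; rewrite {1}/fourier_sum ip_suml big_seq big1// => f fs.
  by rewrite ipZl (ip_conj0 (fourier_ortho x bs fs)) mulr0.
rewrite subr0 ipBl ip_suml; congr (_ - _); apply: eq_bigr => f _.
by rewrite normc_sqr ipZl -ipC.
Qed.

Lemma bessel s x : in_basis s -> \sum_(f <- s) normc (ip x f) ^+ 2 <= hN x ^+ 2.
Proof. by move=> /(fourier_norm x) E'; rewrite -subr_ge0 -E' sqr_ge0. Qed.

(** The finite linear combinations of the basis are dense, and the Fourier sum is
    the best approximation with given basis vectors. *)
Lemma parseval_approx x (e : R) : 0 < e -> exists2 s, in_basis s &
  forall t, in_basis t -> {subset s <= t} ->
    hN x ^+ 2 <= \sum_(f <- t) normc (ip x f) ^+ 2 + e.
Proof.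
move=> e0; have [b1 b0 bm] := bE.
pose W := [set y | exists2 l : seq (R[i] * H), (forall p, p \in l -> E p.2) &
  y = \sum_(p <- l) p.1 *: p.2].
have sW : subspace W.
  split; first by exists [::]; rewrite ?big_nil.
  move=> c y y' [l lE ->] [l' lE' ->].
  exists ([seq (c * p.1, p.2) | p <- l] ++ l').
    by move=> p; rewrite mem_cat => /orP[/mapP[q /lE ? ->]|/lE'].
  rewrite big_cat big_map scaler_sumr; congr (_ + _).
  by apply: eq_bigr => p _; rewrite scalerA.
have tW : total ip W.
  move=> h hW; apply: bm => f Ef; apply: ip_conj0; apply: hW.
  exists [:: (1, f)]; first by move=> p; rewrite inE => /eqP ->.
  by rewrite big_seq1 scale1r.
have se0 : 0 < Num.sqrt e by rewrite sqrtr_gt0.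
have [y [l lE yE] xy] := total_adherent sW tW x se0.
exists (undup (map snd l)).
  by split; [exact: undup_uniq | move=> f; rewrite mem_undup => /mapP[p /lE ? ->]].
move=> t bt st; rewrite -lerBlDl -fourier_norm//.
set z := x - _.
have zy : ip z y = 0.
  apply: ip_conj0; rewrite yE ip_suml big_seq big1// => p pl.
  rewrite ipZl (ip_conj0 (fourier_ortho x bt _)) ?mulr0//.
  by apply: st; rewrite mem_undup; apply/mapP; exists p.
have zz : ip z z = ip z (x - y).
  rewrite ipBr zy subr0 [LHS]ipBr.
  have -> : ip z (fourier_sum t x) = 0.
    apply: ip_conj0; rewrite {1}/fourier_sum ip_suml big_seq big1// => f fs.
    by rewrite ipZl (ip_conj0 (fourier_ortho x bt fs)) mulr0.
  by rewrite subr0.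
have [z0|z0] := eqVneq (hN z) 0; first by rewrite z0 expr0n/= ltW.
have zp : 0 < hN z by rewrite lt_def z0 hN_ge0.
have : hN z <= Num.sqrt e.
  apply: le_trans xy; rewrite -(ler_pM2l zp) -expr2; apply: le_trans (ip_CS _ _).
  by rewrite -zz ip_hN normcr ler_norm.
by move=> h; rewrite -[leRHS](sqr_sqrtr (ltW e0)) sq_le ?hN_ge0 ?sqrtr_ge0.
Qed.

Lemma in_basis_union s t : in_basis s -> in_basis t -> in_basis (undup (s ++ t)).
Proof.
move=> [us sE] [ut tE]; split; first exact: undup_uniq.
by move=> x; rewrite mem_undup mem_cat => /orP[/sE|/tE].
Qed.

Lemma parseval_sum s (F : H -> H) (e : R) : 0 < e -> exists2 t, in_basis t &
  \sum_(x <- s) hN (F x) ^+ 2 <=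
  \sum_(x <- s) \sum_(f <- t) normc (ip (F x) f) ^+ 2 + e.
Proof.
move=> e0.
suff [t bt h] : exists2 t, in_basis t & forall t', in_basis t' -> {subset t <= t'} ->
    \sum_(x <- s) hN (F x) ^+ 2 <=
    \sum_(x <- s) \sum_(f <- t') normc (ip (F x) f) ^+ 2 + e.
  by exists t => //; exact: h.
elim: s e e0 => [|x s IH] e e0.
  by exists [::] => // t _ _; rewrite !big_nil add0r ltW.
have e2 : 0 < e / 2 by rewrite divr_gt0.
have [t bt ht] := IH _ e2; have [t1 bt1 ht1] := parseval_approx (F x) e2.
exists (undup (t ++ t1)); first exact: in_basis_union.
move=> t' bt' st; rewrite !big_cons.
have h1 := ht1 _ bt' _; have h2 := ht _ bt' _.
rewrite [e]splitr addrACA lerD ?h1 ?h2// => f ft;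
  by apply: st; rewrite mem_undup mem_cat ft ?orbT.
Qed.

(** By Parseval the sum of [|q W e|^2] is a double sum of [|<W^* q f, e>|^2],
    and Bessel's inequality in [e] bounds it by the sum of [|W^* q f|^2]. *)
Lemma hilbert_schmidt_bound (q W : bop) (K b : R) : badj ip q = q -> 0 <= b ->
  bnd W b -> sums_le E (fun e => hN (q e) ^+ 2) K ->
  sums_le E (fun e => hN (q (W e)) ^+ 2) (b ^+ 2 * K).
Proof.
move=> qs b0 Wb qK s us sE.
rewrite -subr_le0; apply: real_eps0 => e e0; rewrite lerBlDl.
have [t bt h] := parseval_sum s (fun e => q (W e)) e0.
apply: le_trans h _; rewrite lerD2r exchange_big/=.
apply: (@le_trans _ _ (\sum_(f <- t) (b * hN (q f)) ^+ 2)).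
  apply: ler_sum => f _.
  apply: (@le_trans _ _ (\sum_(x <- s) normc (ip (badj ip W (q f)) x) ^+ 2)).
    apply: ler_sum => x _; rewrite badjPr -{1}qs badjPr.
    by rewrite (ipC ip (W x)) normc_conj.
  rewrite (le_trans (bessel _ _))// sq_le ?hN_ge0 ?mulr_ge0 ?hN_ge0//.
  exact: badj_bnd.
have [ut tE] := bt.
under eq_bigr do rewrite exprMn.
by rewrite -mulr_sumr ler_wpM2l ?exprn_ge0//; exact: qK.
Qed.

End Orthonormal.

Section Summable.
Variables (R : realType) (H : completeNormedModType R[i]).
Variable ip : {dot H for Num.conj}.
Context {ipH : hilbert ip}.
Local Notation bop := (bop H).
Implicit Types (f g V W X Y : bop) (E : set H).

(** A form of the trace class condition which is visibly stable under sums and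
    under products with bounded operators, and which bounds the trace of such a
    product; absolute values of operators have neither property. *)
Definition summing_bound f E (C : R) := forall V W (a b : R), 0 < a -> 0 < b ->
  bnd V a -> bnd W b -> sums_le E (fun e => normc (ip (V (f (W e))) e)) (C * a * b).

Definition summing f := forall E, orthonormal_basis ip E ->
  exists2 C : R, 0 <= C & summing_bound f E C.

(** Write [f = V0 s] with [s = |f|] and [s = q^2]. Then [<V f W e, e>] is
    [<q W e, q (V V0)^* e>], a product of two Hilbert-Schmidt terms. *)
Lemma trace_class_summing f : trace_class ip (gr f) -> summing f.
Proof.
move=> [_ tf] E bE; have [s [sE sf ss s0]] := absolute_value (ip := ip) f.
have [q [_ qs qa _]] := bounded_opsqrt ss s0.
have qe e : complex.Re (ip (s e) e) = hN (q e) ^+ 2.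
  by rewrite -qs bopME -{1}qa badjPr ip_hN.
have [K qK] : exists K, sums_le E (fun e => hN (q e) ^+ 2) K.
  apply/esum_lty_sums_le; first by move=> e _; exact: sqr_ge0.
  have := tf E bE; rewrite sE.
  by apply: le_lt_trans; apply: le_esum => e _; rewrite app_gr qe.
have K0 : 0 <= K by have := qK [::] isT; rewrite big_nil; apply.
have [V0 fV0 V01] : exists2 Z : bop, f = Z * s & bnd Z 1.
  by apply: (douglas (ip := ip)) => x; rewrite (hN_sqrt x sf ss).
exists K => // V W a b a0 b0 Va Wb t ut tE.
have /(_ ipH) h1 := hilbert_schmidt_bound bE qa (ltW b0) Wb qK ut tE.
have Vb : bnd (badj ip (V * V0)) a.
  apply: badj_bnd; first exact: ltW.
  by rewrite -[a]mulr1; apply: bbndM => //; exact: ltW.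
have /(_ ipH) h2 := hilbert_schmidt_bound bE qa (ltW a0) Vb qK ut tE.
(* The weights balance the two sums, which are at most [b^2 K] and [a^2 K]. *)
apply: (@le_trans _ _ (a / (2 * b) * (\sum_(x <- t) hN (q (W x)) ^+ 2) +
   b / (2 * a) * (\sum_(x <- t) hN (q (badj ip (V * V0) x)) ^+ 2))).
  rewrite !mulr_sumr -big_split; apply: ler_sum => e _ /=.
  have -> : ip (V (f (W e))) e = ip (q (W e)) (q (badj ip (V * V0) e)).
    by rewrite fV0 -qs -[LHS]/(ip ((V * V0) (q (q (W e)))) e) badjP badjP qa.
  rewrite (le_trans (ip_CS _ _))//.
  move: (hN (q (W e))) (hN (q (badj ip (V * V0) e))) => u v.
  have -> : u * v = a / (2 * b) * u ^+ 2 + b / (2 * a) * v ^+ 2 -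
     (a * u - b * v) ^+ 2 / (2 * a * b).
    by field; rewrite !gt_eqF.
  by rewrite gerBl divr_ge0 ?sqr_ge0// !mulr_ge0 ?(ltW a0) ?(ltW b0).
have a2 : 0 <= a / (2 * b) by rewrite divr_ge0 ?mulr_ge0 ?(ltW a0) ?(ltW b0).
have b2 : 0 <= b / (2 * a) by rewrite divr_ge0 ?mulr_ge0 ?(ltW a0) ?(ltW b0).
apply: le_trans (lerD (ler_wpM2l a2 h1) (ler_wpM2l b2 h2)) _.
rewrite le_eqVlt; apply/orP; left; apply/eqP; field.
by rewrite !gt_eqF.
Qed.

(** By Douglas' lemma [|f| = V f] with a contraction [V], so that the bound
    applies to [<|f| e, e>] itself. *)
Lemma summing_trace_class f : summing f -> trace_class ip (gr f).
Proof.
move=> sf; split; first exact: gr_bounded.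
move=> E bE; have [s [sE sf2 ss s0]] := absolute_value (ip := ip) f.
have [V sV V1] : exists2 Z : bop, s = Z * f & bnd Z 1.
  by apply: (douglas (ip := ip)) => x; rewrite (hN_sqrt x sf2 ss).
have [C C0 fC] := sf E bE.
rewrite sE; under eq_esum do rewrite app_gr.
apply/esum_lty_sums_le; first by move=> e _; have [] := ge0_real_Re (s0 e).
exists (C * 1 * 1); apply: (sums_le_mono _ (fC V 1 1 1 ltr01 ltr01 V1 (@bbnd1 _ _))).
by move=> e _; rewrite sV; exact: Re_le_normc.
Qed.

Lemma summingD f g : summing f -> summing g -> summing (f + g).
Proof.
move=> sf sg E bE; have [C C0 fC] := sf E bE; have [D D0 gD] := sg E bE.
exists (C + D); first exact: addr_ge0.
move=> V W a b a0 b0 Va Wb t ut tE; rewrite !mulrDl.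
apply: le_trans (lerD (fC V W a b a0 b0 Va Wb t ut tE) (gD V W a b a0 b0 Va Wb t ut tE)).
rewrite -big_split; apply: ler_sum => e _ /=.
by rewrite bopD ipDl le_normcD.
Qed.

Lemma summingM f X Y : summing f -> summing (X * f * Y).
Proof.
move=> sf E bE; have [C C0 fC] := sf E bE.
have [M M0 XM] := bop_bnd_gt0 X; have [N N0 YN] := bop_bnd_gt0 Y.
exists (C * M * N); first by rewrite !mulr_ge0// ltW.
move=> V W a b a0 b0 Va Wb.
have -> : C * M * N * a * b = C * (a * M) * (N * b) by ring.
apply: (fC (V * X) (Y * W)); rewrite ?mulr_gt0//.
  by apply: bbndM => //; exact: ltW.
by apply: bbndM => //; exact: ltW.
Qed.

Lemma summing0 : summing 0.
Proof.
move=> E bE; exists 0 => // V W a b a0 b0 Va Wb t ut tE.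
by rewrite big1 ?mul0r// => e _; rewrite bop0E bop0r ip0l normc0.
Qed.

Lemma summing_sum n (F : nat -> bop) : (forall i, (i < n)%N -> summing (F i)) ->
  summing (\sum_(i < n) F i).
Proof.
elim: n => [|n IH] h; first by rewrite big_ord0; exact: summing0.
rewrite big_ord_recr; apply: summingD; last exact: h.
by apply: IH => i ilt; apply: h; exact: ltnW.
Qed.

End Summable.

(** ** Sums over finite sets and the trace *)

Section NetSum.
Variables (R : realType) (I : choiceType).
Implicit Types (u v : I -> R[i]) (L : R[i]) (w : I -> R).

(** Unconditional summation along finite subsets. *)
Definition net_sum u L := forall e : R, 0 < e -> exists A : {fset I},
  forall B : {fset I}, (A `<=` B)%fset -> normc (\sum_(x <- B) u x - L) <= e.

Lemma net_sumD u v L M : net_sum u L -> net_sum v M ->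
  net_sum (fun x => u x + v x) (L + M).
Proof.
move=> hu hv e e0; have e2 : 0 < e / 2 by rewrite divr_gt0.
have [A hA] := hu _ e2; have [A' hA'] := hv _ e2; exists (A `|` A')%fset => B.
rewrite fsubUset => /andP[AB AB']; rewrite big_split/= opprD addrACA.
by rewrite (le_trans (le_normcD _ _))// [e]splitr lerD ?hA ?hA'.
Qed.

Lemma net_sumZ c u L : net_sum u L -> net_sum (fun x => c * u x) (c * L).
Proof.
move=> hu e e0; have k0 : 0 < normc c + 1 by rewrite ltr_wpDl// normc_ge0.
have [A hA] := hu _ (divr_gt0 e0 k0); exists A => B /hA h.
rewrite -mulr_sumr -mulrBr normcM.
apply: le_trans (ler_wpM2l (normc_ge0 _) h) _.
by rewrite mulrCA ler_piMr ?(ltW e0)// ler_pdivrMr// mul1r lerDl.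
Qed.

Lemma net_sum_le u L (K : R) : net_sum u L ->
  (forall B : {fset I}, \sum_(x <- B) normc (u x) <= K) -> normc L <= K.
Proof.
move=> hu hK; rewrite -subr_le0; apply: real_eps0 => e e0; rewrite lerBlDl.
have [A /(_ A (fsubset_refl _)) hA] := hu _ e0.
have -> : L = (\sum_(x <- A) u x - (\sum_(x <- A) u x - L)) by rewrite opprB subrKC.
rewrite (le_trans (le_normcD _ _))// normcN lerD//.
apply: le_trans (hK A); elim/big_ind2: _ => //; first by rewrite normc0.
by move=> a b c d ab cd; rewrite (le_trans (le_normcD _ _))// lerD.
Qed.

Lemma net_sum_nonneg w (K : R) : (forall x, 0 <= w x) ->
  (forall B : {fset I}, \sum_(x <- B) w x <= K) ->
  exists L : R, net_sum (fun x => (w x)%:C) L%:C.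
Proof.
move=> w0 wK; pose E := [set (\sum_(x <- B) w x) | B in [set: {fset I}]].
have sE : has_sup E.
  by split; [exists (\sum_(x <- fset0) w x); exists fset0 | exists K => _ [B _ <-]].
exists (sup E) => e e0; have [_ [A _ <-] h] := sup_adherent e0 sE.
exists A => B AB.
have -> : \sum_(x <- B) (w x)%:C - (sup E)%:C = (\sum_(x <- B) w x - sup E)%:C.
  by rewrite rmorphB rmorph_sum.
rewrite normcr.
have h1 : (\sum_(x <- B) w x <= sup E) by apply: sup_upper_bound => //; exists B.
rewrite ler0_norm ?subr_le0// opprB lerBlDr -lerBlDl ltW// (lt_le_trans h)//.
rewrite (big_fsetID _ (mem A) B)/= -[leLHS]addr0 lerD//; last exact: sumr_ge0.
have -> : [fset x in B | x \in A]%fset = A; last by [].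
apply/fsetP => x; rewrite !inE andb_idl// => xA; exact: (fsubsetP AB).
Qed.

Lemma net_sum_summable u (K : R) : (forall B : {fset I}, \sum_(x <- B) normc (u x) <= K) ->
  exists L, net_sum u L.
Proof.
move=> uK.
have part (g : R[i] -> R) : (forall c, `|g c| <= normc c) ->
    exists L, net_sum (fun x => (g (u x))%:C) L.
  move=> gc.
  have [|B|L1 h1] := @net_sum_nonneg (fun x => g (u x) + normc (u x)) (K + K).
  - by move=> x; have := gc (u x); rewrite ler_norml => /andP[+ _]; lra.
  - apply: le_trans (lerD (uK B) (uK B)); rewrite -big_split; apply: ler_sum => x _ /=.
    by rewrite lerD2r (le_trans (ler_norm _)).
  have [|B|L2 h2] := @net_sum_nonneg (fun x => normc (u x)) K.
  - by move=> x; exact: normc_ge0.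
  - exact: uK.
  exists (L1%:C + (-1) * L2%:C).
  have := net_sumD h1 (net_sumZ (-1) h2); congr net_sum; apply/funext => x.
  by rewrite rmorphD/= mulN1r addrK.
have [|L1 h1] := part (@complex.Re R).
  by case=> a b /=; rewrite -sqrtr_sqr ler_wsqrtr// lerDl sqr_ge0.
have [|L2 h2] := part (@complex.Im R).
  by case=> a b /=; rewrite -sqrtr_sqr ler_wsqrtr// lerDr sqr_ge0.
exists (L1 + 'i%C * L2).
have := net_sumD h1 (net_sumZ 'i%C h2); congr net_sum; apply/funext => x.
by rewrite -complexE.
Qed.

Lemma net_sum_summability (u : I -> R[i]^o) L : net_sum u L -> summability.sum u = L.
Proof.
move=> hu; have PF := @summability.totally_filter I.
have FF : Filter (@summability.totally I) by exact: filter_filter.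
apply/cvg_lim => //.
apply/cvgrPdist_le => e e0.
have re : 0 < complex.Re e by move: e0; rewrite ltcE => /andP[].
have eE : e = (complex.Re e)%:C by rewrite RRe_real// realE ltW.
have [A hA] := hu _ re; exists A => // B /= AB.
rewrite /summability.partial_sum -(big_seq_fsetE _ B predT u)/= distrC.
by rewrite normC_normc eE lecR; exact: hA.
Qed.

End NetSum.

Section Trace.
Variables (R : realType) (H : completeNormedModType R[i]).
Variable ip : {dot H for Num.conj}.
Context {ipH : hilbert ip}.
Local Notation bop := (bop H).
Implicit Types (f g V W X Y : bop).

Let E0 : set H := xget set0 [set E | orthonormal_basis ip E].

Definition trace_term f (x : H) : R[i] := if x \in E0 then ip (f x) x else 0.

Lemma Tr_sum f : Tr ip (gr f) = summability.sum (trace_term f : H -> R[i]^o).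
Proof.
rewrite /Tr; apply: (f_equal (fun u : H -> R[i]^o => summability.sum u)).
apply/funext => x.
rewrite /trace_term /patch; case: ifPn => // _.
by rewrite app_gr.
Qed.

(** In the absence of an orthonormal basis [E0] is empty and all sums vanish, so
    the existence of a basis is not an issue. *)
Lemma summing_trace_bound f : summing ip f -> exists2 C : R, 0 <= C &
  forall V W (a b : R), 0 < a -> 0 < b -> bnd V a -> bnd W b ->
  forall B : {fset H}, \sum_(x <- B) normc (trace_term (V * f * W) x) <= C * a * b.
Proof.
move=> sf.
suff [C C0 fC] : exists2 C : R, 0 <= C & summing_bound ip f E0 C.
  exists C => // V W a b a0 b0 Va Wb B.
  rewrite (bigID (fun x => x \in E0))/= [X in _ + X]big1 ?addr0; last first.
    by move=> x /negPf xE; rewrite /trace_term xE normc0.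
  rewrite -big_filter big_seq (eq_bigr (fun x => normc (ip (V (f (W x))) x))); last first.
    by move=> x; rewrite mem_filter /trace_term => /andP[-> _].
  rewrite -big_seq; apply: fC => //; first by rewrite filter_uniq// fset_uniq.
  by move=> x; rewrite mem_filter => /andP[/set_mem].
have [[E bE]|nE] := pselect (exists E, orthonormal_basis ip E).
  by apply: sf; apply: (@xgetPex _ set0 [set E | orthonormal_basis ip E]); exists E.
exists 0 => // V W a b a0 b0 Va Wb [|x s] us sE; first by rewrite big_nil !mul0r.
have := sE x (mem_head _ _); rewrite /E0; case: xgetP => // E _ bE _.
by case: nE; exists E.
Qed.

Lemma trace_net_sum f : summing ip f -> net_sum (trace_term f) (Tr ip (gr f)).
Proof.
move=> /summing_trace_bound[C C0 /(_ 1 1 1 1)].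
rewrite mul1r mulr1 => h.
have [L fL] := net_sum_summable (h ltr01 ltr01 (@bbnd1 _ _) (@bbnd1 _ _)).
by rewrite Tr_sum (net_sum_summability fL).
Qed.

Lemma Tr_net f L : net_sum (trace_term f) L -> Tr ip (gr f) = L.
Proof. by move=> h; rewrite Tr_sum; exact: net_sum_summability. Qed.

Lemma TrD f g : summing ip f -> summing ip g ->
  Tr ip (gr (f + g)) = Tr ip (gr f) + Tr ip (gr g).
Proof.
move=> /trace_net_sum hf /trace_net_sum hg; apply: Tr_net.
have := net_sumD hf hg; congr net_sum; apply/funext => x.
by rewrite /trace_term; case: ifP => _; rewrite ?addr0// ipDl.
Qed.

Lemma TrZ c f : summing ip f -> Tr ip (gr (c *: f)) = c * Tr ip (gr f).
Proof.
move=> /trace_net_sum hf; apply: Tr_net.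
have := net_sumZ c hf; congr net_sum; apply/funext => x.
by rewrite /trace_term; case: ifP => _; rewrite ?mulr0// ipZl.
Qed.

Lemma Tr0 : Tr ip (gr 0) = 0.
Proof.
by have := TrZ 0 (@summing0 _ _ ip); rewrite scale0r mul0r.
Qed.

Lemma summingZ c f : summing ip f -> summing ip (c *: f).
Proof.
move=> sf; have := summingM (c *: (1 : bop)) 1 sf.
by rewrite mulr1 -bop_scaleAl mul1r.
Qed.

Lemma Tr_sum_ord n (F : nat -> bop) : (forall i, (i < n)%N -> summing ip (F i)) ->
  Tr ip (gr (\sum_(i < n) F i)) = \sum_(i < n) Tr ip (gr (F i)).
Proof.
elim: n => [|n IH] h; first by rewrite !big_ord0 Tr0.
rewrite !big_ord_recr/= TrD ?IH//.
- by move=> i ilt; apply: h; exact: ltnW.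
- by apply: summing_sum => i ilt; apply: h; exact: ltnW.
- exact: h.
Qed.

(** The trace is continuous in the bounded factors; this is how operator norm
    estimates pass to traces of holomorphic families. *)
Lemma Tr_bound f : summing ip f -> exists2 C : R, 0 <= C &
  forall V W (a b : R), 0 < a -> 0 < b -> bnd V a -> bnd W b ->
  normc (Tr ip (gr (V * f * W))) <= C * a * b.
Proof.
move=> sf; have [C C0 h] := summing_trace_bound sf; exists C => // V W a b a0 b0 Va Wb.
apply: (net_sum_le (trace_net_sum (summingM V W sf))).
exact: h.
Qed.

End Trace.

(** * The operators [T_lam] *)

Section Tlambda.
Variables (R : realType) (H : completeNormedModType R[i]).
Variable ip : {dot H for Num.conj}.
Context {ipH : hilbert ip}.
Local Notation bop := (bop H).
Local Notation adj := (adj ip).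
Variables (D : set (H * H)) (lam : R).
Hypotheses (cD : closed_dense ip D) (lam0 : 0 < lam).

Local Notation G2 := (opmul (adj D) D).
Local Notation G1 := (opmul D (adj D)).
Local Notation l := (lam%:C).

Let oD : is_operator D. Proof. by have [] := cD. Qed.
Let oA : is_operator (adj D). Proof. by have [] := closed_dense_adj cD. Qed.
Let pG2 : nonneg_sa ip G2. Proof. exact: square_nonneg_sa. Qed.
Let pG1 : nonneg_sa ip G1.
Proof. by have := square_nonneg_sa (closed_dense_adj cD); rewrite (closed_dense_adjK cD); apply. Qed.
Let sl : @slit_plane R l. Proof. exact: slit_real. Qed.
Let lne : l != 0. Proof. by rewrite gt_eqF// ltcR. Qed.

Let rho : bop := l *: res G2 l.
Let rho' : bop := l *: res G1 l.

Let rhoD u : exists w, [/\ D (rho u, w) & adj D (w, l *: (u - rho u))].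
Proof.
have [w Dw Aw] := res_in pG2 u sl; exists (l *: w); split.
  exact: op_scale oD Dw.
exact: op_scale oA Aw.
Qed.

Lemma opinv_rho :
  opinv (opadd (opcst 1) (opscale lam^-1%:C G2)) = gr rho.
Proof.
have E : lam^-1%:C = l^-1 by rewrite fmorphV.
have oG : is_operator G2 by have [] := pG2.
apply/seteqP; split=> [[y x]|[y x]]; rewrite /gr /opinv /=.
  move=> [a [b []]]; rewrite /opcst /opscale/= scale1r => -> [v Gv ->] ->; rewrite E -bopZ.
  rewrite scalerDr scalerA mulfV// scale1r.
  by rewrite (resK pG2 sl Gv).
move=> ->; exists (rho y), (y - rho y); split=> /=.
- by rewrite /opcst/= scale1r.
- exists (l *: (y - rho y)); last by rewrite E scalerA mulVf// scale1r.
  exact: op_scale oG (res_in pG2 y sl).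
- by rewrite subrKC.
Qed.

Let rho_sa : badj ip rho = rho.
Proof. by rewrite /rho badjZ conjC_realC (res_adj pG2 lam0). Qed.

Let rho_pos x : 0 <= ip (rho x) x.
Proof. by rewrite bopZE ipZl mulr_ge0 ?ler0c ?(ltW lam0)// (res_pos pG2). Qed.

Let rho_inj : injective rho.
Proof.
move=> x y; rewrite !bopZE => /(scalerI lne); exact: (res_inj pG2 sl).
Qed.

(** With [rho = lam (lam + D^* D)^-1] and [q] its square root, [T_lam] is
    [lam^(-1/2) D q]. On the range of [q] one has
    [|D rho u|^2 = lam <u - rho u, rho u> <= lam |q u|^2], so by closedness [D q]
    is everywhere defined and bounded. The two identities are then verified on
    the dense subspaces [ran q] and [Dom D^*]. *)
Lemma Tlam_bop : exists T : bop, [/\ Tlam ip D lam = gr T,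
  1 - badj ip T * T = l *: res G2 l & 1 - T * badj ip T = l *: res G1 l].
Proof.
have [q [qE qq qs _]] := bounded_opsqrt rho_sa rho_pos.
have qi : injective q by move=> x y E; apply: rho_inj; rewrite -qq !bE E.
have qqE x : q (q x) = rho x by rewrite -qq.
have tq : total ip (range q) by exact: sa_inj_total.
pose t : R := Num.sqrt lam.
have t0 : 0 < t by rewrite sqrtr_gt0.
have tt : t ^+ 2 = lam by rewrite sqr_sqrtr// ltW.
have Dq_bound u w : D (rho u, w) -> hN w <= t * hN (q u).
  move=> Dw; have [w' [Dw' Aw']] := rhoD u.
  rewrite -(op_fun oD Dw Dw') in Aw'.
  rewrite -sq_le ?hN_ge0 ?mulr_ge0 ?hN_ge0 ?(ltW t0)// exprMn tt -lecR -ip_hN.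
  rewrite (adjE Aw' Dw) ipZr conjC_realC ipBr.
  have -> : ip (rho u) u = ip (q u) (q u) by rewrite -qqE badjP qs.
  rewrite rmorphM/= -ip_hN ler_wpM2l ?ler0c ?(ltW lam0)//.
  by rewrite gerBl dnorm_ge0.
have Dq x : exists2 y, D (q x, y) & hN y <= t * hN x.
  have [u [uq ux]] := adherent_seq (total_adherent (range_subspace q) tq x).
  have /choice[v vP] : forall n, exists v, q v = u n.
    by move=> n; have [v _ vE] := uq n; exists v.
  have /choice[w wP] : forall n, exists w, D (rho (v n), w).
    by move=> n; have [w [Dw _]] := rhoD (v n); exists w.
  have [|y yP] := @hN_cauchy _ _ w.
    move=> e e0; have [n0 h0] := qf_archi (divr_gt0 e0 (mulr_gt0 (ltr0Sn R 1) t0)).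
    exists n0 => m n /h0 mn /h0 nn.
    have := Dq_bound (v m - v n) (w m - w n); rewrite bopB => h.
    rewrite (le_trans (h (op_sub oD (wP m) (wP n))))// bopB !vP.
    have -> : u m - u n = (x - u n) - (x - u m) by rewrite opprB [RHS]addrC subrKA.
    rewrite -ler_pdivlMl// (le_trans (hND _ _))// hNN.
    apply: le_trans (lerD (le_trans (ux n) nn) (le_trans (ux m) mn)) _.
    rewrite le_eqVlt; apply/orP; left; apply/eqP; field.
    by rewrite gt_eqF.
  have near (e : R) : 0 < e -> exists n, hN (x - u n) <= e /\ hN (w n - y) <= e.
    move=> e0; have [n0 h0] := qf_archi e0; have [n1 h1] := yP _ e0.
    exists (maxn n0 n1); split; last by rewrite h1// leq_maxr.
    by rewrite (le_trans (ux _))// h0// leq_maxl.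
  exists y.
    have [_ clD _] := cD; apply: clD => e e0.
    have [M M0 qM] := bop_bnd_gt0 q.
    have [n [h1 h2]] := near (Num.min e (e / M)) ltac:(by rewrite lt_min e0 divr_gt0).
    exists (rho (v n)), (w n); split; first exact: wP.
      rewrite -qqE -bopB (le_trans (qM _))// -ler_pdivlMl// mulrC vP.
      by rewrite (le_trans h1)// ge_min lexx orbT.
    by rewrite hNB (le_trans h2)// ge_min lexx.
  rewrite -subr_le0; apply: real_eps0 => e e0; rewrite lerBlDl.
  have k0 : 0 < 1 + t by rewrite addr_gt0.
  have [n [h1 h2]] := near _ (divr_gt0 e0 k0).
  have h3 := Dq_bound _ _ (wP n); rewrite vP in h3.
  have h4 := hND (y - w n) (w n); rewrite subrK hNB in h4.
  have h5 := hND (u n - x) x; rewrite subrK hNB in h5.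
  have h6 : e / (1 + t) * (1 + t) = e by rewrite divfK// gt_eqF.
  have h7 : t * hN (u n) <= t * (hN (x - u n) + hN x) by rewrite ler_wpM2l// ltW.
  have h8 : t * hN (x - u n) <= t * (e / (1 + t)) by rewrite ler_wpM2l// ltW.
  by move: h6; rewrite mulrDr mulr1 (mulrC _ t); lra.
have tC : (t^-1)%:C * (t^-1)%:C * l = 1.
  by rewrite -tt -!rmorphM/= expr2 mulrACA mulVf ?gt_eqF// mulr1.
have TP x y : Tlam ip D lam (x, y) <-> exists2 w, D (q x, w) & y = (t^-1)%:C *: w.
  rewrite /Tlam opinv_rho qE /opscale/=; split.
    by move=> [w [a]]; rewrite /gr/= => -> Dw ->; exists w.
  by move=> [w Dw ->]; exists w => //; exists (q x).
have [|T TE] := @bounded_opP _ _ (Tlam ip D lam).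
  split.
  - split.
    + by apply/TP; exists 0; rewrite ?bop0r ?scaler0//; case: oD.
    + move=> c x y x' y' /TP[w h1 ->] /TP[w' h1' ->]; apply/TP.
      exists (c *: w + w'); first by rewrite bop_lin; exact: op_lin.
      by rewrite scalerDr !scalerA mulrC.
    + by move=> x y y' /TP[w h1 ->] /TP[w' h1' ->]; rewrite (op_fun oD h1 h1').
  - apply/seteqP; split=> // x _; have [w Dw _] := Dq x.
    by exists ((t^-1)%:C *: w); apply/TP; exists w.
  - exists 1 => x y /TP[w Dw ->]; rewrite mul1r !normr_hN lecR hNZ normcr.
    have [w' Dw' le] := Dq x; rewrite (op_fun oD Dw Dw').
    by rewrite ger0_norm ?invr_ge0 ?(ltW t0)// ler_pdivrMl.
have Tx x w : D (q x, w) -> T x = (t^-1)%:C *: w.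
  by move=> Dw; have : Tlam ip D lam (x, (t^-1)%:C *: w) by [apply/TP; exists w]; rewrite TE.
exists T; split=> //.
  suff -> : badj ip T * T = 1 - rho by rewrite opprB subrKC.
  apply: bopP => x; apply/eqP; rewrite -subr_eq0; apply/eqP.
  apply: tq => _ [u _ <-]; apply: ip_conj0; rewrite ipBl bopME badjPr.
  have [w [Dw Aw]] := rhoD u; have [y Dy _] := Dq x.
  rewrite -qqE in Dw.
  have swap u' v : ip u' (q v) = ip (q u') v by rewrite badjP qs.
  have -> : ip (T x) (T (q u)) = ip (q x) (u - rho u).
    have -> : ip (T x) (T (q u)) = (t^-1)%:C * (t^-1)%:C * ip y w.
      by rewrite (Tx _ _ Dw) (Tx _ _ Dy) ipZl ipZr conjC_realC mulrA.
    by rewrite (adjE Aw Dy) ipZr conjC_realC mulrA tC mul1r.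
  by rewrite bopBE bop1E ipBl ipBr -!qqE !swap; ring.
suff -> : T * badj ip T = 1 - rho' by rewrite opprB subrKC.
apply/eqP; rewrite -subr_eq0; apply/eqP; apply: bopP => v; rewrite bop0E.
have [_ _ tA] := closed_dense_adj cD.
apply: (bnd_adherent (total_adherent (dom_subspace oA) tA v)) => {}v [s As].
have Tv : badj ip T v = (t^-1)%:C *: q s.
  apply: (ip_inj ip) => x; rewrite -badjP; have [y Dy _] := Dq x.
  by rewrite (Tx _ _ Dy) ipZl ipZr conjC_realC (adjE As Dy) badjP qs.
have [a Aa Da] := res_in pG1 v sl; rewrite /= in Aa Da.
have aE : a = res G2 l s.
  have Ga : G2 (a, s - l *: a).
    by exists (v - l *: res G1 l v) => //; exact: op_sub oA As (op_scale _ oA Aa).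
  by have <- := resK pG2 sl Ga; rewrite subrKC.
have Dqq : D (q (q s), l *: (v - l *: res G1 l v)).
  by rewrite qqE /rho bopZE -aE; exact: op_scale oD Da.
rewrite bopBE bopME Tv bopZ (Tx _ _ Dqq) !scalerA ?mulrA tC scale1r.
by rewrite bopBE bop1E /rho' bopZE subrr.
Qed.

End Tlambda.

(** * Holomorphic families of operators *)

Section Holomorphy.
Variables (R : realType) (H : completeNormedModType R[i]).
Variable ip : {dot H for Num.conj}.
Context {ipH : hilbert ip}.
Local Notation bop := (bop H).
Implicit Types (P Q : R[i] -> bop) (z h : R[i]) (g : R[i] -> R[i]).

(** Complex differentiability with a quadratic remainder: it is stable under
    products without a separate continuity argument, and bounds of operators
    turn it into the same condition for traces. *)
Definition opdiff P z := exists P1 : bop, exists M : R, exists2 d : R, 0 < d /\ 0 < M &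
  forall h, normc h < d -> bnd (P (z + h) - P z - h *: P1) (M * normc h ^+ 2).

Definition quad_diff g z := exists g1 : R[i], exists M : R, exists2 d : R, 0 < d /\ 0 < M &
  forall h, h != 0 -> normc h < d -> normc (g (z + h) - g z - h * g1) <= M * normc h ^+ 2.

Lemma opdiff_cst (f : bop) z : opdiff (fun _ => f) z.
Proof.
exists 0, 1, 1 => // h _ x; rewrite subrr sub0r scaler0 bopNE bop0E hNN hN0.
by rewrite mulr_ge0 ?hN_ge0// mul1r sqr_ge0.
Qed.

Lemma opdiff_loc P z : opdiff P z ->
  exists P1 : bop, exists M : R, exists2 d : R, [/\ 0 < d, d <= 1 & 0 < M] &
  [/\ bnd (P z) M, bnd P1 M & forall h, normc h < d ->
     bnd (P (z + h) - P z - h *: P1) (M * normc h ^+ 2) /\ bnd (P (z + h)) (3 * M)].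
Proof.
move=> [P1 [M [d [d0 M0] h1]]]; exists P1.
have [p p0 pP] := bop_bnd_gt0 (P z); have [p1 p10 pP1] := bop_bnd_gt0 P1.
pose N := M + p + p1; exists N.
have [MN pN p1N] : [/\ M <= N, p <= N & p1 <= N] by rewrite /N; split; lra.
exists (Num.min d 1); first by split; rewrite ?lt_min ?d0 ?ge_min ?lexx ?orbT// /N; lra.
split; [exact: bnd_le pN pP | exact: bnd_le p1N pP1 |].
move=> h; rewrite lt_min => /andP[/h1 hd k1]; have k0 := normc_ge0 h.
have kk : normc h ^+ 2 <= 1 by rewrite exprn_ile1// ltW.
split; first by apply: bnd_le hd; rewrite ler_wpM2r// sqr_ge0.
have -> : P (z + h) = (P (z + h) - P z - h *: P1) + (P z + h *: P1).
  by rewrite [P z + _]addrC addrA !subrK.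
apply: (bnd_le _ (bbndD hd (bbndD pP (bbndZ h pP1)))).
have : M * normc h ^+ 2 <= M by rewrite ler_piMr// ltW.
have : normc h * p1 <= p1 by rewrite ler_piMl ?ltW.
lra.
Qed.

Lemma opdiffM P Q z : opdiff P z -> opdiff Q z -> opdiff (fun w => P w * Q w) z.
Proof.
move=> /opdiff_loc[P1 [M [d [d0 d1 M0] [PM P1M hP]]]].
move=> /opdiff_loc[Q1 [N [d' [d0' d1' N0] [QN Q1N hQ]]]].
exists (P1 * Q z + P z * Q1), (M * N + M * (3 * N) + (M + M) * N).
exists (Num.min d d'); first by rewrite lt_min d0 d0' !addr_gt0 ?mulr_gt0 ?addr_gt0.
move=> h; rewrite lt_min => /andP[hd hd']; have k0 := normc_ge0 h.
have k1 : normc h <= 1 by rewrite ltW// (lt_le_trans hd).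
have [a1 _] := hP _ hd; have [b1 b2] := hQ _ hd'.
have -> : P (z + h) * Q (z + h) - P z * Q z - h *: (P1 * Q z + P z * Q1) =
  (h ^+ 2 *: (P1 * Q1) + (P (z + h) - P z - h *: P1) * Q (z + h)) +
  (P z + h *: P1) * (Q (z + h) - Q z - h *: Q1).
  apply: bopP => x; apply: (ip_inj ip) => y.
  by rewrite !bE !bopD !bopN !bopZ !ipE; ring.
have k2 : 0 <= normc h ^+ 2 by exact: sqr_ge0.
have kM : normc h * M <= M by rewrite ler_piMl ?(ltW M0).
apply: (bnd_le _ (bbndD (bbndD (bbndZ _ (bbndM (ltW M0) P1M Q1N))
   (bbndM _ a1 b2)) (bbndM _ (bbndD PM (bbndZ h P1M)) b1))).
- rewrite !mulrDl; apply: lerD; first apply: lerD.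
  + by rewrite expr2 normcM -expr2 mulrC.
  + by rewrite mulrAC.
  + rewrite -!mulrDl -mulrA; apply: ler_wpM2r; last by rewrite lerD2l.
    by rewrite mulr_ge0// ltW.
- by rewrite mulr_ge0// ltW.
- by rewrite addr_ge0 ?mulr_ge0 ?(ltW M0).
Qed.

Lemma opdiffX P z n : opdiff P z -> opdiff (fun w => P w ^+ n) z.
Proof.
move=> hP; elim: n => [|n IH]; first exact: opdiff_cst.
have -> : (fun w => P w ^+ n.+1) = (fun w => P w * P w ^+ n).
  by apply/funext => w; rewrite exprS.
exact: opdiffM.
Qed.

Section ResolventFamily.
Variable G : set (H * H).
Hypothesis pG : nonneg_sa ip G.

(** The resolvent identity, used twice, gives the derivative [- (z + G)^-2] and
    an explicit remainder; used once, it bounds the nearby resolvents. *)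
Lemma opdiff_res z : @slit_plane R z -> opdiff (res G) z.
Proof.
move=> sz; have [d d0 sd] := slit_open sz; set r := res G z.
have [M M0 rM] := bop_bnd_gt0 r.
exists (- (r * r)), (2 * M * (M * M)), (Num.min d (2 * M)^-1).
  by rewrite lt_min d0 invr_gt0 !mulr_gt0.
move=> h; rewrite lt_min => /andP[hd hM]; have sh := sd _ hd.
set r' := res G (z + h).
have E : r' - r = - h *: (r' * r).
  by rewrite (res_identity pG sh sz); congr (_ *: _); rewrite opprD addrA subrr sub0r.
have hM2 : normc h * M <= 2^-1.
  by rewrite ltW// -ltr_pdivlMr// -invfM.
have r'M : bnd r' (2 * M).
  move=> y; have /(congr1 (fun f : bop => f y)) := E; rewrite bopBE bopZE bopME.
  have -> : r' (r y) = r (r' y) by apply: bop_commE; exact: res_comm.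
  move=> /eqP; rewrite subr_eq => /eqP e1.
  have := hND ((- h) *: r (r' y)) (r y); rewrite -e1 hNZ normcN.
  have := rM y; have := rM (r' y) => h1 h2.
  have h3 : normc h * hN (r (r' y)) <= 2^-1 * hN (r' y).
    apply: (@le_trans _ _ (normc h * (M * hN (r' y)))).
      by rewrite ler_wpM2l ?normc_ge0.
    by rewrite mulrA ler_wpM2r ?hN_ge0.
  by move: h1 h2 h3 (hN_ge0 (r' y)); lra.
have -> : r' - r - h *: - (r * r) = h ^+ 2 *: (r' * (r * r)).
  have E2 : r' * r - r * r = - h *: (r' * r * r) by rewrite -mulrBl E -bop_scaleAl.
  rewrite E scalerN opprK scaleNr addrC -scalerBr -[r * r - _]opprB E2.
  by rewrite scaleNr opprK scalerA mulrA expr2.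
have M2 : 0 <= 2 * M by rewrite mulr_ge0// ltW.
apply: (bnd_le _ (bbndZ _ (bbndM M2 r'M (bbndM (ltW M0) rM rM)))).
by rewrite expr2 normcM -expr2 mulrC.
Qed.

(** The bounded operator [(1 + G) (z + G)^-1], which converts a resolvent at [1]
    into one at [z]. *)
Definition res_shift z : bop := 1 + (1 - z) *: res G z.

Lemma res_shiftE z : @slit_plane R z -> res G z = res_shift z * res G 1.
Proof.
move=> sz; rewrite /res_shift mulrDl mul1r -bop_scaleAl.
by rewrite -(res_identity pG sz (@slit1 R)) subrKC.
Qed.

Lemma res_shift_comm z : @slit_plane R z -> GRing.comm (res G 1) (res_shift z).
Proof.
move=> sz; apply: commrD; first exact: commr1.
rewrite /GRing.comm -bop_scaleAr -bop_scaleAl; congr (_ *: _).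
exact: res_comm pG _ _ (@slit1 R) sz.
Qed.

Lemma opdiff_shift z : @slit_plane R z -> opdiff res_shift z.
Proof.
move=> /opdiff_res /opdiff_loc[P1 [M [d [d0 d1 M0] [PM P1M hP]]]].
exists ((1 - z) *: P1 - res G z), (M + (normc (1 - z) + 1) * M), d.
  by rewrite d0 !addr_gt0 ?mulr_gt0// ltr_wpDl ?normc_ge0.
move=> h hd; have [a1 _] := hP _ hd.
have -> : res_shift (z + h) - res_shift z - h *: ((1 - z) *: P1 - res G z) =
    - (h ^+ 2 *: P1) + (1 - z - h) *: (res G (z + h) - res G z - h *: P1).
  apply: bopP => x; apply: (ip_inj ip) => y.
  by rewrite /res_shift !bE !ipE !rmorphB/= ?rmorphD/= ?rmorphM/= ?rmorph1; ring.
apply: (bnd_le _ (bbndD (bbndN (bbndZ _ P1M)) (bbndZ _ a1))).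
have k2 : 0 <= normc h ^+ 2 by exact: sqr_ge0.
rewrite mulrDl; apply: lerD; first by rewrite expr2 normcM -expr2 mulrC.
rewrite -mulrA; apply: ler_wpM2r; first by rewrite mulr_ge0// ltW.
by rewrite (le_trans (le_normcD _ _))// normcN lerD2l ltW// (lt_le_trans hd).
Qed.

End ResolventFamily.

(** The expansions of [P] and [Q] at [z] are multiplied out inside the trace;
    what remains is bounded by [Tr_bound]. *)
Lemma quad_diff_Tr P Q (f : bop) z : summing ip f -> opdiff P z -> opdiff Q z ->
  quad_diff (fun w => Tr ip (gr (P w * f * Q w))) z.
Proof.
move=> sf; have [C C0 fC] := Tr_bound sf.
move=> /opdiff_loc[P1 [M [d [d0 d1 M0] [PM P1M hP]]]].
move=> /opdiff_loc[Q1 [N [d' [d0' d1' N0] [QN Q1N hQ]]]].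
have sM := fun X Y : bop => summingM X Y sf.
exists (Tr ip (gr (P1 * f * Q z)) + Tr ip (gr (P z * f * Q1))).
exists ((C + 1) * (M * N + M * (3 * N) + (M + M) * N)).
exists (Num.min d d').
  rewrite lt_min d0 d0' mulr_gt0//; first by rewrite ltr_wpDl.
  by rewrite !addr_gt0 ?mulr_gt0 ?addr_gt0.
move=> h h0; rewrite lt_min => /andP[hd hd']; have k0 := normc_ge0 h.
have k1 : normc h <= 1 by rewrite ltW// (lt_le_trans hd).
have kp : 0 < normc h.
  by rewrite lt_def k0 andbT; apply: contra h0 => /eqP/eq0_normc ->.
have [a1 _] := hP _ hd; have [b1 b2] := hQ _ hd'.
pose a := P (z + h) - P z - h *: P1; pose b := Q (z + h) - Q z - h *: Q1.
have -> : Tr ip (gr (P (z + h) * f * Q (z + h))) - Tr ip (gr (P z * f * Q z)) -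
    h * (Tr ip (gr (P1 * f * Q z)) + Tr ip (gr (P z * f * Q1))) =
    h ^+ 2 * Tr ip (gr (P1 * f * Q1)) + Tr ip (gr (a * f * Q (z + h))) +
    Tr ip (gr ((P z + h *: P1) * f * b)).
  have -> : P (z + h) * f * Q (z + h) =
      (P z * f * Q z + h *: (P1 * f * Q z + P z * f * Q1)) +
      ((h ^+ 2 *: (P1 * f * Q1) + a * f * Q (z + h)) + (P z + h *: P1) * f * b).
    apply: bopP => x; apply: (ip_inj ip) => y.
    by rewrite /a /b !(bE, bopD, bopN, bopZ) !ipE; ring.
  have s1 : summing ip (P1 * f * Q z + P z * f * Q1) by apply: summingD; exact: sM.
  have s2 : summing ip (h ^+ 2 *: (P1 * f * Q1)) by apply: summingZ; exact: sM.
  have s3 : summing ip (P z * f * Q z + h *: (P1 * f * Q z + P z * f * Q1)).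
    by apply: summingD; [exact: sM | exact: summingZ].
  have s4 : summing ip (h ^+ 2 *: (P1 * f * Q1) + a * f * Q (z + h)).
    by apply: summingD => //; exact: sM.
  have s5 := summingD s4 (sM (P z + h *: P1) b).
  rewrite (TrD s3 s5) (TrD s4 (sM _ _)) (TrD s2 (sM _ _)) (TrZ _ (sM _ _)).
  rewrite (TrD (sM _ _) (summingZ _ s1)) (TrZ _ s1) (TrD (sM _ _) (sM _ _)).
  by ring.
have k2 : 0 < normc h ^+ 2 by exact: exprn_gt0.
have kM : normc h * M <= M by rewrite ler_piMl ?(ltW M0).
have b1' : bnd (P z + h *: P1) (M + M).
  by apply: (bnd_le _ (bbndD PM (bbndZ h P1M))); rewrite lerD2l.
have t1 : normc (h ^+ 2 * Tr ip (gr (P1 * f * Q1))) <= normc h ^+ 2 * (C * M * N).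
  rewrite expr2 !normcM -expr2; apply: ler_wpM2l; first exact: ltW.
  exact: fC.
have t2 : normc (Tr ip (gr (a * f * Q (z + h)))) <= C * (M * normc h ^+ 2) * (3 * N).
  by apply: fC => //; rewrite mulr_gt0.
have t3 : normc (Tr ip (gr ((P z + h *: P1) * f * b))) <= C * (M + M) * (N * normc h ^+ 2).
  by apply: fC => //; rewrite ?addr_gt0 ?mulr_gt0.
rewrite (le_trans (le_normcD _ _))//.
apply: le_trans (lerD (le_trans (le_normcD _ _) (lerD t1 t2)) t3) _.
have -> : normc h ^+ 2 * (C * M * N) + C * (M * normc h ^+ 2) * (3 * N) +
    C * (M + M) * (N * normc h ^+ 2) =
    C * (M * N + M * (3 * N) + (M + M) * N) * normc h ^+ 2 by ring.
apply: ler_wpM2r; first exact: ltW.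
by rewrite ler_wpM2r ?lerDl// !addr_ge0 ?mulr_ge0 ?addr_ge0 ?(ltW M0) ?(ltW N0).
Qed.

Lemma quad_diffD g1 g2 z : quad_diff g1 z -> quad_diff g2 z ->
  quad_diff (fun w => g1 w + g2 w) z.
Proof.
move=> [a [M [d [d0 M0] hM]]] [b [N [d' [d0' N0] hN']]].
exists (a + b), (M + N), (Num.min d d'); first by rewrite lt_min d0 d0' addr_gt0.
move=> h h0; rewrite lt_min => /andP[/(hM _ h0) h1 /(hN' _ h0) h2].
have -> : g1 (z + h) + g2 (z + h) - (g1 z + g2 z) - h * (a + b) =
  (g1 (z + h) - g1 z - h * a) + (g2 (z + h) - g2 z - h * b) by ring.
by rewrite (le_trans (le_normcD _ _))// mulrDl lerD.
Qed.

Lemma quad_diff_cst c z : quad_diff (fun _ => c) z.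
Proof.
exists 0, 1, 1 => // h _ _; rewrite subrr sub0r mulr0 oppr0 normc0 mul1r.
exact: sqr_ge0.
Qed.

Lemma quad_diff_sum n (g : nat -> R[i] -> R[i]) z :
  (forall i, (i < n)%N -> quad_diff (g i) z) ->
  quad_diff (fun w => \sum_(i < n) g i w) z.
Proof.
elim: n => [|n IH] h.
  have -> : (fun w => \sum_(i < 0) g i w) = (fun _ => 0).
    by apply/funext => w; rewrite big_ord0.
  exact: quad_diff_cst.
have -> : (fun w => \sum_(i < n.+1) g i w) = (fun w => \sum_(i < n) g i w + g n w).
  by apply/funext => w; rewrite big_ord_recr.
by apply: quad_diffD; [apply: IH => i ilt; apply: h; exact: ltnW | exact: h].
Qed.

Lemma quad_diff_local g1 g2 z (d : R) : 0 < d -> g1 z = g2 z ->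
  (forall h, normc h < d -> g1 (z + h) = g2 (z + h)) -> quad_diff g1 z -> quad_diff g2 z.
Proof.
move=> d0 gz gE [a [M [d' [d0' M0] hM]]]; exists a, M, (Num.min d d').
  by rewrite lt_min d0 d0'.
by move=> h h0; rewrite lt_min => /andP[/gE <- hd]; rewrite -gz; exact: hM.
Qed.

Lemma quad_diff_derivable g z : quad_diff g z -> derivable (g : R[i]^o -> R[i]^o) z 1.
Proof.
move=> [a [M [d [d0 M0] hM]]]; apply/cvg_ex; exists a; apply/cvgrPdist_le => e e0.
have re : 0 < complex.Re e by move: e0; rewrite ltcE => /andP[].
have eE : e = (complex.Re e)%:C by rewrite RRe_real// realE ltW.
have k0 : 0 < (Num.min d (complex.Re e / M))%:C :> R[i].
  by rewrite ltcR lt_min d0 divr_gt0.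
near=> h.
have h0 : h != 0 by near: h; exact: nbhs_dnbhs_neq.
have hk : `|h| < (Num.min d (complex.Re e / M))%:C by near: h; exact: dnbhs0_lt.
move: hk; rewrite normC_normc ltcR lt_min => /andP[hd he].
have -> : a - h^-1 *: ((g \o shift z) (h *: 1) - g z) =
    - (h^-1 * (g (z + h) - g z - h * a)).
  rewrite /= -[h *: 1]/(h * 1) mulr1 [h + z]addrC.
  rewrite -[h^-1 *: _]/(h^-1 * _).
  by field.
rewrite normrN normC_normc eE lecR normcM normcV.
have kp : 0 < normc h.
  by rewrite lt_def normc_ge0 andbT; apply: contra h0 => /eqP/eq0_normc ->.
rewrite ler_pdivrMl//; apply: le_trans (hM _ h0 hd) _.
rewrite expr2 mulrCA; apply: ler_wpM2l; first exact: ltW.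
by rewrite mulrC -ler_pdivlMr// ltW.
Unshelve. all: by end_near.
Qed.

End Holomorphy.

(** * Resolvents of the two Laplacians *)

Section Factorization.
Variables (R : realType) (H : completeNormedModType R[i]).
Variable ip : {dot H for Num.conj}.
Context {ipH : hilbert ip}.
Local Notation bop := (bop H).

Lemma badjX_sa (f : bop) n : badj ip f = f -> badj ip (f ^+ n) = f ^+ n.
Proof. by move=> fs; rewrite badjX fs. Qed.

Lemma injX (f : bop) n : injective f -> injective (f ^+ n).
Proof.
move=> fi; elim: n => [|n IH] x y; first by rewrite !bopX0.
by rewrite !bopXS => /fi /IH.
Qed.

Variables (G1 G2 : set (H * H)) (f r : bop) (n0 : nat).
Hypotheses (pG1 : nonneg_sa ip G1) (pG2 : nonneg_sa ip G2) (G12 : dom G1 = dom G2).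
Hypothesis G12f : forall x u v, G1 (x, u) -> G2 (x, v) -> f x = u - v.

(** The second resolvent identity; the equality of the domains lets [G2] be
    applied to the range of the resolvent of [G1]. *)
Lemma res_difference z : @slit_plane R z ->
  res G2 z - res G1 z = res G2 z * f * res G1 z.
Proof.
move=> sz; apply: bopP => y; rewrite bopBE !bopME.
have /(_ ipH) Gy := res_in pG1 y sz; set x := res G1 z y in Gy *.
have [v Gv] : dom G2 x by rewrite -G12; exists (y - z *: x).
have fx := G12f Gy Gv.
have yE : y = (z *: x + v) + f x by rewrite fx; apply: (ip_inj ip) => w; rewrite !ipE; ring.
by rewrite {1}yE bopD (resK pG2 sz Gv) addrC addKr.
Qed.

(** The factor of each term of the telescoping sum which does not depend on
    [z]. *)
Definition core_term n i : bop := res G2 1 ^+ i.+1 * f * res G1 1 ^+ (n - i).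

Lemma res_power_difference z n : @slit_plane R z ->
  res G2 z ^+ n - res G1 z ^+ n =
  \sum_(i < n) res_shift G2 z ^+ i.+1 * core_term n i * res_shift G1 z ^+ (n - i).
Proof.
move=> sz; rewrite bop_subrXX; apply: eq_bigr => -[i /= ilt] _.
rewrite (res_difference sz) /core_term.
have -> : (n - i = (n.-1 - i).+1)%N by case: n ilt => //= n ilt; rewrite subSn.
set m := (n.-1 - i)%N.
have e2 : res_shift G2 z ^+ i.+1 * res G2 1 ^+ i.+1 = res G2 z ^+ i.+1.
  rewrite -exprMn_comm; first by rewrite -(res_shiftE pG2 sz).
  by apply: commr_sym; exact: res_shift_comm.
have e1 : res G1 1 ^+ m.+1 * res_shift G1 z ^+ m.+1 = res G1 z ^+ m.+1.
  rewrite -exprMn_comm; last exact: res_shift_comm.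
  by rewrite (res_shift_comm pG1 sz) -(res_shiftE pG1 sz).
rewrite !mulrA e2 -[RHS]mulrA e1 exprSr exprS !mulrA.
by [].
Qed.

(** In the intended use [r] is the resolvent of the unperturbed operator at [1]. *)
Hypothesis rs : badj ip r = r.
Hypothesis ri : injective r.
Hypothesis rG1 : forall k x, exists v, (res G1 1 ^+ k) x = (r ^+ k) v.
Hypothesis rG2 : forall k x, exists v, (res G2 1 ^+ k) x = (r ^+ k) v.
Hypothesis n00 : (0 < n0)%N.
Hypothesis tr : forall i, (i < n0)%N -> summing ip (r ^+ i.+1 * f * r ^+ (n0 - i)).

(** The ranges of the powers of the perturbed resolvents lie in those of [r], so
    that [res G1 1 ^+ k = r ^+ k * T1], and dually on the left. The choice
    [j = min (i, n0 - 1)] makes the exponents [j + 1 <= i + 1] and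
    [n0 - j <= n - i]; the surplus of resolvents is bounded. *)
Lemma summing_core_term n i : (n0 <= n)%N -> (i < n)%N -> summing ip (core_term n i).
Proof.
move=> n0n ilt; pose j := minn i n0.-1.
have jn : (j < n0)%N by rewrite /j; case: n0 n00 => // m _; rewrite ltnS geq_minr.
have ji : (j <= i)%N by exact: geq_minl.
have jb : (n0 - j <= n - i)%N by rewrite /j; lia.
have /(_ ipH) [T1 e1] := range_factor (badjX_sa (n0 - j) rs) (injX (n := n0 - j) ri) (rG1 (n0 - j)).
have /(_ ipH) [T2 e2] := range_factor (badjX_sa j.+1 rs) (injX (n := j.+1) ri) (rG2 j.+1).
have e2' : res G2 1 ^+ j.+1 = badj ip T2 * r ^+ j.+1.
  have := congr1 (badj ip) e2; rewrite badjM (badjX_sa j.+1 rs).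
  by rewrite badjX_sa//; exact: res1_adj.
have -> : core_term n i = (res G2 1 ^+ (i - j) * badj ip T2) *
    (r ^+ j.+1 * f * r ^+ (n0 - j)) * (T1 * res G1 1 ^+ (n - i - (n0 - j))).
  have -> : core_term n i = (res G2 1 ^+ (i - j) * res G2 1 ^+ j.+1) * f *
      (res G1 1 ^+ (n0 - j) * res G1 1 ^+ (n - i - (n0 - j))).
    by rewrite /core_term -!exprD addnS subnK// subnKC.
  by rewrite e1 e2' !mulrA.
by apply: summingM; exact: tr.
Qed.

Lemma summing_res_power_difference z n : (n0 <= n)%N -> @slit_plane R z ->
  summing ip (res G2 z ^+ n - res G1 z ^+ n).
Proof.
move=> n0n sz; rewrite (res_power_difference n sz).
apply: (summing_sum (F := fun i => res_shift G2 z ^+ i.+1 * core_term n i *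
  res_shift G1 z ^+ (n - i))) => i ilt.
by apply: summingM; exact: summing_core_term.
Qed.

(** In the telescoping sum only the bounded factors depend on the parameter. *)
Lemma quad_diff_res_power n z : (n0 <= n)%N -> @slit_plane R z ->
  quad_diff (fun w => Tr ip (gr (res G2 w ^+ n - res G1 w ^+ n))) z.
Proof.
move=> n0n sz; have [d d0 sd] := slit_open sz.
pose g w := \sum_(i < n) Tr ip (gr (res_shift G2 w ^+ i.+1 * core_term n i *
   res_shift G1 w ^+ (n - i))).
have gE w : @slit_plane R w -> g w = Tr ip (gr (res G2 w ^+ n - res G1 w ^+ n)).
  move=> sw; rewrite (res_power_difference n sw).
  rewrite (Tr_sum_ord (F := fun i => res_shift G2 w ^+ i.+1 * core_term n i *
     res_shift G1 w ^+ (n - i)))// => i ilt.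
  by apply: summingM; exact: summing_core_term.
apply: (quad_diff_local d0 (gE z sz)) => [h /sd|]; first exact: gE.
apply: (quad_diff_sum (g := fun i w => Tr ip (gr (res_shift G2 w ^+ i.+1 *
   core_term n i * res_shift G1 w ^+ (n - i))))) => i ilt.
apply: quad_diff_Tr; first exact: summing_core_term.
  by apply: (opdiffX ip (P := res_shift G2)); exact: opdiff_shift.
by apply: (opdiffX ip (P := res_shift G1)); exact: opdiff_shift.
Qed.

End Factorization.

(** * The homological index *)

Section Assumptions.
Variables (R : realType) (H : completeNormedModType R[i]).
Variable ip : {dot H for Num.conj}.
Context {ipH : hilbert ip}.
Local Notation bop := (bop H).

(** Invariance of the scale is part of the assumption for [a]; for its adjoint it
    comes from the boundedness of the iterated commutators. *)
Lemma OP0_scale G (a : bop) : nonneg_sa ip G -> OP0 ip G (gr a) ->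
  let S := opsqrt ip G in
  (forall m x, scale S m x -> scale S m (a x)) /\
  (forall m x, scale S m x -> scale S m (badj ip a x)).
Proof.
move=> pG [_ aG] S; have /(_ ipH) [saS _ SS] := opsqrtP pG; rewrite -/S in saS SS.
have /(_ ipH) cS := selfadjoint_closed_dense saS; have [_ _ aS] := saS.
have nS : normal_root ip S G by split=> //; rewrite aS.
have a0 m x : scale S m x -> scale S m (a x).
  case: m => [|m] mx; first exact: scale0.
  by have [/(_ x (a x) mx) h _] := aG m.+1 isT; apply: h.
split=> //.
have /choice[B BC] k : exists b : bop, (k = 0%N -> b = a) /\ iter_comm S k (gr a) `<=` gr b.
  case: k => [|k]; first by exists a; split=> // x.
  have [_ [T /bounded_opP[b ->] aT]] := aG k.+1 isT.
  by exists b.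
have B0 : B 0%N = a by have [->] := BC 0%N.
have := smooth_adj_scale pG nS aS (B := B); rewrite B0 => /(_ ipH a0 (fun k => (BC k).2) 0%N).
by rewrite B0 => h m x; exact: h.
Qed.

(** Without a bounded extension [bounded_ext C] would be the empty graph, and the
    product would have an empty domain. *)
Lemma bounded_ext_gr (S T C : set (H * H)) : bounded_op (S * bounded_ext C * T)%op ->
  exists2 f : bop, bounded_ext C = gr f & C `<=` gr f.
Proof.
move=> [_ dT _]; rewrite /bounded_ext in dT *; case: xgetP dT => [B _ [/bounded_opP[f ->] Cf] _|_ dT].
  by exists f.
have : dom (S * set0 * T)%op (0 : H) by rewrite dT.
by move=> [y [u _ [v []]]].
Qed.

End Assumptions.

Lemma derivable_exprM (K : numFieldType) (h : K -> K) (z : K) n :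
  derivable (h : K^o -> K^o) z 1 ->
  derivable ((fun w => w ^+ n * h w) : K^o -> K^o) z 1.
Proof.
move=> dh; elim: n => [|n IH].
  by rewrite (_ : (fun w => _) = h)//; apply/funext => w; rewrite mul1r.
rewrite (_ : (fun w => _) = (fun w : K^o => w : K^o) * (fun w => w ^+ n * h w)).
  by apply: derivableM.
by apply/funext => w /=; rewrite exprS mulrA.
Qed.

(** Instantiating the field here keeps unification away from the structures
    inherited by [R[i]]. *)
Lemma derivable_exprM_complex (R : realType) (h : R[i] -> R[i]) (z : R[i]) n :
  derivable (h : R[i]^o -> R[i]^o) z 1 ->
  derivable ((fun w => w ^+ n * h w) : R[i]^o -> R[i]^o) z 1.
Proof. exact: derivable_exprM. Qed.

Theorem theorem3p1 (R : realType) (H : completeNormedModType R[i])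
    (ip : {dot H for Num.conj}) (norm_ip : forall x : H, `|x| ^+ 2 = ip x x)
    (Dp A : set (H * H)) :
  let Dm := adj ip Dp in
  let As := adj ip A in
  is_operator Dp -> closed Dp -> dense (dom Dp) ->
  bounded_op A ->
  normal_op ip Dp ->
  maps_into_itself A (dom Dp) -> maps_into_itself As (dom Dp) ->
  extends_to_bounded ([comm Dp, As] + [comm A, Dm])%op ->
  let cDp := (Dp + A)%op in
  let cDm := adj ip cDp in
  let Delta := (Dp * Dm)%op in
  let Delta1 := (cDp * cDm)%op in
  let Delta2 := (cDm * cDp)%op in
  let F := bounded_ext (cDp * cDm - cDm * cDp)%op in
  OP0 ip Delta A ->
  forall n0 : nat, (0 < n0)%N ->
  (forall i : nat, (i < n0)%N ->
    trace_class ip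
      ((1%:Op + Delta) ^- i.+1 * F * (1%:Op + Delta) ^- (n0 - i)%N)%op) ->
  (forall (n : nat) (lam : R), (n0 <= n)%N -> 0 < lam ->
    HInd_exists ip n (Tlam ip cDp lam)) /\
  (forall n : nat, (n0 <= n)%N ->
    let G (z : R[i]) :=
      ((z%:Op + Delta2) ^- n - (z%:Op + Delta1) ^- n)%op in
    let f (z : R[i]) : R[i] := z ^+ n * Tr ip (G z) in
    [/\ forall z, @slit_plane R z -> trace_class ip (G z),
        holomorphic_on (@slit_plane R) f
      & forall lam : R, 0 < lam ->
          f lam%:C = HInd ip n (Tlam ip cDp lam)]).
Proof.
have ipH : hilbert ip := norm_ip.
move=> Dm As oD cD dD bA nD _ _ _ cDp cDm Delta Delta1 Delta2 F aO n0 n00 tF.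
have [a Aa] := bounded_opP bA.
have cDp0 : closed_dense ip Dp.
  split=> //; first exact: closed_closedg.
  by apply: adherent_total; apply/dense_adherent.
have pG : nonneg_sa ip Delta by rewrite /Delta nD; exact: square_nonneg_sa.
have nDp : normal_root ip Dp Delta by split=> //; rewrite /Delta nD.
have /(_ ipH) nDm := normal_root_adj nDp.
pose S := opsqrt ip Delta.
have /(_ ipH) [saS _ SS] := opsqrtP pG; rewrite -/S in saS SS.
have /(_ ipH) cS := selfadjoint_closed_dense saS; have [_ _ aS] := saS.
have nS : normal_root ip S Delta by split=> //; rewrite aS.
rewrite Aa in aO; have /(_ ipH) [a0 a0'] := OP0_scale pG aO.
have cDpE : cDp = (Dp + gr a)%op by rewrite /cDp Aa.
have cDmE : cDm = (Dm + gr (badj ip a))%op by rewrite /cDm cDpE adj_perturb.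
have ccDp : closed_dense ip cDp by rewrite cDpE; exact: closed_dense_perturb nDp.
have adjDm : adj ip cDm = cDp by exact: closed_dense_adjK.
have a0'' m x : scale S m x -> scale S m (badj ip (badj ip a) x) by rewrite badjK; exact: a0.
have p2 : nonneg_sa ip Delta2 by exact: square_nonneg_sa.
(* [Delta1] is also of the form [T^* T], for the perturbation [D_- + A^*] of the
   normal operator [D_-]; this makes the two Laplacians instances of one case. *)
have D1E : Delta1 = (adj ip cDm * cDm)%op by rewrite adjDm.
have p1 : nonneg_sa ip Delta1 by rewrite D1E; apply: square_nonneg_sa; exact: closed_dense_adj.
have dom2 : dom Delta2 = dom Delta.
  by rewrite /Delta2 /cDm cDpE; exact: (perturb_dom pG nS).
have dom1 : dom Delta1 = dom Delta.
  by rewrite D1E cDmE; exact: (perturb_dom pG nS).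
pose r := res Delta 1.
have r2 k x : exists v, (res Delta2 1 ^+ k) x = (r ^+ k) v.
  by rewrite /Delta2 /cDm cDpE; exact: (perturb_res_range pG nS).
have r1 k x : exists v, (res Delta1 1 ^+ k) x = (r ^+ k) v.
  by rewrite D1E cDmE; exact: (perturb_res_range pG nS).
(* The case [i = 0] of the trace class assumption shows that [F] is an operator. *)
have [f FE Ff] : exists2 f : bop H, F = gr f & (Delta1 - Delta2)%op `<=` gr f.
  by have [bF _] := tF 0%N n00; exact: bounded_ext_gr bF.
have fD x u v : Delta1 (x, u) -> Delta2 (x, v) -> f x = u - v.
  move=> xu xv; have : (Delta1 - Delta2)%op (x, u - v).
    by exists u, ((-1) *: v); rewrite scaleN1r; split=> //; exists v => //; rewrite scaleN1r.
  by move/Ff => /= <-.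
have tr i : (i < n0)%N -> summing ip (r ^+ i.+1 * f * r ^+ (n0 - i)).
  move=> /tF; rewrite FE (opinv_res pG (@slit1 R)) !oppow_gr !opmul_gr.
  exact: trace_class_summing.
have G12 : dom Delta1 = dom Delta2 by rewrite dom1 dom2.
have /(_ ipH) rs := res1_adj pG; have /(_ ipH) ri := res1_inj pG.
have sm n z : (n0 <= n)%N -> @slit_plane R z ->
    summing ip (res Delta2 z ^+ n - res Delta1 z ^+ n).
  by apply: (summing_res_power_difference p1 p2 G12 fD rs ri r1 r2 n00 tr).
have GE n z : @slit_plane R z -> ((z%:Op + Delta2) ^- n - (z%:Op + Delta1) ^- n)%op
    = gr (res Delta2 z ^+ n - res Delta1 z ^+ n).
  by move=> sz; rewrite (opinv_res p1 sz) (opinv_res p2 sz) !oppow_gr opsub_gr.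
have hE n (lam : R) : 0 < lam -> hind_op ip n (Tlam ip cDp lam) =
    gr (lam%:C ^+ n *: (res Delta2 lam%:C ^+ n - res Delta1 lam%:C ^+ n)).
  move=> lam0; have [T [-> e2 e1]] := Tlam_bop ccDp lam0.
  rewrite /hind_op adj_gr !opmul_gr opcst_gr scale1r !opsub_gr !oppow_gr opsub_gr.
  by rewrite e1 e2 !bop_exprZ scalerBr.
split=> [n lam n0n lam0|n n0n G g].
  split; first by have [T [-> _ _]] := Tlam_bop ccDp lam0; exact: gr_bounded.
  rewrite hE//; apply: summing_trace_class; apply: summingZ; apply: sm => //.
  exact: slit_real.
split=> [z sz|z sz|lam lam0].
- by rewrite /G GE//; apply: summing_trace_class; exact: sm.
- have dG : derivable ((fun w => Tr ip (G w)) : R[i]^o -> R[i]^o) z 1.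
    apply: quad_diff_derivable; have [d d0 sd] := slit_open sz.
    apply: (quad_diff_local d0 _ _ (quad_diff_res_power p1 p2 G12 fD rs ri r1 r2 n00 tr n0n sz)) => [|h /sd sh].
      by rewrite /G GE.
    by rewrite /G GE.
  by have := @derivable_exprM_complex R (fun w => Tr ip (G w)) z n dG; exact.
- rewrite /g /G GE ?hE//; last exact: slit_real.
  by rewrite /HInd hE// TrZ//; apply: sm => //; exact: slit_real.
Qed.
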